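(* Let $A$ be a Noetherian ring, $x=(x_1,\dots,x_n)$, $F_1,\dots,F_m\in\langle x\rangle A[[x]]$, $I=\langle F_1,\dots,F_m\rangle\subset A[[x]]$ and $B:=A[[x]]/I$. Assume that the canonical map $\phi:A\to B$ is flat. For $\mathfrak p\in\operatorname{Spec}A$ let $\mathfrak n_{\mathfrak p}=\langle x,\mathfrak p\rangle\in\operatorname{Spec}B$, and denote by $$\operatorname{Sing}_\sigma(\phi):=\{\mathfrak n_{\mathfrak p}\in\operatorname{Spec}B\mid \mathfrak p\in\operatorname{Spec}A,\ B_{\mathfrak n_{\mathfrak p}}\text{ is not }\mathfrak n_{\mathfrak p}\text{-smooth over }A_{\mathfrak p}\}$$ the singular locus of $\phi$ along the section $\sigma:\operatorname{Spec}A\to\operatorname{Spec}B$, $\mathfrak p\mapsto\mathfrak n_{\mathfrak p}$. Then $$\operatorname{Sing}_\sigma(\phi)=\{\mathfrak n_{\mathfrak p}\in\operatorname{Spec}B\mid \mathfrak p\in\operatorname{Spec}A,\ \hat B(\mathfrak p)\text{ is not regular}\}.$$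
   Context: Rings are commutative with unit. For $\mathfrak p\in\operatorname{Spec}A$, $k(\mathfrak p)=A_{\mathfrak p}/\mathfrak pA_{\mathfrak p}$, and $\hat B(\mathfrak p)=k(\mathfrak p)[[x]]/\hat I(\mathfrak p)$ is the completed fibre of $\phi$ over $\mathfrak p$, where $\hat I(\mathfrak p)$ is the ideal generated by the images of $F_1,\dots,F_m$ in $k(\mathfrak p)[[x]]$. The ideal $\mathfrak n_{\mathfrak p}$ of $B$ generated by $x_1,\dots,x_n$ and $\mathfrak p$ is prime and lies over $\mathfrak p$. Formal smoothness: for a ring $C_0$, a $C_0$-algebra $D$ and an ideal $J\subset D$, $D$ is $J$-smooth over $C_0$ (formally smooth with respect to the $J$-adic topology) if for every $C_0$-algebra $C$, every ideal $N\subset C$ with $N^2=0$ and every $C_0$-algebra homomorphism $u:D\to C/N$ with $u(J^k)=0$ for some $k$, there is a $C_0$-algebra homomorphism $D\to C$ lifting $u$. ''$B_{\mathfrak n_{\mathfrak p}}$ is $\mathfrak n_{\mathfrak p}$-smooth over $A_{\mathfrak p}$'' means with respect to the ideal $\mathfrak n_{\mathfrak p}B_{\mathfrak n_{\mathfrak p}}$. *)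

(* Defs.v *)
(* Rings are comPzRingType rather than comNzRingType, so that the zero ring,   *)
(* and quotients by the unit ideal, are rings.                                 *)
From HB Require Import structures.
From mathcomp Require Import all_boot all_algebra.
From mathcomp Require Import boolp classical_sets.
From mathcomp.multinomials Require Import mpoly.
From mathcomp Require Import ring zify.

Set Implicit Arguments.
Unset Strict Implicit.
Unset Printing Implicit Defensive.

Import GRing.Theory.

Local Open Scope ring_scope.
Local Open Scope classical_set_scope.
Local Open Scope quotient_scope.

(* MathComp's idealr only covers proper ideals; here the unit ideal is an      *)
(* ideal as well.                                                              *)
Definition is_ideal (R : comPzRingType) (I : set R) : Prop :=
  [/\ I 0, forall x y, I x -> I y -> I (x + y) & forall a x, I x -> I (a * x)].

Record ideal (R : comPzRingType) := Ideal {
  ideal_set :> set R;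
  ideal_setP : is_ideal ideal_set
}.

Section IdealTheory.
Variable R : comPzRingType.
Implicit Types (I J : ideal R) (X : set R).

Lemma ideal0 I : ideal_set I 0. Proof. by case: I => I []. Qed.

Lemma idealD I x y : ideal_set I x -> ideal_set I y -> ideal_set I (x + y).
Proof. by case: I => I [] /= _ + _; apply. Qed.

Lemma idealM I a x : ideal_set I x -> ideal_set I (a * x).
Proof. by case: I => I [] /= _ _; apply. Qed.

Lemma idealN I x : ideal_set I x -> ideal_set I (- x).
Proof. by move=> Ix; rewrite -mulN1r; apply: idealM. Qed.

Lemma idealB I x y : ideal_set I x -> ideal_set I y -> ideal_set I (x - y).
Proof. by move=> Ix /idealN; apply: idealD. Qed.

Lemma ideal_sum I (K : finType) (G : K -> R) :
  (forall k, ideal_set I (G k)) -> ideal_set I (\sum_k G k).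
Proof.
by move=> IG; apply: big_ind => //; [apply: ideal0 | apply: idealD].
Qed.

Lemma smallest_idealP X : is_ideal (smallest (@is_ideal R) X).
Proof.
split=> [J [[J0 _ _] _] //|x y Ix Iy J JX|a x Ix J JX].
  by case: (JX) => [[_ JD _] _]; apply: JD; [apply: Ix | apply: Iy].
by case: (JX) => [[_ _ JM] _]; apply: JM; apply: Ix.
Qed.

Definition ideal_gen X : ideal R := Ideal (smallest_idealP X).

Lemma ideal_gen_sub X : X `<=` ideal_gen X.
Proof. by move=> x Xx J [_]; apply. Qed.

Lemma ideal_gen_min X I : X `<=` I -> ideal_gen X `<=` I.
Proof. by move=> XI x; apply; split=> //; apply: ideal_setP. Qed.

Fixpoint ideal_exp I (k : nat) : ideal R :=
  if k is k'.+1 then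
    ideal_gen [set z | exists x y, [/\ ideal_set I x,
                                       ideal_set (ideal_exp I k') y & z = x * y]]
  else ideal_gen [set 1].

Definition finitely_generated I : Prop :=
  exists (d : nat) (g : 'I_d -> R), ideal_set I = ideal_gen (range g).

Definition maximal_ideal I : Prop :=
  ~ ideal_set I 1 /\
  forall J, I `<=` J -> ideal_set J = I \/ ideal_set J = setT.

End IdealTheory.

Definition noetherian (R : comPzRingType) : Prop :=
  forall I : ideal R, finitely_generated I.

Record Spec (R : comPzRingType) := PrimeIdeal {
  spec_ideal :> ideal R;
  spec_proper : ~ ideal_set spec_ideal 1;
  spec_prime : forall x y, ideal_set spec_ideal (x * y) ->
    ideal_set spec_ideal x \/ ideal_set spec_ideal y
}.

Definition prime_chain (R : comPzRingType) (d : nat) : Prop :=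
  exists P : 'I_d.+1 -> Spec R,
    forall i j : 'I_d.+1, (i < j)%N ->
      ideal_set (P i) `<` ideal_set (P j).

Definition krull_dim_eq (R : comPzRingType) (d : nat) : Prop :=
  prime_chain R d /\ forall e, prime_chain R e -> (e <= d)%N.

Definition regular_local_ring (R : comPzRingType) : Prop :=
  noetherian R /\
  exists M : ideal R,
    [/\ maximal_ideal M,
        forall M' : ideal R, maximal_ideal M' -> ideal_set M' = M &
        exists2 d, krull_dim_eq R d &
          exists g : 'I_d -> R, ideal_set M = ideal_gen (range g)].

Section QuotientRing.
Variables (R : comPzRingType) (I : ideal R).

Definition idealb : {pred R} := fun x => `[< ideal_set I x >].

Lemma idealb_zmod_closed : zmod_closed idealb.
Proof.
split=> [|x y]; rewrite /in_mem /= /idealb; first exact/asboolP/ideal0.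
by move=> /asboolP Ix /asboolP Iy; apply/asboolP/idealB.
Qed.

HB.instance Definition _ := GRing.isZmodClosed.Build R idealb idealb_zmod_closed.

Definition quot_ring := Quotient.quot (idealb : zmodClosed R).

HB.instance Definition _ := GRing.Zmodule.on quot_ring.
HB.instance Definition _ : EqQuotient R (Quotient.equiv (idealb : zmodClosed R)) quot_ring :=
  EqQuotient.on quot_ring.

Lemma quot_ring_eq x y : (\pi_quot_ring x = \pi_quot_ring y) <-> ideal_set I (x - y).
Proof.
split=> [/eqP|Ixy].
  by rewrite -[_ == _]Quotient.idealrBE => /asboolP.
by apply/eqP; rewrite -[_ == _]Quotient.idealrBE; apply/asboolP.
Qed.

Definition quot_one : quot_ring := lift_cst quot_ring 1.
Definition quot_mul := lift_op2 quot_ring (fun x y : R => x * y).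

Lemma pi_quot_mul x y :
  quot_mul (\pi_quot_ring x) (\pi_quot_ring y) = \pi_quot_ring (x * y).
Proof.
unlock quot_mul; apply/quot_ring_eq; rewrite -[_ * _](addrNK (x * repr (\pi_quot_ring y))).
rewrite -mulrBl -addrA -mulrBr; apply: idealD.
  by rewrite mulrC; apply: idealM; apply/quot_ring_eq; rewrite reprK.
by apply: idealM; apply/quot_ring_eq; rewrite reprK.
Qed.

Lemma pi_quot_add x y :
  \pi_quot_ring x + \pi_quot_ring y = \pi_quot_ring (x + y).
Proof. exact/esym/Quotient.pi_add. Qed.

Lemma quot_mulA : associative quot_mul.
Proof.
by move=> x y z; rewrite -[x]reprK -[y]reprK -[z]reprK !pi_quot_mul mulrA.
Qed.

Lemma quot_mulC : commutative quot_mul.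
Proof.
by move=> x y; rewrite -[x]reprK -[y]reprK !pi_quot_mul mulrC.
Qed.

Lemma quot_mul1 : left_id quot_one quot_mul.
Proof.
by move=> x; rewrite -[x]reprK /quot_one; unlock; rewrite pi_quot_mul mul1r.
Qed.

Lemma quot_mulDl : left_distributive quot_mul +%R.
Proof.
move=> x y z; rewrite -[x]reprK -[y]reprK -[z]reprK.
by rewrite pi_quot_add !pi_quot_mul pi_quot_add mulrDl.
Qed.

HB.instance Definition _ := GRing.Zmodule_isComPzRing.Build quot_ring
  quot_mulA quot_mulC quot_mul1 quot_mulDl.

Definition quot_proj (x : R) : quot_ring := \pi_quot_ring x.

Lemma quot_proj_is_zmod_morphism : zmod_morphism quot_proj.
Proof. by move=> x y; rewrite -[LHS]/(\pi_quot_ring _) Quotient.pi_add Quotient.pi_opp. Qed.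

Lemma quot_proj_is_monoid_morphism : monoid_morphism quot_proj.
Proof. 
split=> [|x y]; last exact/esym/pi_quot_mul.
by rewrite -[RHS]/quot_one /quot_one; unlock.
Qed.

HB.instance Definition _ :=
  GRing.isZmodMorphism.Build R quot_ring quot_proj quot_proj_is_zmod_morphism.
HB.instance Definition _ :=
  GRing.isMonoidMorphism.Build R quot_ring quot_proj quot_proj_is_monoid_morphism.

End QuotientRing.

Record mulset (R : comPzRingType) := MulSet {
  mulset_set :> set R;
  mulset1 : mulset_set 1;
  mulsetM : forall s t, mulset_set s -> mulset_set t -> mulset_set (s * t)
}.

Section Localization.
Variables (R : comPzRingType) (S : mulset R).

Record fraction := Fraction {
  num : R;
  den : R;
  denP : mulset_set S den
}.

HB.instance Definition _ := gen_eqMixin fraction.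
HB.instance Definition _ := gen_choiceMixin fraction.

Definition frac_equiv (x y : fraction) : bool :=
  `[< exists2 u, mulset_set S u & u * (num x * den y) = u * (num y * den x) >].

Lemma frac_equiv_is_equiv : equiv_class_of frac_equiv.
Proof.
split=> [x|x y|y x z]; rewrite /frac_equiv.
- by apply/asboolP; exists 1 => //; apply: mulset1.
- by apply/asbool_equiv_eq; split=> -[u Su e]; exists u.
move=> /asboolP[u Su e] /asboolP[v Sv e']; apply/asboolP.
exists (u * v * den y); first by do !apply: mulsetM => //; apply: denP.
transitivity (v * den z * (u * (num x * den y))); first by ring.
rewrite e; transitivity (u * den x * (v * (num y * den z))); first by ring.
by rewrite e'; ring.
Qed.

Canonical frac_equiv_equiv := EquivRelPack frac_equiv_is_equiv.
Canonical frac_equiv_encModRel := defaultEncModRel frac_equiv.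

Definition localization := {eq_quot frac_equiv}.

HB.instance Definition _ : EqQuotient fraction frac_equiv localization :=
  EqQuotient.on localization.
HB.instance Definition _ := Choice.on localization.

Local Notation "\frac x" := (\pi_localization x) (at level 10).

Lemma loc_eq (x y : fraction) : (\frac x = \frac y) <->
  exists2 u, mulset_set S u & u * (num x * den y) = u * (num y * den x).
Proof. by split=> [/eqmodP/asboolP|h]; [|apply/eqmodP/asboolP]. Qed.

Definition frac_zero := Fraction 0 (mulset1 S).
Definition frac_one := Fraction 1 (mulset1 S).
Definition frac_opp x := Fraction (- num x) (denP x).
Definition frac_add x y :=
  Fraction (num x * den y + num y * den x) (mulsetM (denP x) (denP y)).
Definition frac_mul x y :=
  Fraction (num x * num y) (mulsetM (denP x) (denP y)).

Definition loc_zero := lift_cst localization frac_zero.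
Definition loc_one := lift_cst localization frac_one.
Definition loc_opp := lift_op1 localization frac_opp.
Definition loc_add := lift_op2 localization frac_add.
Definition loc_mul := lift_op2 localization frac_mul.

Lemma repr_pi (x : fraction) : exists2 u, mulset_set S u &
  u * (num (repr (\frac x)) * den x) = u * (num x * den (repr (\frac x))).
Proof. by apply/loc_eq; rewrite reprK. Qed.

Lemma pi_loc_opp x : loc_opp (\frac x) = \frac (frac_opp x).
Proof.
unlock loc_opp; have [u Su e] := repr_pi x; apply/loc_eq; exists u => //=.
by rewrite !mulNr !mulrN e.
Qed.

Lemma pi_loc_add x y : loc_add (\frac x) (\frac y) = \frac (frac_add x y).
Proof.
unlock loc_add; have [u Su e] := repr_pi x; have [v Sv e'] := repr_pi y.
apply/loc_eq; exists (u * v) => /=; first exact: mulsetM.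
set x' := repr _ in e *; set y' := repr _ in e' *.
transitivity (u * (num x' * den x) * (v * den y' * den y)
  + v * (num y' * den y) * (u * den x' * den x)); first by ring.
by rewrite e e'; ring.
Qed.

Lemma pi_loc_mul x y : loc_mul (\frac x) (\frac y) = \frac (frac_mul x y).
Proof.
unlock loc_mul; have [u Su e] := repr_pi x; have [v Sv e'] := repr_pi y.
apply/loc_eq; exists (u * v) => /=; first exact: mulsetM.
set x' := repr _ in e *; set y' := repr _ in e' *.
transitivity (u * (num x' * den x) * (v * (num y' * den y))); first by ring.
by rewrite e e'; ring.
Qed.

Lemma loc_zeroE : loc_zero = \frac frac_zero. Proof. by rewrite /loc_zero; unlock. Qed.

Lemma loc_oneE : loc_one = \frac frac_one. Proof. by rewrite /loc_one; unlock. Qed.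

Let piE := (loc_zeroE, loc_oneE, pi_loc_opp, pi_loc_add, pi_loc_mul).

Lemma loc_eq1 (x y : fraction) :
  num x * den y = num y * den x -> \frac x = \frac y.
Proof. by move=> e; apply/loc_eq; exists 1; rewrite ?e //; apply: mulset1. Qed.

Lemma loc_addA : associative loc_add.
Proof.
move=> x y z; rewrite -[x]reprK -[y]reprK -[z]reprK !piE.
by apply: loc_eq1 => /=; ring.
Qed.

Lemma loc_addC : commutative loc_add.
Proof.
by move=> x y; rewrite -[x]reprK -[y]reprK !piE; apply: loc_eq1 => /=; ring.
Qed.

Lemma loc_add0 : left_id loc_zero loc_add.
Proof. by move=> x; rewrite -[x]reprK !piE; apply: loc_eq1 => /=; ring. Qed.

Lemma loc_addN : left_inverse loc_zero loc_opp loc_add.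
Proof. by move=> x; rewrite -[x]reprK !piE; apply: loc_eq1 => /=; ring. Qed.

HB.instance Definition _ := GRing.isZmodule.Build localization
  loc_addA loc_addC loc_add0 loc_addN.

Lemma loc_mulA : associative loc_mul.
Proof.
move=> x y z; rewrite -[x]reprK -[y]reprK -[z]reprK !piE.
by apply: loc_eq1 => /=; ring.
Qed.

Lemma loc_mulC : commutative loc_mul.
Proof.
by move=> x y; rewrite -[x]reprK -[y]reprK !piE; apply: loc_eq1 => /=; ring.
Qed.

Lemma loc_mul1 : left_id loc_one loc_mul.
Proof. by move=> x; rewrite -[x]reprK !piE; apply: loc_eq1 => /=; ring. Qed.

Lemma loc_mulDl : left_distributive loc_mul loc_add.
Proof.
move=> x y z; rewrite -[x]reprK -[y]reprK -[z]reprK !piE.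
by apply: loc_eq1 => /=; ring.
Qed.

HB.instance Definition _ := GRing.Zmodule_isComPzRing.Build localization
  loc_mulA loc_mulC loc_mul1 loc_mulDl.

Definition loc_in (x : R) : localization := \frac (Fraction x (mulset1 S)).

Lemma loc_in_is_zmod_morphism : zmod_morphism loc_in.
Proof.
move=> x y; rewrite -[RHS]/(loc_add _ (loc_opp _)) !piE.
by apply: loc_eq1 => /=; ring.
Qed.

Lemma loc_in_is_monoid_morphism : monoid_morphism loc_in.
Proof.
split=> [|x y]; first by rewrite -[RHS]/loc_one piE.
rewrite -[RHS]/(loc_mul _ _) !piE.
by apply: loc_eq1 => /=; ring.
Qed.

HB.instance Definition _ :=
  GRing.isZmodMorphism.Build R localization loc_in loc_in_is_zmod_morphism.
HB.instance Definition _ :=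
  GRing.isMonoidMorphism.Build R localization loc_in loc_in_is_monoid_morphism.

End Localization.

Section LocalizationMap.
Variables (R R' : comPzRingType) (f : {rmorphism R -> R'}).
Variables (S : mulset R) (S' : mulset R').
Hypothesis fS : forall s, mulset_set S s -> mulset_set S' (f s).

Definition frac_map (x : fraction S) : fraction S' :=
  Fraction (f (num x)) (fS (denP x)).

Definition loc_map (x : localization S) : localization S' :=
  \pi_(localization S') (frac_map (repr x)).

Lemma pi_loc_map x :
  loc_map (\pi_(localization S) x) = \pi_(localization S') (frac_map x).
Proof.
have [u Su e] := repr_pi x; apply/loc_eq; exists (f u); first exact: fS.
by rewrite /= -!rmorphM e.
Qed.

Lemma loc_map_is_zmod_morphism : zmod_morphism loc_map.
Proof.
move=> x y; rewrite -[x]reprK -[y]reprK.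
rewrite -[_ - _]/(loc_add _ (loc_opp _)) pi_loc_opp pi_loc_add !pi_loc_map.
rewrite -[RHS]/(loc_add _ (loc_opp _)) pi_loc_opp pi_loc_add.
by apply: loc_eq1; rewrite /= !(rmorphD, rmorphM, rmorphN); ring.
Qed.

Lemma loc_map_is_monoid_morphism : monoid_morphism loc_map.
Proof.
split=> [|x y].
  rewrite -[1 in LHS]/(loc_one _) -[RHS]/(loc_one _) !loc_oneE pi_loc_map.
  by apply: loc_eq1; rewrite /= rmorph1; ring.
rewrite -[x]reprK -[y]reprK.
rewrite -[_ * _ in LHS]/(loc_mul _ _) pi_loc_mul !pi_loc_map.
rewrite -[RHS]/(loc_mul _ _) pi_loc_mul.
by apply: loc_eq1; rewrite /= !rmorphM; ring.
Qed.

HB.instance Definition _ := GRing.isZmodMorphism.Build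
  (localization S) (localization S') loc_map loc_map_is_zmod_morphism.
HB.instance Definition _ := GRing.isMonoidMorphism.Build
  (localization S) (localization S') loc_map loc_map_is_monoid_morphism.

End LocalizationMap.

Section LocalizationAtPrime.
Variables (R : comPzRingType) (p : Spec R).

Lemma prime_compl1 : (~` ideal_set p) 1.
Proof. exact: spec_proper. Qed.

Lemma prime_complM s t :
  (~` ideal_set p) s -> (~` ideal_set p) t -> (~` ideal_set p) (s * t).
Proof. by move=> ps pt /spec_prime[]. Qed.

Definition prime_compl : mulset R := MulSet prime_compl1 prime_complM.

Definition loc_at := localization prime_compl.
HB.instance Definition _ := GRing.ComPzRing.on loc_at.

Definition loc_at_in : {rmorphism R -> loc_at} := @loc_in R prime_compl.

Definition loc_at_ideal (I : ideal R) : ideal loc_at :=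
  ideal_gen (loc_at_in @` I).

Definition residue_field := quot_ring (loc_at_ideal p).
HB.instance Definition _ := GRing.ComPzRing.on residue_field.

Definition to_residue_field : {rmorphism R -> residue_field} :=
  @quot_proj _ (loc_at_ideal p) \o loc_at_in.

End LocalizationAtPrime.

Section Tensor.
Variables (A : comPzRingType) (M N : lmodType A).

(* The sequence [:: (x1, n1); ...; (xk, nk)] stands for the sum of the xi (x)  *)
(* ni. By tensor_Dl and tensor_0l, (- x) (x) n is the opposite of x (x) n, so  *)
(* that the quotient is the abelian group M (x)_A N and not merely a monoid.   *)
Inductive tensor_rel : seq (M * N) -> seq (M * N) -> Prop :=
| tensor_refl s : tensor_rel s s
| tensor_sym s t : tensor_rel s t -> tensor_rel t s
| tensor_trans s t u : tensor_rel s t -> tensor_rel t u -> tensor_rel s u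
| tensor_cat s s' t t' : tensor_rel s s' -> tensor_rel t t' ->
    tensor_rel (s ++ t) (s' ++ t')
| tensor_catC s t : tensor_rel (s ++ t) (t ++ s)
| tensor_Dl x y n : tensor_rel [:: (x + y, n)] [:: (x, n); (y, n)]
| tensor_Dr x n n' : tensor_rel [:: (x, n + n')] [:: (x, n); (x, n')]
| tensor_0l n : tensor_rel [:: (0, n)] [::]
| tensor_Z a x n : tensor_rel [:: (a *: x, n)] [:: (x, a *: n)].

Definition tensor_equiv (s t : seq (M * N)) : bool := `[< tensor_rel s t >].

Lemma tensor_equiv_is_equiv : equiv_class_of tensor_equiv.
Proof.
split=> [s|s t|t s u]; rewrite /tensor_equiv.
- exact/asboolP/tensor_refl.
- by apply/asbool_equiv_eq; split; apply: tensor_sym.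
by move=> /asboolP st /asboolP tu; apply/asboolP/(tensor_trans st).
Qed.

Canonical tensor_equiv_equiv := EquivRelPack tensor_equiv_is_equiv.
Canonical tensor_equiv_encModRel := defaultEncModRel tensor_equiv.

Definition tensor := {eq_quot tensor_equiv}.

HB.instance Definition _ : EqQuotient (seq (M * N)) tensor_equiv tensor :=
  EqQuotient.on tensor.
HB.instance Definition _ := Choice.on tensor.

Lemma tensor_eq s t : (\pi_tensor s = \pi_tensor t) <-> tensor_rel s t.
Proof. by split=> [/eqmodP/asboolP|h]; [|apply/eqmodP/asboolP]. Qed.

End Tensor.

Section TensorMap.
Variables (A : comPzRingType) (M M' N : lmodType A) (f : {linear M -> M'}).

Definition tensor_map (t : tensor M N) : tensor M' N :=
  \pi_(tensor M' N) [seq (f z.1, z.2) | z <- repr t].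

Lemma tensor_rel_map (s t : seq (M * N)) : tensor_rel s t ->
  @tensor_rel A M' N [seq (f z.1, z.2) | z <- s] [seq (f z.1, z.2) | z <- t].
Proof.
elim=> {s t} /=.
- by move=> s; apply: tensor_refl.
- by move=> s t _; apply: tensor_sym.
- by move=> s t u _ st _; apply: tensor_trans.
- by move=> s s' t t' _ ss' _ tt'; rewrite !map_cat; apply: tensor_cat.
- by move=> s t; rewrite !map_cat; apply: tensor_catC.
- by move=> x y n; rewrite linearD; apply: tensor_Dl.
- by move=> x n n'; apply: tensor_Dr.
- by move=> n; rewrite linear0; apply: tensor_0l.
- by move=> a x n; rewrite linearZ; apply: tensor_Z.
Qed.

Lemma pi_tensor_map s : tensor_map (\pi_(tensor M N) s) =
  \pi_(tensor M' N) [seq (f z.1, z.2) | z <- s].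
Proof. by apply/tensor_eq/tensor_rel_map/tensor_eq; rewrite reprK. Qed.

End TensorMap.

Definition flat_module (A : comPzRingType) (N : lmodType A) : Prop :=
  forall (M M' : lmodType A) (f : {linear M -> M'}),
    injective f -> injective (@tensor_map A M M' N f).

Section RestrictionOfScalars.
Variables (A B : comPzRingType) (f : {rmorphism A -> B}).

Definition restr : Type := B.
HB.instance Definition _ := GRing.Zmodule.on restr.

Definition restr_scale (a : A) (b : restr) : restr := f a * (b : B).

Lemma restr_scaleA a b v :
  restr_scale a (restr_scale b v) = restr_scale (a * b) v.
Proof. by rewrite /restr_scale rmorphM mulrA. Qed.

Lemma restr_scale1 : left_id 1 restr_scale.
Proof. by move=> v; rewrite /restr_scale rmorph1 mul1r. Qed.

Lemma restr_scaleDr : right_distributive restr_scale +%R.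
Proof. by move=> a u v; apply: mulrDr. Qed.

Lemma restr_scaleDl v : {morph restr_scale^~ v : a b / a + b}.
Proof. by move=> a b; rewrite /restr_scale rmorphD mulrDl. Qed.

HB.instance Definition _ := GRing.Zmodule_isLmodule.Build A restr
  restr_scaleA restr_scale1 restr_scaleDr restr_scaleDl.

Definition flat_morphism : Prop := flat_module restr.

End RestrictionOfScalars.

(* A C0-algebra is a commutative ring C with a ring morphism C0 -> C.          *)
Definition formally_smooth (C0 D : comPzRingType) (f : {rmorphism C0 -> D})
    (J : ideal D) : Prop :=
  forall (C : comPzRingType) (g : {rmorphism C0 -> C}) (N : ideal C),
    ideal_set (ideal_exp N 2) = [set 0] ->
  forall u : {rmorphism D -> quot_ring N},
    (forall c, u (f c) = quot_proj N (g c)) ->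
    (exists k, forall y, ideal_set (ideal_exp J k) y -> u y = 0) ->
  exists v : {rmorphism D -> C},
    (forall c, v (f c) = g c) /\ (forall y, quot_proj N (v y) = u y).

Record mpseries (n : nat) (R : comPzRingType) :=
  MPSeries { mpscoef :> 'X_{1..n} -> R }.

Section PowerSeries.
Variables (n : nat) (R : comPzRingType).
Implicit Types f g h : mpseries n R.

HB.instance Definition _ := gen_eqMixin (mpseries n R).
HB.instance Definition _ := gen_choiceMixin (mpseries n R).

Lemma mpseriesP f g : f =1 g <-> f = g.
Proof. by split=> [|->//]; case: f g => f [g] /= fg; congr MPSeries; apply/funext. Qed.

Definition mps_zero : mpseries n R := MPSeries (fun=> 0).
Definition mps_opp f : mpseries n R := MPSeries (fun m => - f m).
Definition mps_add f g : mpseries n R := MPSeries (fun m => f m + g m).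
Definition mps_const (a : R) : mpseries n R :=
  MPSeries (fun m => if m == 0%MM then a else 0).
Definition mps_var (i : 'I_n) : mpseries n R :=
  MPSeries (fun m => if m == U_(i)%MM then 1 else 0).

(* The bound on the degree of k is implied by k <= m; it only serves to make   *)
(* the index type finite.                                                      *)
Definition mps_mul f g : mpseries n R :=
  MPSeries (fun m =>
    \sum_(k : 'X_{1..n < (mdeg m).+1} | (k <= m)%MM) f k * g (m - k)%MM).

Lemma mps_addA : associative mps_add.
Proof. by move=> f g h; apply/mpseriesP => m /=; rewrite addrA. Qed.

Lemma mps_addC : commutative mps_add.
Proof. by move=> f g; apply/mpseriesP => m /=; rewrite addrC. Qed.

Lemma mps_add0 : left_id mps_zero mps_add.
Proof. by move=> f; apply/mpseriesP => m /=; rewrite add0r. Qed.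

Lemma mps_addN : left_inverse mps_zero mps_opp mps_add.
Proof. by move=> f; apply/mpseriesP => m /=; rewrite addNr. Qed.

HB.instance Definition _ := GRing.isZmodule.Build (mpseries n R)
  mps_addA mps_addC mps_add0 mps_addN.

Lemma lem_mdeg (k m : 'X_{1..n}) : (k <= m)%MM -> (mdeg k <= mdeg m)%N.
Proof. by move=> /mnm_lepP km; rewrite !mdegE; apply: leq_sum. Qed.


Lemma mps_sumE b b' m (F : 'X_{1..n} -> R) :
  (mdeg m < b)%N -> (mdeg m < b')%N ->
  \sum_(k : 'X_{1..n < b} | (k <= m)%MM) F k =
  \sum_(k : 'X_{1..n < b'} | (k <= m)%MM) F k.
Proof.
move=> mb mb'.
have e c : \sum_(k : 'X_{1..n < c} | (k <= m)%MM) F k =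
    \sum_(k <- [seq k <- [seq val k | k : 'X_{1..n < c}] | (k <= m)%MM]) F k.
  by rewrite big_filter big_image_cond.
rewrite !e; apply/perm_big/uniq_perm.
- by rewrite filter_uniq // map_inj_uniq ?enum_uniq //; apply: val_inj.
- by rewrite filter_uniq // map_inj_uniq ?enum_uniq //; apply: val_inj.
move=> k; rewrite !mem_filter; case: (boolP (k <= m)%MM) => //= km.
have d := lem_mdeg km.
have kb := leq_ltn_trans d mb; have kb' := leq_ltn_trans d mb'.
have -> : k \in [seq val k | k : 'X_{1..n < b}].
  by apply/mapP; exists (BMultinom kb); rewrite ?mem_enum.
by apply/esym/mapP; exists (BMultinom kb'); rewrite ?mem_enum.
Qed.

Lemma mps_mulE b f g m : (mdeg m < b)%N -> mps_mul f g m =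
  \sum_(k : 'X_{1..n < b} | (k <= m)%MM) f k * g (m - k)%MM.
Proof. by move=> mb; apply: (mps_sumE (fun k => f k * g (m - k)%MM)). Qed.

Lemma mps_mulC : commutative mps_mul.
Proof.
move=> f g; apply/mpseriesP => m /=.
have pr (h : 'X_{1..n}) : (mdeg (m - h) < (mdeg m).+1)%N by rewrite ltnS mdegB.
pose G (k : 'X_{1..n < (mdeg m).+1}) := BMultinom (pr k).
have inv_G (h : 'X_{1..n}) : (h <= m)%MM -> (m - (m - h))%MM = h.
  by move=> le_hm; rewrite submBA // addmC addmK.
rewrite (reindex_onto G G) /=; last first.
  by move=> h /inv_G eqh; apply/eqP; rewrite eqE /= eqh.
apply/eq_big => [h|h /andP[_ /eqP/(congr1 val) /= e]]; last by rewrite e mulrC.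
rewrite lem_subr eqE /=; apply/eqP/idP => [<-|/inv_G //]; exact: lem_subr.
Qed.

Lemma mps_mulA : associative mps_mul.
Proof.
move=> p q r; apply/mpseriesP => mi; pose b := (mdeg mi).+1.
rewrite (mps_mulC q r) (mps_mulC (mps_mul p q)) !(mps_mulE (b := b)) //.
have lt_b m : (mdeg (mi - m) < b)%N by rewrite ltnS mdegB.
have memB (mj mk : 'X_{1..n}) : (mk <= mi)%MM && (mj <= mi - mk)%MM =
    (mj + mk <= mi)%MM.
  apply/andP/mnm_lepP => [[/mnm_lepP le1 /mnm_lepP le2] i|le].
    by move: (le1 i) (le2 i); rewrite mnmBE mnmDE addnC; lia.
  by split; apply/mnm_lepP => i; move: (le i); rewrite ?mnmBE mnmDE; lia.
transitivity (\sum_(mj : 'X_{1..n < b}) \sum_(mk : 'X_{1..n < b} |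
    (mj + mk <= mi)%MM) p mj * (q (mi - (mj + mk))%MM * r mk)).
  rewrite big_mkcond; apply: eq_bigr => mj _.
  rewrite (mps_mulE (b := b)) //; case: ifP => lej.
    rewrite big_distrr; apply: eq_big => [mk|mk _].
      by rewrite addmC -memB lej.
    by rewrite submDA [r _ * _]mulrC.
  by rewrite big_pred0 // => mk; rewrite addmC -memB lej.
transitivity (\sum_(mk : 'X_{1..n < b}) \sum_(mj : 'X_{1..n < b} |
    (mj + mk <= mi)%MM) p mj * (q (mi - (mj + mk))%MM * r mk)).
  by rewrite (exchange_big_dep predT).
apply/esym; rewrite big_mkcond; apply: eq_bigr => mk _.
rewrite (mps_mulE (b := b)) //; case: ifP => lek.
  rewrite big_distrr; apply: eq_big => [mj|mj _].
    by rewrite -memB lek.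
  by rewrite /= [(mj + mk)%MM]addmC submDA; ring.
by rewrite big_pred0 // => mj; rewrite -memB lek.
Qed.

Lemma mps_mul1 : left_id (mps_const 1) mps_mul.
Proof.
move=> f; apply/mpseriesP => m /=.
have b0 : (mdeg (0%MM : 'X_{1..n}) < (mdeg m).+1)%N by rewrite mdeg0.
rewrite (bigD1 (BMultinom b0)) /=; last by apply/mnm_lepP => i; rewrite mnm0E.
rewrite eqxx mul1r subm0 big1 ?addr0 // => k /andP[_].
by rewrite eqE /= => /negPf ->; rewrite mul0r.
Qed.

Lemma mps_mulDl : left_distributive mps_mul mps_add.
Proof.
move=> f g h; apply/mpseriesP => m /=.
by rewrite -big_split; apply: eq_bigr => k _; rewrite mulrDl.
Qed.

HB.instance Definition _ := GRing.Zmodule_isComPzRing.Build (mpseries n R)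
  mps_mulA mps_mulC mps_mul1 mps_mulDl.

Lemma mps_const_is_zmod_morphism : zmod_morphism mps_const.
Proof.
by move=> a b; apply/mpseriesP => m /=; case: ifP; rewrite ?subr0.
Qed.

Lemma mps_var_mulE i f m : (mps_var i * f) m =
  if (U_(i) <= m)%MM then f (m - U_(i))%MM else 0.
Proof.
rewrite -[LHS]/(mps_mul _ _ _) (mps_mulE (b := (mdeg m).+2)) //.
case: ifP => im.
  have b1 : (mdeg (U_(i)%MM : 'X_{1..n}) < (mdeg m).+2)%N by rewrite mdeg1.
  rewrite (bigD1 (BMultinom b1)) //= eqxx mul1r big1 ?addr0 // => k /andP[_].
  by rewrite eqE /= => /negPf ->; rewrite mul0r.
apply: big1 => k km /=; case: eqP => [e|_]; last by rewrite mul0r.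
by rewrite -e km in im.
Qed.

Lemma mps_const_is_monoid_morphism : monoid_morphism mps_const.
Proof.
split=> // a b; apply/mpseriesP => m /=.
have b0 : (mdeg (0%MM : 'X_{1..n}) < (mdeg m).+1)%N by rewrite mdeg0.
rewrite (bigD1 (BMultinom b0)) /=; last by apply/mnm_lepP => i; rewrite mnm0E.
rewrite eqxx subm0 big1 ?addr0 => [|k /andP[_]].
  by case: ifP; rewrite ?mulr0.
by rewrite eqE /= => /negPf ->; rewrite mul0r.
Qed.

HB.instance Definition _ := GRing.isZmodMorphism.Build R (mpseries n R)
  mps_const mps_const_is_zmod_morphism.
HB.instance Definition _ := GRing.isMonoidMorphism.Build R (mpseries n R)
  mps_const mps_const_is_monoid_morphism.

Definition mps_coef0 f : R := f 0%MM.
Arguments mps_coef0 : simpl never.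

Lemma mps_coef0_is_zmod_morphism : zmod_morphism mps_coef0.
Proof. by []. Qed.

Lemma mps_coef0_is_monoid_morphism : monoid_morphism mps_coef0.
Proof.
split=> [|f g]; first by rewrite /mps_coef0 /= eqxx.
rewrite /mps_coef0 -[LHS]/(mps_mul _ _ _).
rewrite (mps_mulE (b := 1)) ?mdeg0 //.
have b0 : (mdeg (0%MM : 'X_{1..n}) < 1)%N by rewrite mdeg0.
rewrite (bigD1 (BMultinom b0)) /=; last by apply/mnm_lepP => i; rewrite mnm0E.
rewrite subm0 big1 ?addr0 // => k /andP[_].
by rewrite eqE /= -mdeg_eq0; have := bmdeg k; case: (mdeg _).
Qed.

HB.instance Definition _ := GRing.isZmodMorphism.Build (mpseries n R) R
  mps_coef0 mps_coef0_is_zmod_morphism.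
HB.instance Definition _ := GRing.isMonoidMorphism.Build (mpseries n R) R
  mps_coef0 mps_coef0_is_monoid_morphism.

Definition var_ideal : ideal (mpseries n R) := ideal_gen (range mps_var).

Lemma mps_sum_coef (K : finType) (G : K -> mpseries n R) m :
  (\sum_k G k) m = \sum_k G k m.
Proof. by apply: (big_morph (fun f : mpseries n R => f m)). Qed.

Lemma var_idealP f : ideal_set var_ideal f <-> mps_coef0 f = 0.
Proof.
split.
  have kerP : is_ideal [set g : mpseries n R | mps_coef0 g = 0].
    rewrite /mkset; split=> [|g h g0 h0|a g g0]; first exact: rmorph0.
      by rewrite rmorphD /= g0 h0 addr0.
    by rewrite rmorphM /= g0 mulr0.
  apply: (ideal_gen_min (I := Ideal kerP)) => _ [i _ <-] /=.
  by rewrite /mps_coef0 /= eq_sym mnm1_eq0.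
move=> f0; pose fst (m : 'X_{1..n}) := [pick i | m i != 0%N].
pose G i : mpseries n R :=
  MPSeries (fun m => if fst (m + U_(i))%MM == Some i then f (m + U_(i))%MM else 0).
have -> : f = \sum_i G i * mps_var i.
  apply/mpseriesP => m; rewrite mps_sum_coef.
  transitivity (\sum_i if fst m == Some i then f m else 0).
    rewrite /fst; case: pickP => [i mi|m0].
      rewrite (bigD1 i) //= eqxx big1 ?addr0 // => j ji.
      by case: eqP => // -[e]; rewrite e eqxx in ji.
    rewrite big1 // (_ : m = 0%MM) //.
    by apply/mnmP => i; rewrite mnm0E; have /negbFE/eqP := m0 i.
  apply: eq_bigr => i _; rewrite mulrC mps_var_mulE lep1mP.
  case: (boolP (m i != 0%N)) => mi; first by rewrite /= submK // lep1mP.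
  rewrite /fst; case: pickP => // j mj.
  by case: eqP => // -[e]; rewrite -e mj in mi.
apply: ideal_sum => i; apply: idealM; apply: ideal_gen_sub; exact: imageT.
Qed.

End PowerSeries.

Definition mps_map (n : nat) (R R' : comPzRingType) (h : R -> R')
  (f : mpseries n R) : mpseries n R' := MPSeries (fun m => h (f m)).

Section Family.
Variables (A : comPzRingType) (n m : nat) (F : 'I_m -> mpseries n A).

Definition series_quot := quot_ring (ideal_gen (range F)).
HB.instance Definition _ := GRing.ComPzRing.on series_quot.

Definition series_proj : {rmorphism mpseries n A -> series_quot} :=
  quot_proj (ideal_gen (range F)).

Definition structure_map : {rmorphism A -> series_quot} :=
  series_proj \o @mps_const n A.

Definition completed_fibre (p : Spec A) : comPzRingType :=
  quot_ring (ideal_gen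
    (range (fun i => mps_map (to_residue_field p) (F i)))).

(* The ideal n_p, generated by the variables and (the image of) p.             *)
Definition section_ideal (p : Spec A) : ideal series_quot :=
  ideal_gen ([set series_proj (mps_var A i) | i in [set: 'I_n]] `|`
             structure_map @` p).

Hypothesis F0 : forall i, ideal_set (var_ideal n A) (F i).

Lemma series_proj_coef0 f g :
  series_proj f = series_proj g -> mps_coef0 f = mps_coef0 g.
Proof.
move=> /quot_ring_eq fg; apply/eqP; rewrite -subr_eq0 -rmorphB; apply/eqP.
by apply/var_idealP; apply: ideal_gen_min fg => _ [i _ <-].
Qed.

Lemma section_idealP p f :
  ideal_set (section_ideal p) (series_proj f) <-> ideal_set p (mps_coef0 f).
Proof.
split=> [|pf].
  have P : is_ideal [set b : series_quot |
      exists2 g, series_proj g = b & ideal_set p (mps_coef0 g)].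
    split=> [|_ _ [g <- pg] [h <- ph]|b _ [g <- pg]].
    - exists 0; first exact: rmorph0.
      by rewrite rmorph0; apply: ideal0.
    - exists (g + h); first exact: rmorphD.
      by rewrite rmorphD; apply: idealD.
    - exists (repr b * g); last by rewrite rmorphM; apply: idealM.
      by rewrite rmorphM; congr (_ * _); rewrite -[LHS]/(\pi_(series_quot) _) reprK.
  move=> /(@ideal_gen_min _ _ (Ideal P)) -[].
    move=> _ [[i _ <-]|[a pa <-]]; [exists (mps_var A i) | exists (mps_const n a)] => //.
      rewrite /mps_coef0 /= eq_sym mnm1_eq0; exact: ideal0.
    by rewrite /mps_coef0 /= eqxx.
  by move=> g /series_proj_coef0 ->.
rewrite -(subrK (mps_const n (mps_coef0 f)) f) rmorphD; apply: idealD.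
  have : ideal_set (var_ideal n A) (f - mps_const n (mps_coef0 f)).
    apply/var_idealP; rewrite rmorphB /=.
    by rewrite /mps_coef0 /= eqxx subrr.
  have Q : is_ideal [set g | ideal_set (section_ideal p) (series_proj g)].
    rewrite /mkset; split=> [|g h ? ?|a g ?].
    - by rewrite rmorph0; apply: ideal0.
    - by rewrite rmorphD; apply: idealD.
    - by rewrite rmorphM; apply: idealM.
  apply: (ideal_gen_min (I := Ideal Q)) => _ [i _ <-] /=.
  by apply: ideal_gen_sub; left; exists i.
by apply: ideal_gen_sub; right; exists (mps_coef0 f).
Qed.

Lemma section_ideal_proper p : ~ ideal_set (section_ideal p) 1.
Proof.
by rewrite -(rmorph1 series_proj) => /section_idealP; rewrite rmorph1 => /spec_proper.
Qed.

Lemma section_ideal_prime p x y : ideal_set (section_ideal p) (x * y) ->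
  ideal_set (section_ideal p) x \/ ideal_set (section_ideal p) y.
Proof.
have -> : x = series_proj (repr x) by rewrite -[RHS]/(\pi_(series_quot) _) reprK.
have -> : y = series_proj (repr y) by rewrite -[RHS]/(\pi_(series_quot) _) reprK.
rewrite -rmorphM => /section_idealP; rewrite rmorphM => /spec_prime[] ?.
  by left; apply/section_idealP.
by right; apply/section_idealP.
Qed.

Definition sigma (p : Spec A) : Spec series_quot :=
  PrimeIdeal (@section_ideal_proper p) (@section_ideal_prime p).

Lemma sigma_over p a :
  ideal_set (sigma p) (structure_map a) <-> ideal_set p a.
Proof.
have e : mps_coef0 (mps_const n a) = a by rewrite /mps_coef0 /= eqxx.
by rewrite -{2}e; apply: section_idealP.
Qed.

Lemma sigma_compl p a : mulset_set (prime_compl p) a ->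
  mulset_set (prime_compl (sigma p)) (structure_map a).
Proof. by move=> pa /sigma_over. Qed.

Definition structure_map_at (p : Spec A) :
    {rmorphism loc_at p -> loc_at (sigma p)} :=
  loc_map (@sigma_compl p).

Definition Sing_sigma : set (Spec series_quot) :=
  [set sigma p | p in [set p : Spec A |
    ~ formally_smooth (structure_map_at p) (loc_at_ideal (sigma p) (sigma p))]].

End Family.

(* Main.v *)
Require Import Defs.
From HB Require Import structures.
From mathcomp Require Import all_boot all_order all_algebra.
From mathcomp Require Import boolp classical_sets.
From mathcomp.multinomials Require Import mpoly.
From mathcomp Require Import ring zify.

Set Implicit Arguments.
Unset Strict Implicit.
Unset Printing Implicit Defensive.

Import Order.TTheory GRing.Theory.

Local Open Scope ring_scope.
Local Open Scope classical_set_scope.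
Local Open Scope quotient_scope.

(** Fix a prime p of A, with residue field K, write S for the power series ring
    over K, M for its maximal ideal and G for the reduction of the series F.
    Since the section gives the local ring of B at n_p the residue field K, both
    properties of p turn out to say the same thing: G is generated by series
    with linearly independent linear parts, that is, the fibre is a power series
    ring. [linear_splitting] chooses a maximal family F (f l) with independent
    linear parts mod p, together with inverse changes of coordinates; e denotes
    the number n - r of remaining coordinates, and S' the power series ring in
    e variables over K. There is a map theta : S' -> S which is surjective modulo
    the ideal J of the G (f l) ([theta_surj]).

    Regular implies smooth ([regular_smooth]). If S / (G) is regular, its
    dimension d is at least e, by counting generators of the maximal ideal
    modulo squares. A nonzero kernel of S' -> S / (G) would produce a chain of
    d + 1 primes in the domain S', whose dimension is e; hence (G) = J
    ([regular_generators]). To lift a homomorphism from B to a square-zero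
    extension C, choose arbitrary images of the variables in C. They generate,
    together with p, a nilpotent ideal Q. The Jacobian matrix of the selected F
    has a right inverse modulo Q, so Newton iteration makes the selected F
    vanish in C. The other F then vanish as well: by flatness, p A[[x]] meets
    I = (F) in p I ([flat_intersection]), and so the ideal generated by the
    values of F in C is equal to Q times itself. Denominators outside p and the
    infinitely many coefficients are dealt with by truncating at high order and
    controlling the error with the Artin-Rees lemma ([almost_generators]).

    Smooth implies regular ([smooth_regular]). Formal smoothness is applied to
    the truncations of S': starting from the linear change of coordinates, it
    lifts step by step to a homomorphism psi : S -> S' which kills G
    ([smooth_hom]). The composite psi theta is the identity on leading forms,
    hence injective ([theta_inj]), so that theta induces an isomorphism of S'
    with S / (G).

    Two results on power series support this. The Artin-Rees lemma
    ([artin_rees]) comes from a standard basis: by Dickson's lemma and the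
    ascending chain condition the ideals of leading coefficients, indexed by
    monomials, are governed by monomials of bounded degree. It also gives
    Noetherianity and closedness of ideals. The bound e on the dimension of S'
    ([prime_chain_length]) compares two estimates of the length of S' / (P + M^t):
    the number of monomials of degree less than t, hence t^e, bounds it, and a chain of d primes
    above P makes it grow at least like t^d. *)

(** * Ideals, homomorphisms and universal properties *)

Section IdealOperations.
Variable R : comPzRingType.
Implicit Types (I J N Q : ideal R) (X Y : set R).

Lemma zero_is_ideal : is_ideal [set 0 : R].
Proof. by split=> [|x y -> ->|a x ->]; rewrite ?addr0 ?mulr0. Qed.

Definition zero_ideal : ideal R := Ideal zero_is_ideal.

Lemma ideal_exchange I x y : ideal_set I (x - y) -> ideal_set I y -> ideal_set I x.
Proof. by move=> xy /(idealD xy); rewrite subrK. Qed.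

Lemma idealMr I a x : ideal_set I x -> ideal_set I (x * a).
Proof. by rewrite mulrC; apply: idealM. Qed.

Lemma ideal_sum_cond I (K : finType) (P : pred K) (G : K -> R) :
  (forall k, P k -> ideal_set I (G k)) -> ideal_set I (\sum_(k | P k) G k).
Proof.
by move=> IG; apply: big_ind => //; [apply: ideal0 | apply: idealD].
Qed.

Lemma ideal_add_is_ideal I J :
  is_ideal [set z | exists x y, [/\ ideal_set I x, ideal_set J y & z = x + y]].
Proof.
split=> [|_ _ [x [y [Ix Jy ->]]] [x' [y' [Ix' Jy' ->]]]|a _ [x [y [Ix Jy ->]]]].
- by exists 0, 0; rewrite addr0; split=> //; apply: ideal0.
- by exists (x + x'), (y + y'); split; [exact: idealD | exact: idealD | rewrite addrACA].
by exists (a * x), (a * y); split; [exact: idealM | exact: idealM | rewrite mulrDr].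
Qed.

Definition ideal_add I J : ideal R := Ideal (ideal_add_is_ideal I J).

Lemma ideal_addl I J x : ideal_set I x -> ideal_set (ideal_add I J) x.
Proof. by move=> Ix; exists x, 0; rewrite addr0; split=> //; apply: ideal0. Qed.

Lemma ideal_addr I J x : ideal_set J x -> ideal_set (ideal_add I J) x.
Proof. by move=> Jx; exists 0, x; rewrite add0r; split=> //; apply: ideal0. Qed.

Definition ideal_mul I J : ideal R :=
  ideal_gen [set z | exists x y, [/\ ideal_set I x, ideal_set J y & z = x * y]].

Lemma ideal_mulP I J x y : ideal_set I x -> ideal_set J y ->
  ideal_set (ideal_mul I J) (x * y).
Proof. by move=> Ix Jy; apply: ideal_gen_sub; exists x, y. Qed.

Lemma ideal_mul_min I J Q :
  (forall x y, ideal_set I x -> ideal_set J y -> ideal_set Q (x * y)) ->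
  ideal_mul I J `<=` Q.
Proof. by move=> h; apply: ideal_gen_min => _ [x [y [Ix Jy ->]]]; apply: h. Qed.

Lemma ideal_mul_subl I J : ideal_mul I J `<=` I.
Proof. by apply: ideal_mul_min => x y Ix _; rewrite mulrC; apply: idealM. Qed.

Lemma ideal_mul_subr I J : ideal_mul I J `<=` J.
Proof. by apply: ideal_mul_min => x y _ Jy; apply: idealM. Qed.

Lemma ideal_colon_is_ideal Q (a : R) : is_ideal [set x | ideal_set Q (a * x)].
Proof.
rewrite /mkset; split=> [|x y Qx Qy|b x Qx]; first by rewrite mulr0; apply: ideal0.
  by rewrite mulrDr; apply: idealD.
by rewrite mulrCA; apply: idealM.
Qed.

Definition ideal_colon Q a : ideal R := Ideal (ideal_colon_is_ideal Q a).

(** Both factors are moved through the generating sets by taking colon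
    ideals, which avoids expanding elements as linear combinations. *)
Lemma ideal_gen_mul X Y Q : (forall x y, X x -> Y y -> ideal_set Q (x * y)) ->
  forall x y, ideal_set (ideal_gen X) x -> ideal_set (ideal_gen Y) y ->
  ideal_set Q (x * y).
Proof.
move=> h x y Xx Yy.
suff: ideal_set (ideal_colon Q y) x by rewrite /= mulrC.
apply: ideal_gen_min Xx => {}x Xx /=; rewrite mulrC.
suff: ideal_set (ideal_colon Q x) y by [].
by apply: ideal_gen_min Yy => {}y Yy /=; apply: h.
Qed.

Lemma ideal_exp0 I x : ideal_set (ideal_exp I 0) x.
Proof. by rewrite -[x]mulr1; apply: idealM; apply: ideal_gen_sub. Qed.

Lemma ideal_exp1 I x : ideal_set I x -> ideal_set (ideal_exp I 1) x.
Proof. by move=> Ix; rewrite -[x]mulr1; apply: ideal_mulP => //; apply: ideal_exp0. Qed.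

Lemma ideal_expD I j k x y : ideal_set (ideal_exp I j) x ->
  ideal_set (ideal_exp I k) y -> ideal_set (ideal_exp I (j + k)) (x * y).
Proof.
elim: j x => [|j IH] x Ix Iy; first exact: idealM.
suff: ideal_set (ideal_colon (ideal_exp I (j.+1 + k)) y) x by rewrite /= mulrC.
apply: ideal_gen_min Ix => _ [a [b [Ia Ib ->]]] /=; rewrite mulrC -mulrA.
by apply: ideal_mulP => //; apply: IH.
Qed.

Lemma ideal_exp_sub I j k : (k <= j)%N -> ideal_exp I j `<=` ideal_exp I k.
Proof.
move=> /subnK <-; elim: (j - k)%N => [|d IH] //.
by apply: subset_trans IH; apply: ideal_mul_subr.
Qed.

Lemma ideal_exp_prod I n (c : 'I_n -> R) (m : 'I_n -> nat) :
  (forall i, ideal_set I (c i)) ->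
  ideal_set (ideal_exp I (\sum_i m i)) (\prod_i c i ^+ m i).
Proof.
move=> Ic; elim/big_ind2: _ => [|x k y l Ix Iy|i _]; first exact: ideal_exp0.
- exact: ideal_expD.
elim: (m i) => [|k IH]; first exact: ideal_exp0.
by rewrite exprS; apply: ideal_mulP.
Qed.

Lemma square_zeroP N :
  ideal_set (ideal_exp N 2) = [set 0] <->
  (forall x y, ideal_set N x -> ideal_set N y -> x * y = 0).
Proof.
split=> [N2 x y Nx Ny|N2].
  have: ideal_set (ideal_exp N 2) (x * y) by apply: ideal_mulP => //; apply: ideal_exp1.
  by rewrite N2.
apply/seteqP; split=> [x|x ->]; last exact: ideal0.
apply: (@ideal_mul_min _ _ zero_ideal) => {x} x y Nx Ny; apply: N2 => //.
exact: ideal_mul_subl Ny.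
Qed.

Lemma ideal_gen_rangeP (K : finType) (g : K -> R) x :
  ideal_set (ideal_gen (range g)) x <-> exists q : K -> R, x = \sum_k q k * g k.
Proof.
split=> [|[q ->]]; last first.
  by apply: ideal_sum => k; apply: idealM; apply: ideal_gen_sub; exists k.
have P : is_ideal [set x | exists q : K -> R, x = \sum_k q k * g k].
  split=> [|_ _ [q ->] [r ->]|a _ [q ->]].
  - by exists (fun=> 0); rewrite big1 // => k _; rewrite mul0r.
  - exists (fun k => q k + r k).
    by rewrite -big_split; apply: eq_bigr => k _; rewrite mulrDl.
  by exists (fun k => a * q k); rewrite mulr_sumr; apply: eq_bigr => k _; rewrite mulrA.
apply: (ideal_gen_min (I := Ideal P)) => _ [k _ <-] /=.
exists (fun j => (j == k)%:R); rewrite (bigD1 k) //= eqxx mul1r big1 ?addr0 // => j.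
by move=> /negPf ->; rewrite mul0r.
Qed.

End IdealOperations.

(** The union of the chain is finitely generated, and all its generators lie in
    one member of the chain. *)
Lemma noetherian_acc (R : comPzRingType) (I : nat -> ideal R) :
  noetherian R -> (forall k, I k `<=` I k.+1) ->
  exists k, forall j, ideal_set (I j) `<=` I k.
Proof.
move=> hR Imono.
have mono j k : (j <= k)%N -> I j `<=` I k.
  by move=> /subnK <-; elim: (k - j)%N => // d IH; apply: subset_trans IH (Imono _).
have U : is_ideal [set x | exists k, ideal_set (I k) x].
  split=> [|x y [j Ix] [k Iy]|a x [k Ix]]; first by exists 0%N; apply: ideal0.
    exists (j + k)%N; apply: idealD.
      exact: mono (leq_addr _ _) _ Ix.
    exact: mono (leq_addl _ _) _ Iy.
  by exists k; apply: idealM.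
have [d [g Ug]] := hR (Ideal U).
have /choice [f fP] : forall i, exists k, ideal_set (I k) (g i).
  move=> i; suff: ideal_set (Ideal U) (g i) by [].
  by rewrite Ug; apply: ideal_gen_sub; exists i.
exists (\max_i f i)%N => j x Ix.
have: ideal_set (Ideal U) x by exists j.
rewrite Ug; apply: ideal_gen_min => _ [i _ <-].
exact: mono (leq_bigmax i) _ (fP i).
Qed.

Section Morphisms.

Lemma rmorphismP (R R' : comPzRingType) (f : R -> R') :
  zmod_morphism f -> monoid_morphism f -> exists g : {rmorphism R -> R'}, g =1 f.
Proof.
move=> fB fM.
pose m1 := GRing.isZmodMorphism.Build R R' f fB.
pose m2 := GRing.isMonoidMorphism.Build R R' f fM.
pose g : {rmorphism R -> R'} := HB.pack f m1 m2.
by exists g.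
Qed.

Variables (R R' : comPzRingType).

Lemma comap_is_ideal (f : {rmorphism R -> R'}) (I : ideal R') :
  is_ideal [set x | ideal_set I (f x)].
Proof.
rewrite /mkset; split=> [|x y|a x]; rewrite ?rmorph0 ?rmorphD ?rmorphM.
- exact: ideal0.
- exact: idealD.
exact: idealM.
Qed.

Definition ideal_comap f I : ideal R := Ideal (comap_is_ideal f I).

Lemma comap_proper (f : {rmorphism R -> R'}) (p : Spec R') :
  ~ ideal_set (ideal_comap f p) 1.
Proof. by rewrite /= rmorph1; apply: spec_proper. Qed.

Lemma comap_prime (f : {rmorphism R -> R'}) (p : Spec R') x y :
  ideal_set (ideal_comap f p) (x * y) ->
  ideal_set (ideal_comap f p) x \/ ideal_set (ideal_comap f p) y.
Proof. by rewrite /= rmorphM; apply: spec_prime. Qed.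

Definition spec_comap f p : Spec R :=
  PrimeIdeal (@comap_proper f p) (@comap_prime f p).

Lemma comap_chain (f : {rmorphism R -> R'}) (I J : ideal R') :
  (forall y, exists x, f x = y) -> ideal_set I `<` J ->
  ideal_set (ideal_comap f I) `<` ideal_comap f J.
Proof.
move=> fs [IJ JI]; split=> [x|h]; first exact: IJ.
by apply: JI => y Jy; have [x e] := fs y; rewrite -e; apply: h; rewrite /= e.
Qed.

Lemma rmorph_ideal_gen (f : {rmorphism R -> R'}) X (I : ideal R') :
  (forall x, X x -> ideal_set I (f x)) ->
  forall x, ideal_set (ideal_gen X) x -> ideal_set I (f x).
Proof. by move=> h x; apply: (@ideal_gen_min _ X (ideal_comap f I)). Qed.

Lemma rmorph_ideal_exp (f : {rmorphism R -> R'}) (I : ideal R) (J : ideal R') :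
  (forall x, ideal_set I x -> ideal_set J (f x)) ->
  forall k x, ideal_set (ideal_exp I k) x -> ideal_set (ideal_exp J k) (f x).
Proof.
move=> h; elim=> [|k IH] x; first by move=> _; apply: ideal_exp0.
apply: rmorph_ideal_gen => _ [y [z [Iy Iz ->]]]; rewrite rmorphM.
by apply: ideal_mulP; [apply: h | apply: IH].
Qed.

Lemma quot_projK (I : ideal R) (x : quot_ring I) : quot_proj I (repr x) = x.
Proof. exact: reprK. Qed.

Lemma quot_projP (I : ideal R) x y :
  quot_proj I x = quot_proj I y <-> ideal_set I (x - y).
Proof. exact: quot_ring_eq. Qed.

Lemma quot_proj0 (I : ideal R) x : quot_proj I x = 0 <-> ideal_set I x.
Proof. by rewrite -(rmorph0 (quot_proj I)) quot_projP subr0. Qed.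

Lemma quot_image_is_ideal (I J : ideal R) :
  is_ideal [set y : quot_ring I | exists2 x, ideal_set J x & quot_proj I x = y].
Proof.
split=> [|_ _ [x Jx <-] [y Jy <-]|a _ [x Jx <-]].
- by exists 0; [apply: ideal0 | rewrite rmorph0].
- by exists (x + y); [apply: idealD | rewrite rmorphD].
by exists (repr a * x); [apply: idealM | rewrite rmorphM; congr (_ * _); apply: quot_projK].
Qed.

Definition quot_image I J : ideal (quot_ring I) := Ideal (quot_image_is_ideal I J).

Lemma quot_imageP (I J : ideal R) x : I `<=` J ->
  ideal_set (quot_image I J) (quot_proj I x) <-> ideal_set J x.
Proof.
move=> IJ; split=> [[y Jy /esym/quot_projP/IJ/ideal_exchange]|Jx]; first exact.
by exists x.
Qed.

Lemma quot_image_exp (I J : ideal R) k :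
  ideal_exp (quot_image I J) k `<=` quot_image I (ideal_exp J k).
Proof.
elim: k => [|k IH] y.
  by move=> _; exists (repr y); [apply: ideal_exp0 | apply: quot_projK].
apply: ideal_mul_min => {y} _ y [x Jx <-] /IH[z Jz <-].
by exists (x * z); [apply: ideal_mulP | rewrite rmorphM].
Qed.

Lemma quot_lift (I : ideal R) (f : {rmorphism R -> R'}) :
  (forall x, ideal_set I x -> f x = 0) ->
  exists g : {rmorphism quot_ring I -> R'}, forall x, g (quot_proj I x) = f x.
Proof.
move=> fI; pose g (y : quot_ring I) := f (repr y).
have gE x : g (quot_proj I x) = f x.
  apply/eqP; rewrite -subr_eq0 -rmorphB; apply/eqP/fI/quot_projP.
  exact: quot_projK.
have [||h hg] := @rmorphismP _ _ g.
- move=> x y; rewrite -[x]quot_projK -[y]quot_projK -rmorphB !gE; exact: rmorphB.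
- split=> [|x y]; first by rewrite -(rmorph1 (quot_proj I)) gE rmorph1.
  by rewrite -[x]quot_projK -[y]quot_projK -rmorphM !gE rmorphM.
by exists h => x; rewrite hg gE.
Qed.

End Morphisms.

Definition invertible (R : comPzRingType) (x : R) : Prop := exists y, y * x = 1.

Section UnitTheory.
Variable R : comPzRingType.

Lemma invertible_rmorph (R' : comPzRingType) (f : {rmorphism R -> R'}) x :
  invertible x -> invertible (f x).
Proof. by case=> y yx; exists (f y); rewrite -rmorphM yx rmorph1. Qed.

Lemma ideal_invertible (I : ideal R) s x :
  invertible s -> ideal_set I (s * x) -> ideal_set I x.
Proof. by case=> t ts /(idealM t); rewrite mulrA ts mul1r. Qed.

(** If a s = 1 - e with e^2 = 0, then a (1 + e) inverts s. *)
Lemma invertible_mod_square_zero (N : ideal R) s :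
  (forall x y, ideal_set N x -> ideal_set N y -> x * y = 0) ->
  invertible (quot_proj N s) -> invertible s.
Proof.
move=> N2 [t]; rewrite -[t]quot_projK -rmorphM -(rmorph1 (quot_proj N)).
set a := repr t => /quot_projP Ne; exists (a * (2 - a * s)).
have := N2 _ _ Ne Ne => h.
suff: a * (2 - a * s) * s - 1 = 0 by move/eqP; rewrite subr_eq0 => /eqP.
transitivity (- ((a * s - 1) * (a * s - 1))); first by ring.
by rewrite h oppr0.
Qed.

End UnitTheory.

Section LocalizationUniversal.
Variables (R : comPzRingType) (S : mulset R).

Lemma loc_fracE (x : fraction S) :
  loc_in S (den x) * \pi_(localization S) x = loc_in S (num x).
Proof.
rewrite -[LHS]/(loc_mul _ _) pi_loc_mul; apply: loc_eq1 => /=.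
by rewrite mul1r mulr1 mulrC.
Qed.

Lemma loc_in_invertible s : mulset_set S s -> invertible (loc_in S s).
Proof.
move=> Ss; pose x := Fraction 1 Ss; exists (\pi_(localization S) x).
by rewrite mulrC (loc_fracE x) rmorph1.
Qed.

Lemma loc_fracP (z : localization S) :
  exists a s, mulset_set S s /\ loc_in S s * z = loc_in S a.
Proof.
exists (num (repr z)), (den (repr z)); split; first exact: denP.
by rewrite -[X in _ * X]reprK loc_fracE.
Qed.

Lemma loc_lift (R' : comPzRingType) (f : {rmorphism R -> R'}) :
  (forall s, mulset_set S s -> invertible (f s)) ->
  exists g : {rmorphism localization S -> R'}, forall x, g (loc_in S x) = f x.
Proof.
move=> fS.
have inj s a b : mulset_set S s -> f s * a = f s * b -> a = b.
  by move=> /fS[t ts] e; rewrite -[a]mul1r -[b]mul1r -ts -!mulrA e.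
have /choice [g gP] : forall z : localization S, exists b, forall a s,
    mulset_set S s -> loc_in S s * z = loc_in S a -> f s * b = f a.
  move=> z; have [a0 [s0 [Ss0 e0]]] := loc_fracP z; have [t ts] := fS _ Ss0.
  exists (t * f a0) => a s Ss e.
  have: loc_in S (a0 * s) = loc_in S (a * s0).
    by rewrite !rmorphM /= -e0 -e; ring.
  move=> /loc_eq[u Su] /=; rewrite !mulr1 => /(congr1 f).
  rewrite !rmorphM => /(inj _ _ _ Su) h.
  transitivity (t * (f a0 * f s)); first by ring.
  by rewrite h mulrCA ts mulr1.
have [||h hg] := @rmorphismP _ _ g.
- move=> x y; have [a [s [Ss ex]]] := loc_fracP x; have [b [t [St ey]]] := loc_fracP y.
  apply: (inj (s * t)); first exact: mulsetM.
  rewrite (gP (x - y) (a * t - b * s)); last 2 first.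
  - exact: mulsetM.
  - by rewrite rmorphB !rmorphM /= -ex -ey; ring.
  by rewrite rmorphB !rmorphM -(gP _ _ _ Ss ex) -(gP _ _ _ St ey); ring.
- split=> [|x y].
    apply: (inj 1); first exact: mulset1.
    rewrite (gP 1 1) ?rmorph1 ?mulr1 //; exact: mulset1.
  have [a [s [Ss ex]]] := loc_fracP x; have [b [t [St ey]]] := loc_fracP y.
  apply: (inj (s * t)); first exact: mulsetM.
  rewrite (gP (x * y) (a * b)); last 2 first.
  - exact: mulsetM.
  - by rewrite !rmorphM /= -ex -ey; ring.
  by rewrite !rmorphM -(gP _ _ _ Ss ex) -(gP _ _ _ St ey); ring.
exists h => x; rewrite hg -[LHS]mul1r -(rmorph1 f).
by apply: gP; rewrite ?rmorph1 ?mul1r //; apply: mulset1.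
Qed.

Lemma loc_hom_ext (R' : comPzRingType) (f g : {rmorphism localization S -> R'}) :
  (forall x, f (loc_in S x) = g (loc_in S x)) -> f =1 g.
Proof.
move=> e z; have [a [s [Ss ez]]] := loc_fracP z.
have [t ts] := invertible_rmorph f (loc_in_invertible Ss).
rewrite -[LHS]mul1r -[RHS]mul1r -ts -!mulrA; congr (_ * _).
have := e a; rewrite -ez !rmorphM => h; rewrite h; congr (_ * _).
exact/esym/e.
Qed.

End LocalizationUniversal.

Section ResidueField.
Variables (R : comPzRingType) (p : Spec R).

Lemma loc_at_idealP (z : loc_at p) : ideal_set (loc_at_ideal p p) z <->
  exists a s, [/\ mulset_set (prime_compl p) s,
                  loc_at_in p s * z = loc_at_in p a & ideal_set p a].
Proof.
split=> [|[a [s [ps e pa]]]]; last first.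
  have := loc_in_invertible ps => /ideal_invertible; apply.
  by rewrite e; apply: ideal_gen_sub; exists a.
have P : is_ideal [set z : loc_at p | exists a s,
    [/\ mulset_set (prime_compl p) s,
        loc_at_in p s * z = loc_at_in p a & ideal_set p a]].
  split=> [|x y [a [s [ps ex pa]]] [b [t [pt ey pb]]]|y x [a [s [ps ex pa]]]].
  - exists 0, 1; split; [exact: mulset1 | by rewrite mulr0 rmorph0 | exact: ideal0].
  - exists (a * t + b * s), (s * t); split; first exact: mulsetM.
      by rewrite rmorphD !rmorphM -ex -ey; ring.
    by apply: idealD; apply: idealMr.
  have [b [t [pt ey]]] := loc_fracP y.
  exists (b * a), (t * s); split; first exact: mulsetM.
    by rewrite !rmorphM -ex /= -ey; ring.
  exact: idealM.
apply: (ideal_gen_min (I := Ideal P)) => _ [a pa <-].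
by exists a, 1; split; [exact: mulset1 | rewrite rmorph1 mul1r | ].
Qed.

Lemma residue_field0 a : to_residue_field p a = 0 <-> ideal_set p a.
Proof.
rewrite /= quot_proj0; split=> [/loc_at_idealP [b [s [ps]]]|pa]; last first.
  by apply: ideal_gen_sub; exists a.
rewrite -rmorphM => /loc_eq[u pu] /=; rewrite !mulr1 => e pb.
have: ideal_set p (u * (s * a)) by rewrite e; apply: idealM.
by move=> /spec_prime[/pu //|/spec_prime[/ps|]].
Qed.

Lemma residue_fracP (z : residue_field p) : exists a s,
  [/\ mulset_set (prime_compl p) s & to_residue_field p s * z = to_residue_field p a].
Proof.
have [a [s [ps e]]] := loc_fracP (repr z); exists a, s; split=> //.
by rewrite -[z]quot_projK /= -rmorphM e.
Qed.

Lemma residue_one_neq0 : (1 : residue_field p) <> 0.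
Proof.
by rewrite -(rmorph1 (to_residue_field p)) => /residue_field0; apply: spec_proper.
Qed.

Lemma residue_compl_invertible s :
  mulset_set (prime_compl p) s -> invertible (to_residue_field p s).
Proof.
by move=> ps; apply: (invertible_rmorph (quot_proj (loc_at_ideal p p)) (loc_in_invertible ps)).
Qed.

Lemma residue_invertible (z : residue_field p) : z <> 0 -> invertible z.
Proof.
move=> z0; have [a [s [ps e]]] := residue_fracP z.
have [pa|pa] := pselect (ideal_set p a).
  case: z0; have [t ts] := residue_compl_invertible ps.
  rewrite -[z]mul1r -ts -mulrA e; move/residue_field0: pa => ->; exact: mulr0.
have [t ta] := residue_compl_invertible pa.
by exists (t * to_residue_field p s); rewrite -mulrA e.
Qed.

End ResidueField.

Definition is_field (K : comPzRingType) : Prop :=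
  (1 : K) <> 0 /\ forall x : K, x <> 0 -> invertible x.

Lemma residue_is_field (R : comPzRingType) (p : Spec R) : is_field (residue_field p).
Proof. by split; [apply: residue_one_neq0 | apply: residue_invertible]. Qed.

Lemma field_noetherian (K : comPzRingType) : is_field K -> noetherian K.
Proof.
move=> [_ hK] I; have [I0|] := pselect (forall x, ideal_set I x -> x = 0).
  exists 0%N, (fun=> 0); apply/seteqP; split=> x.
    by move=> /I0 ->; apply: ideal0.
  move=> h; rewrite (_ : x = 0); last by move: h; apply: (@ideal_gen_min _ _ (zero_ideal K)) => y [i _ <-].
  exact: ideal0.
move=> /existsNP[x /not_implyP[Ix /hK [y yx]]].
have I1 : ideal_set I 1 by rewrite -yx; apply: idealM.
exists 1%N, (fun=> 1); apply/seteqP; split=> z _.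
  by rewrite -[z]mulr1; apply: idealM; apply: ideal_gen_sub; exists ord0.
by rewrite -[z]mulr1; apply: idealM.
Qed.

(** * Power series: order filtration, completeness, homomorphisms *)

Section Order.
Variables (n : nat) (R : comPzRingType).
Implicit Types (f g h : mpseries n R) (m k : 'X_{1..n}).

Definition ord_ge (t : nat) f : Prop := forall m, (mdeg m < t)%N -> f m = 0.

Lemma mps_coefD f g m : (f + g) m = f m + g m. Proof. by []. Qed.
Lemma mps_coefB f g m : (f - g) m = f m - g m. Proof. by []. Qed.

Lemma mps_coefM f g m : (f * g) m =
  \sum_(k : 'X_{1..n < (mdeg m).+1} | (k <= m)%MM) f k * g (m - k)%MM.
Proof. by []. Qed.

Lemma mdeg_split m k : (k <= m)%MM -> mdeg m = (mdeg k + mdeg (m - k)%MM)%N.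
Proof. by move=> km; rewrite -mdegD addmC submK. Qed.

Lemma mps_coefM0 f g m : (forall k, (k <= m)%MM -> f k * g (m - k)%MM = 0) ->
  (f * g) m = 0.
Proof. by move=> h; rewrite mps_coefM big1 // => k km; apply: h. Qed.

(** A coefficient of a product reduced to its only possibly nonzero term. *)
Lemma mps_coefM1 f g m k0 : (k0 <= m)%MM ->
  (forall k, (k <= m)%MM -> k != k0 -> f k * g (m - k)%MM = 0) ->
  (f * g) m = f k0 * g (m - k0)%MM.
Proof.
move=> k0m h; have b0 : (mdeg k0 < (mdeg m).+1)%N by rewrite ltnS lem_mdeg.
rewrite mps_coefM (bigD1 (BMultinom b0)) //= big1 ?addr0 // => k /andP[km kk].
by apply: h => //; apply: contra_neq kk => e; apply: val_inj.
Qed.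

Lemma mps_constM a f m : (mps_const n a * f) m = a * f m.
Proof.
rewrite (@mps_coefM1 _ _ _ 0%MM) /= ?eqxx ?subm0 //.
  by apply/mnm_lepP => i; rewrite mnm0E.
by move=> k _ /negPf ->; rewrite mul0r.
Qed.

Lemma ord_ge_is_ideal t : is_ideal [set f | ord_ge t f].
Proof.
split=> [m //|f g hf hg m mt|a f hf m mt].
  by rewrite mps_coefD hf // hg // addr0.
apply: mps_coefM0 => k km; rewrite hf ?mulr0 //.
by rewrite (mdeg_split km) in mt; lia.
Qed.

Definition ord_ideal t : ideal (mpseries n R) := Ideal (ord_ge_is_ideal t).

Lemma ord_geM s t f g : ord_ge s f -> ord_ge t g -> ord_ge (s + t) (f * g).
Proof.
move=> hf hg m mst; apply: mps_coefM0 => k km; rewrite (mdeg_split km) in mst.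
have [ks|ks] := ltnP (mdeg k) s; first by rewrite hf ?mul0r.
by rewrite hg ?mulr0 //; lia.
Qed.

Lemma ord_ge_le s t f : (s <= t)%N -> ord_ge t f -> ord_ge s f.
Proof. by move=> st hf m ms; apply: hf; lia. Qed.

Lemma ord_ge0 f : ord_ge 0 f. Proof. by []. Qed.

Lemma ord_ge1 f : ord_ge 1 f <-> mps_coef0 f = 0.
Proof.
split=> [|f0 m]; first by apply; rewrite mdeg0.
by rewrite ltnS leqn0 mdeg_eq0 => /eqP ->.
Qed.

Lemma ord_ge_eq0 f : (forall t, ord_ge t f) -> f = 0.
Proof. by move=> h; apply/mpseriesP => m; apply: (h (mdeg m).+1). Qed.

Lemma ord_ge_var i : ord_ge 1 (mps_var R i : mpseries n R).
Proof. by apply/ord_ge1; rewrite /mps_coef0 /= eq_sym mnm1_eq0. Qed.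

Lemma mps_coef0_const (a : R) : mps_coef0 (mps_const n a) = a.
Proof. by rewrite /mps_coef0 /= eqxx. Qed.

Lemma mps_coef0B f g : mps_coef0 (f - g) = mps_coef0 f - mps_coef0 g.
Proof. by []. Qed.

Lemma mps_coef0M f g : mps_coef0 (f * g) = mps_coef0 f * mps_coef0 g.
Proof. exact: rmorphM. Qed.

Lemma mps_coef01 : mps_coef0 (1 : mpseries n R) = 1.
Proof. exact: mps_coef0_const. Qed.

(** Each monomial of positive degree is charged to its first variable. *)
Lemma ord_geS t f : ord_ge t.+1 f ->
  exists G : 'I_n -> mpseries n R,
    (forall i, ord_ge t (G i)) /\ f = \sum_i mps_var R i * G i.
Proof.
move=> ft; pose fst (m : 'X_{1..n}) := [pick i | m i != 0%N].
pose G i : mpseries n R :=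
  MPSeries (fun m => if fst (m + U_(i))%MM == Some i then f (m + U_(i))%MM else 0).
exists G; split.
  by move=> i m mt /=; case: ifP => // _; apply: ft; rewrite mdegD mdeg1 addn1.
apply/mpseriesP => m; rewrite mps_sum_coef.
transitivity (\sum_i if fst m == Some i then f m else 0).
  rewrite /fst; case: pickP => [i mi|m0].
    rewrite (bigD1 i) //= eqxx big1 ?addr0 // => j ji.
    by case: eqP => // -[e]; rewrite e eqxx in ji.
  rewrite big1 // ft // (_ : m = 0%MM) ?mdeg0 //.
  by apply/mnmP => i; rewrite mnm0E; have /negbFE/eqP := m0 i.
apply: eq_bigr => i _; rewrite mps_var_mulE lep1mP.
case: (boolP (m i != 0%N)) => mi; first by rewrite /= submK // lep1mP.
rewrite /fst; case: pickP => // j mj.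
by case: eqP => // -[e]; rewrite -e mj in mi.
Qed.

Lemma mps_decomp f : exists G : 'I_n -> mpseries n R,
  f = mps_const n (mps_coef0 f) + \sum_i mps_var R i * G i.
Proof.
have [|G [_ e]] := @ord_geS 0 (f - mps_const n (mps_coef0 f)).
  by apply/ord_ge1; rewrite mps_coef0B mps_coef0_const subrr.
by exists G; rewrite -e addrC subrK.
Qed.

Lemma coef_var_sum (G : 'I_n -> mpseries n R) i :
  (\sum_j mps_var R j * G j) U_(i)%MM = mps_coef0 (G i).
Proof.
rewrite mps_sum_coef (bigD1 i) // mps_var_mulE lep1mP mnm1E eqxx (_ : (U_(i) - U_(i))%MM = 0%MM); last by apply/mnmP => j; rewrite mnmBE subnn mnm0E.
rewrite big1 => [|j ji]; first exact: addr0.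
by rewrite mps_var_mulE lep1mP mnm1E [i == j]eq_sym (negPf ji).
Qed.

(** The source of the limits below: inverses, quotients by a standard basis,
    preimages under coordinate changes, exact solutions of equations. *)
Lemma mps_complete (a : nat -> mpseries n R) :
  (forall j, ord_ge j (a j.+1 - a j)) -> exists b, forall j, ord_ge j (b - a j).
Proof.
move=> ha; exists (MPSeries (fun m => a (mdeg m).+1 m)) => j m mj.
rewrite mps_coefB /=; move: mj => /subnK <-.
elim: (j - (mdeg m).+1)%N => [|d IH]; first by rewrite subrr.
have h : (a (d + (mdeg m).+1).+1%N - a (d + (mdeg m).+1)%N) m = 0 by apply: ha; lia.
by move: h => /eqP; rewrite addSn mps_coefB subr_eq0 => /eqP ->.
Qed.

Lemma mps_invertible_1B g : ord_ge 1 g -> invertible (1 - g).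
Proof.
move=> g1; pose b := fix b j := if j is j'.+1 then 1 + g * b j' else 0.
have step j : ord_ge j (b j.+1 - b j).
  elim: j => [|j IH] //=.
  rewrite (_ : _ - _ = g * (b j.+1 - b j)); last by rewrite /=; ring.
  by rewrite -add1n; apply: ord_geM.
have [c hc] := mps_complete step; exists c.
apply/eqP; rewrite -subr_eq0; apply/eqP/ord_ge_eq0 => t.
rewrite (_ : _ - 1 = (1 - g) * (c - b t) + (- (b t.+1 - b t))); last by rewrite /=; ring.
by apply: (idealD (I := ord_ideal t)); [apply: idealM | apply: idealN] => /=.
Qed.

Lemma mps_invertible f : invertible (mps_coef0 f) -> invertible f.
Proof.
case=> a e; have [|b be] := @mps_invertible_1B (1 - mps_const n a * f).
  by apply/ord_ge1; rewrite mps_coef0B mps_coef0M mps_coef01 mps_coef0_const e subrr.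
by exists (b * mps_const n a); rewrite -be; ring.
Qed.

End Order.

Section MapSeries.
Variables (n : nat) (R R' : comPzRingType) (h : {rmorphism R -> R'}).

Lemma mps_mapP : exists H : {rmorphism mpseries n R -> mpseries n R'},
  forall f, H f = mps_map h f.
Proof.
apply: rmorphismP => [f g|]; first by apply/mpseriesP => m; apply: rmorphB.
split=> [|f g]; apply/mpseriesP => m.
  by rewrite /=; case: ifP => _; rewrite ?rmorph1 ?rmorph0.
rewrite -[LHS]/(h ((f * g) m)) [RHS]mps_coefM mps_coefM rmorph_sum.
by apply: eq_bigr => k _; rewrite rmorphM.
Qed.

End MapSeries.

Section HomDifference.
Variables (n : nat) (A C : comPzRingType).
Variables (a b : {rmorphism mpseries n A -> C}) (Q E : ideal C).
Hypothesis ab_const : forall x, a (mps_const n x) = b (mps_const n x).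
Hypothesis ab_var : forall i, ideal_set E (a (mps_var A i) - b (mps_var A i)).
Hypothesis b_var : forall i, ideal_set Q (b (mps_var A i)).

Lemma rmorph_decomp (c : {rmorphism mpseries n A -> C}) (G : 'I_n -> mpseries n A) x :
  c (mps_const n x + \sum_i mps_var A i * G i) =
  c (mps_const n x) + \sum_i c (mps_var A i) * c (G i).
Proof.
by rewrite rmorphD rmorph_sum; congr (_ + _); apply: eq_bigr => i _; rewrite rmorphM.
Qed.

Lemma hom_sub_decomp (G : 'I_n -> mpseries n A) x :
  let f := mps_const n x + \sum_i mps_var A i * G i in
  a f - b f = \sum_i ((a (mps_var A i) - b (mps_var A i)) * a (G i)
                      + b (mps_var A i) * (a (G i) - b (G i))).
Proof.
rewrite /= !rmorph_decomp ab_const opprD addrACA subrr add0r -sumrB.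
by apply: eq_bigr => i _; ring.
Qed.

(** Induction on s, splitting off one variable at a time. When Q is nilpotent,
    homomorphisms are therefore determined by constants and variables. *)
Lemma hom_diff s f : ideal_set (ideal_add E (ideal_exp Q s)) (a f - b f).
Proof.
elim: s f => [|s IH] f; first by apply: ideal_addr; apply: ideal_exp0.
have [G ->] := mps_decomp f; rewrite hom_sub_decomp; apply: ideal_sum => i.
apply: idealD; first by apply: ideal_addl; apply: idealMr.
have [x [y [Ex Qy ->]]] := IH (G i); rewrite mulrDr; apply: idealD.
  by apply: ideal_addl; apply: idealM.
by apply: ideal_addr; apply: ideal_mulP.
Qed.

Lemma hom_diff_nilpotent s f : (forall x, ideal_set (ideal_exp Q s) x -> x = 0) ->
  ideal_set E (a f - b f).
Proof. by move=> Q0; have [x [y [Ex /Q0 -> ->]]] := hom_diff s f; rewrite addr0. Qed.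

(** First-order Taylor expansion at the origin: after one variable is split
    off, its cofactor matters only through its constant term modulo Q. *)
Lemma hom_taylor s f : (forall x, ideal_set (ideal_exp Q s) x -> x = 0) ->
  E `<=` Q ->
  ideal_set (ideal_mul Q E) (a f - b f -
    \sum_i (a (mps_var A i) - b (mps_var A i)) * b (mps_const n (f U_(i)%MM))).
Proof.
move=> Q0 EQ; have [G fG] := mps_decomp f.
have -> : a f - b f = a (mps_const n (mps_coef0 f) + \sum_i mps_var A i * G i) -
                      b (mps_const n (mps_coef0 f) + \sum_i mps_var A i * G i).
  by rewrite -fG.
rewrite hom_sub_decomp -sumrB; apply: ideal_sum => i.
have -> : f U_(i)%MM = mps_coef0 (G i).
  by rewrite {1}fG mps_coefD coef_var_sum /= mnm1_eq0 add0r.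
set e := a (mps_var A i) - _; rewrite addrAC; apply: idealD; last first.
  apply: ideal_mulP; first exact: b_var.
  exact: hom_diff_nilpotent Q0.
rewrite -mulrBr mulrC; apply: ideal_mulP; last exact: ab_var.
have aQ j : ideal_set Q (a (mps_var A j)).
  by apply: ideal_exchange (b_var j); apply: EQ; apply: ab_var.
have [H e'] := mps_decomp (G i); rewrite {1}e' rmorph_decomp ab_const.
rewrite addrC addKr; apply: ideal_sum => j; by apply: idealMr; apply: aQ.
Qed.

End HomDifference.

Lemma hom_uniq n (A C : comPzRingType) (a b : {rmorphism mpseries n A -> C})
    (Q : ideal C) s :
  (forall x, a (mps_const n x) = b (mps_const n x)) ->
  (forall i, a (mps_var A i) = b (mps_var A i)) ->
  (forall i, ideal_set Q (b (mps_var A i))) ->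
  (forall x, ideal_set (ideal_exp Q s) x -> x = 0) -> a =1 b.
Proof.
move=> hc hv hQ Q0 f; apply/eqP; rewrite -subr_eq0; apply/eqP.
apply: (@hom_diff_nilpotent _ _ _ a b Q (zero_ideal C) hc _ hQ s) => // i.
by rewrite hv subrr.
Qed.

(** A series of order t + 1 is a combination of the variables with coefficients
    of order t. *)
Lemma hom_ord n (A C : comPzRingType) (b : {rmorphism mpseries n A -> C})
    (Q : ideal C) :
  (forall i, ideal_set Q (b (mps_var A i))) ->
  forall t f, ord_ge t f -> ideal_set (ideal_exp Q t) (b f).
Proof.
move=> hQ; elim=> [|t IH] f; first by move=> _; apply: ideal_exp0.
move=> /ord_geS[G [Gt ->]]; rewrite rmorph_sum; apply: ideal_sum => i.
by rewrite rmorphM; apply: ideal_mulP => //; apply: IH.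
Qed.

(** * Substitution homomorphisms *)

Section Evaluation.
Variables (n : nat) (A C : comPzRingType) (g : {rmorphism A -> C}) (c : 'I_n -> C).

Let mon (m : 'X_{1..n}) : C := \prod_i c i ^+ m i.
Let ev T (f : mpseries n A) : C := \sum_(k : 'X_{1..n < T}) g (f k) * mon k.

Let monD k l : mon (k + l)%MM = mon k * mon l.
Proof. by rewrite -big_split; apply: eq_bigr => i _; rewrite mnmDE exprD. Qed.

Let sum_shift T (k : 'X_{1..n}) (F : 'X_{1..n} -> C) :
  \sum_(m : 'X_{1..n < T} | (k <= m)%MM) F (m - k)%MM =
  \sum_(l : 'X_{1..n < T} | (mdeg (k + l)%MM < T)%N) F l.
Proof.
pose h (l : 'X_{1..n < T}) : 'X_{1..n < T} := insubd l (k + l)%MM.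
pose h' (m : 'X_{1..n < T}) : 'X_{1..n < T} := insubd m (m - k)%MM.
have h'E (m : 'X_{1..n < T}) : val (h' m) = (m - k)%MM.
  by rewrite val_insubd (leq_ltn_trans _ (bmdeg m)) // mdegB.
rewrite (reindex_onto h h') => [|m km]; last first.
  apply: val_inj; rewrite val_insubd h'E addmC submK // bmdeg //.
apply: eq_big => [l|l /andP[km /eqP e]]; last by rewrite -h'E e.
rewrite -val_eqE /= h'E /h val_insubd.
case: ifP => kl; first by rewrite addmC addmK lem_addl eqxx.
apply/negP => /andP[kml /eqP e]; move: kl.
by rewrite -{1}e addmC submK // bmdeg.
Qed.

Let ev_mul T f h : (forall m, (T <= mdeg m)%N -> mon m = 0) ->
  ev T (f * h) = ev T f * ev T h.
Proof.
move=> mon0; rewrite /ev.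
transitivity (\sum_(m : 'X_{1..n < T}) \sum_(k : 'X_{1..n < T} | (k <= m)%MM)
   g (f k) * mon k * (g (h (m - k)%MM) * mon (m - k)%MM)).
  apply: eq_bigr => m _; rewrite -[(f * h) m]/(mps_mul f h m).
  rewrite (mps_mulE (b := T)) ?bmdeg // rmorph_sum mulr_suml.
  apply: eq_bigr => k km; rewrite rmorphM -[X in mon X](submK km) addmC monD; ring.
rewrite (exchange_big_dep predT) //= mulr_suml; apply: eq_bigr => k _.
rewrite -mulr_sumr (sum_shift T k (fun l => g (h l) * mon l)) -!mulrA; congr (_ * _).
rewrite [X in _ = _ * X](bigID (fun l : 'X_{1..n < T} => (mdeg (k + l)%MM < T)%N)) /=.
rewrite mulrDr [X in _ = _ + X]mulr_sumr [X in _ = _ + X]big1 ?addr0 // => l.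
by rewrite -leqNgt => /mon0; rewrite monD mulrCA => ->; rewrite mulr0.
Qed.

(** Substituting elements of a nilpotent ideal for the variables: only
    finitely many monomials survive. *)
Lemma eval_nilpotent (Q : ideal C) s :
  (forall i, ideal_set Q (c i)) ->
  (forall x, ideal_set (ideal_exp Q s) x -> x = 0) ->
  exists v : {rmorphism mpseries n A -> C},
    (forall a, v (mps_const n a) = g a) /\ (forall i, v (mps_var A i) = c i).
Proof.
move=> Qc Q0; pose T := s.+2.
have mon0 m : (T <= mdeg m)%N -> mon m = 0.
  move=> Tm; apply: Q0; apply: (@ideal_exp_sub _ _ (mdeg m)); first by rewrite /T in Tm; lia.
  by rewrite mdegE; apply: ideal_exp_prod.
have ev_const a : ev T (mps_const n a) = g a.
  have b0 : (mdeg (0%MM : 'X_{1..n}) < T)%N by rewrite mdeg0.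
  rewrite /ev (bigD1 (BMultinom b0)) //= eqxx big1 ?addr0.
    by rewrite /mon big1 ?mulr1 // => i _; rewrite mnm0E expr0.
  by move=> k; rewrite -val_eqE /= => /negPf ->; rewrite rmorph0 mul0r.
have [||v vE] := @rmorphismP _ _ (ev T).
- move=> f h; rewrite /ev -sumrB; apply: eq_bigr => k _.
  by rewrite -mulrBl -rmorphB.
- by split=> [|f h]; [rewrite -[1 in LHS]/(mps_const n 1) ev_const rmorph1 | apply: ev_mul].
exists v; split=> [a|i]; first by rewrite vE ev_const.
have b1 : (mdeg (U_(i)%MM : 'X_{1..n}) < T)%N by rewrite mdeg1.
rewrite vE /ev (bigD1 (BMultinom b1)) //= eqxx big1 ?addr0.
  rewrite rmorph1 mul1r /mon (bigD1 i) //= mnm1E eqxx big1 ?mulr1 // => j ji.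
  by rewrite mnm1E eq_sym (negPf ji).
by move=> k; rewrite -val_eqE /= => /negPf ->; rewrite rmorph0 mul0r.
Qed.

End Evaluation.

Lemma ord_ideal_exp n (R : comPzRingType) (Q : ideal (mpseries n R)) :
  Q `<=` ord_ideal n R 1 -> forall t, ideal_exp Q t `<=` ord_ideal n R t.
Proof.
move=> Q1; elim=> [|t IH] //; apply: ideal_mul_min => x y Qx Qy.
by rewrite -add1n; apply: ord_geM; [apply: Q1 | apply: IH].
Qed.

Section Substitution.
Variables (n e : nat) (A R : comPzRingType) (g : {rmorphism A -> R}).
Variable w : 'I_n -> mpseries e R.
Hypothesis w1 : forall i, ord_ge 1 (w i).

(** Substitution of series without constant term, obtained as the limit of the
    substitutions modulo the powers of the variables. *)
Lemma substitution : exists v : {rmorphism mpseries n A -> mpseries e R},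
  (forall a, v (mps_const n a) = mps_const e (g a)) /\
  (forall i, v (mps_var A i) = w i).
Proof.
pose pr t : {rmorphism mpseries e R -> _} := quot_proj (ord_ideal e R t).
pose Q t := quot_image (ord_ideal e R t) (ord_ideal e R 1).
have Q0 t x : ideal_set (ideal_exp (Q t) t) x -> x = 0.
  by move=> /quot_image_exp[f /ord_ideal_exp ft <-]; apply/quot_proj0/ft.
have Qw t i : ideal_set (Q t) (pr t (w i)) by exists (w i) => //; apply: w1.
pose gt t : {rmorphism A -> _} := pr t \o @mps_const e R \o g.
pose ex t := cid (eval_nilpotent (gt t) (Qw t) (Q0 t)).
pose v t := sval (ex t).
have vP t : (forall a, v t (mps_const n a) = gt t a) /\
    (forall i, v t (mps_var A i) = pr t (w i)) := svalP (ex t).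
(* The truncated substitutions are compatible as the precision t varies. *)
have coh s t f : (s <= t)%N -> pr s (repr (v t f)) = v s f.
  move=> st; have [|h hE] := @quot_lift _ _ (ord_ideal e R t) (pr s).
    by move=> x xt; apply/quot_proj0; apply: ord_ge_le st xt.
  rewrite -hE [X in h X]quot_projK.
  apply: (@hom_uniq _ _ _ (h \o v t) (v s) (Q s) s) => [a|i|i|] /=.
  - by rewrite (vP t).1 (vP s).1 /= hE.
  - by rewrite (vP t).2 (vP s).2 /= hE.
  - by rewrite (vP s).2; apply: Qw.
  exact: Q0.
pose u f : mpseries e R := MPSeries (fun m => repr (v (mdeg m).+1 f) m).
have uE t f : pr t (u f) = v t f.
  rewrite -[v t f]quot_projK; apply/quot_projP => m mt.
  have : pr (mdeg m).+1 (repr (v t f)) = pr (mdeg m).+1 (repr (v (mdeg m).+1 f)).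
    by rewrite coh //; apply/esym/quot_projK.
  move=> /quot_projP/(_ m (leqnn _))/eqP; rewrite mps_coefB subr_eq0 => /eqP h.
  by rewrite mps_coefB h; apply: subrr.
have u_eq f h : (forall t, pr t f = pr t h) -> f = h.
  move=> e'; apply/eqP; rewrite -subr_eq0; apply/eqP/ord_ge_eq0 => t.
  by have /quot_projP := e' t.
have [||h hE] := @rmorphismP _ _ u.
- by move=> x y; apply: u_eq => t; rewrite rmorphB !uE rmorphB.
- by split=> [|x y]; apply: u_eq => t; rewrite ?rmorphM !uE ?rmorphM ?rmorph1.
exists h; split=> [a|i]; rewrite hE; apply: u_eq => t; rewrite uE.
  by rewrite (vP t).1.
by rewrite (vP t).2.
Qed.

End Substitution.

(** * Leading monomials and the Artin-Rees lemma for power series *)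

Lemma nondecreasing_subsequence (u : nat -> nat) : exists f : nat -> nat,
  (forall k, (f k < f k.+1)%N) /\ (forall k, (u (f k) <= u (f k.+1))%N).
Proof.
have /choice [m mP] : forall N, exists i, (N <= i)%N /\ forall j, (N <= j)%N -> (u i <= u j)%N.
  move=> N; have ex : exists v, `[< exists2 i, (N <= i)%N & u i = v >].
    by exists (u N); apply/asboolP; exists N.
  have [_ /asboolP[i Ni <-] vmin] := ex_minnP ex; exists i; split=> // j Nj.
  by apply: vmin; apply/asboolP; exists j.
pose f := fix f k := if k is k'.+1 then m (f k').+1 else m 0%N.
have fS k : (f k < f k.+1)%N by have [] := mP (f k).+1.
exists f; split=> // -[|k]; first by have [_] := mP 0%N; apply.
have [_] := mP (f k).+1; apply; exact: leq_trans (fS k) (ltnW (fS k.+1)).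
Qed.

(** Dickson's lemma, in the form of infinite subsequences. *)
Lemma dickson n (v : nat -> 'X_{1..n}) : exists f : nat -> nat,
  (forall k, (f k < f k.+1)%N) /\ (forall k, (v (f k) <= v (f k.+1))%MM).
Proof.
suff [f [f1 f2]] : exists f : nat -> nat, (forall k, (f k < f k.+1)%N) /\
    forall i, i \in enum 'I_n -> forall k, (v (f k) i <= v (f k.+1) i)%N.
  by exists f; split=> // k; apply/mnm_lepP => i; apply: f2; rewrite mem_enum.
elim: (enum 'I_n) => [|i s [f [f1 f2]]]; first by exists id.
have [h [h1 h2]] := nondecreasing_subsequence (fun k => v (f k) i).
have mono (u : nat -> nat) : (forall k, (u k <= u k.+1)%N) ->
    forall j k, (j <= k)%N -> (u j <= u k)%N.
  move=> us j k /subnK <-; elim: (k - j)%N => // d IH.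
  by rewrite addSn; apply: leq_trans (us _).
exists (f \o h); split=> [k|j] /=.
  apply: (@leq_trans (f (h k).+1)) => //.
  by apply: (mono f) (h1 k) => l; apply: ltnW.
rewrite inE => /orP[/eqP -> k|js k]; first exact: h2.
by apply: (mono (fun k => v (f k) j)) (ltnW (h1 k)) => l; apply: f2.
Qed.

Lemma increasing_ge (f : nat -> nat) : (forall k, (f k < f k.+1)%N) ->
  forall k, (k <= f k)%N.
Proof. by move=> fS; elim=> // k IH; apply: leq_ltn_trans IH (fS k). Qed.

(** Otherwise, for every D there is a monomial k not covered in degrees up to D;
    Dickson's lemma extracts from these an infinite strictly ascending chain
    of ideals of A. *)
Lemma monomial_ideals_bounded n (A : comPzRingType) (L : 'X_{1..n} -> ideal A) :
  noetherian A -> (forall m k, (m <= k)%MM -> L m `<=` L k) ->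
  exists D, forall k, exists m, [/\ (m <= k)%MM, (mdeg m <= D)%N & L k `<=` L m].
Proof.
move=> hA Lmono; apply: contrapT => /forallNP bad.
have /choice [v vP] : forall D, exists k,
    forall m, (m <= k)%MM -> (mdeg m <= D)%N -> ~ (L k `<=` L m).
  move=> D; have /existsNP[k /forallNP hk] := bad D; exists k => m mk mD km.
  by apply: (hk m).
have [f [f1 f2]] := dickson v.
have [k hk] := noetherian_acc hA (fun k => Lmono _ _ (f2 k)).
pose j := (k + mdeg (v (f k)))%N.
apply: (vP (f j) (v (f k))) (hk j).
  rewrite /j; elim: (mdeg _) => [|d IH]; first by rewrite addn0; apply: lepm_refl.
  by apply: lepm_trans IH _; rewrite addnS.
apply: leq_trans (increasing_ge f1 j); exact: leq_addl.
Qed.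

Section LeadingMonomial.
Variables (n : nat) (A : comPzRingType).
Implicit Types (f g h : mpseries n A) (m k : 'X_{1..n}).

Lemma lead_exists h m : h m <> 0 ->
  exists k, [/\ (k <= m)%O, h k <> 0 & forall l, (l < k)%O -> h l = 0].
Proof.
elim/(well_founded_ind (@ltom_wf n)): m => m IH hm.
have [hl|/existsNP[l /not_implyP[lm hl]]] := pselect (forall l, (l < m)%O -> h l = 0).
  by exists m.
have [k [kl hk kmin]] := IH _ lm hl; exists k; split=> //.
by apply: le_trans kl (ltW lm).
Qed.

(** Reduction by leading monomials: to prove P modulo order t it suffices to
    be able to cancel leading terms of degree < t, since there are finitely
    many monomials of degree < t. *)
Lemma lead_ind t (P : mpseries n A -> Prop) :
  (forall h, ord_ge t h -> P h) ->
  (forall h k, (mdeg k < t)%N -> (forall l, (l < k)%O -> h l = 0) -> h k <> 0 ->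
     (forall h', (forall l, (l <= k)%O -> h' l = 0) -> P h') -> P h) ->
  forall h, P h.
Proof.
move=> Pord Plead.
pose up h : {set 'X_{1..n < t}} := finset (fun m : 'X_{1..n < t} => `[< exists2 k, (k <= val m)%O & h k <> 0 >]).
suff: forall N h, (#|up h| <= N)%N -> P h by move=> PN h; apply: (PN #|up h|).
elim=> [|N IH] h hN.
  apply: Pord => m mt; apply: contrapT => hm; move: hN.
  rewrite leqn0 cards_eq0 => /eqP/setP/(_ (BMultinom mt)).
  by rewrite !inE => /negbT/negP; apply; apply/asboolP; exists m.
have [|/existsNP[m /not_implyP[mt hm]]] := pselect (ord_ge t h); first exact: Pord.
have [k [km hk kmin]] := lead_exists hm.
have kt : (mdeg k < t)%N := leq_ltn_trans (lemc_mdeg km) mt.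
apply: (Plead h k) => // h' h'0; apply: IH; rewrite -ltnS.
apply: leq_trans hN; apply: proper_card; apply/properP; split.
  apply/fintype.subsetP => l; rewrite !inE.
  move=> [l' l'l h'l']; exists k => //.
  by apply: le_trans l'l; rewrite leNgt; apply/negP => /ltW/h'0.
exists (BMultinom kt); rewrite !inE; first by exists k.
by apply/negP; rewrite inE => -[l lk]; apply; apply: h'0.
Qed.

Definition mps_mono k (a : A) : mpseries n A :=
  MPSeries (fun m => if m == k then a else 0).

Lemma mps_monoM k a h m :
  (mps_mono k a * h) m = if (k <= m)%MM then a * h (m - k)%MM else 0.
Proof.
case: ifP => km.
  rewrite (@mps_coefM1 _ _ _ _ _ k) //= ?eqxx // => l _ /negPf ->; exact: mul0r.
apply: mps_coefM0 => l lm /=; case: eqP => [e|_]; last exact: mul0r.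
by rewrite -e lm in km.
Qed.

Lemma mps_mono_lt k a h l m : (forall l', (l' < l)%O -> h l' = 0) ->
  (m < (l + k)%MM)%O -> (mps_mono k a * h) m = 0.
Proof.
move=> hl ml; rewrite mps_monoM; case: ifP => // km; rewrite hl ?mulr0 //.
by rewrite -(ltmc_add2l _ _ k) submK.
Qed.

Lemma mps_mono_lead k a h l : (mps_mono k a * h) (l + k)%MM = a * h l.
Proof. by rewrite mps_monoM lem_addl addmK. Qed.

Lemma mps_mono_ord k a : ord_ge (mdeg k) (mps_mono k a).
Proof. by move=> m mk /=; case: eqP mk => // ->; rewrite ltnn. Qed.

End LeadingMonomial.

Section ArtinRees.
Variables (n : nat) (A : comPzRingType).
Hypothesis hA : noetherian A.
Variable I : ideal (mpseries n A).

Lemma lead_ideal_is_ideal (k : 'X_{1..n}) :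
  is_ideal [set a : A | exists h, [/\ ideal_set I h,
                          forall l, (l < k)%O -> h l = 0 & h k = a]].
Proof.
split=> [|_ _ [f [If f0 <-]] [g [Ig g0 <-]]|a _ [f [If f0 <-]]].
- by exists 0; split=> //; apply: ideal0.
- exists (f + g); split=> // [|l lk]; first exact: idealD.
  by rewrite mps_coefD f0 // g0 // addr0.
exists (mps_const n a * f); split=> [|l lk|]; first exact: idealM.
  by rewrite mps_constM f0 ?mulr0.
by rewrite mps_constM.
Qed.

Let lead_ideal k : ideal A := Ideal (lead_ideal_is_ideal k).

Let lead_ideal_mono m k : (m <= k)%MM -> lead_ideal m `<=` lead_ideal k.
Proof.
move=> mk _ [h [Ih h0 <-]]; exists (mps_mono (k - m)%MM 1 * h).
have e : (m + (k - m))%MM = k by rewrite addmC submK.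
split; first exact: idealM.
  by move=> l lk; apply: mps_mono_lt h0 _; rewrite e.
by have := mps_mono_lead (k - m)%MM 1 h m; rewrite e mul1r.
Qed.

(** A standard basis of I: lifts to I of generators of the leading coefficient
    ideals of the monomials of degree at most D. A leading term is cancelled by
    multiplying these lifts by monomials, at a loss of at most D in degree. *)
Lemma standard_basis : exists (T : finType) (g : T -> mpseries n A) (D : nat),
  (forall j, ideal_set I (g j)) /\
  forall h k, ideal_set I h -> (forall l, (l < k)%O -> h l = 0) ->
  exists q : T -> mpseries n A, (forall j, ord_ge (mdeg k - D) (q j)) /\
    forall l, (l <= k)%O -> (h - \sum_j q j * g j) l = 0.
Proof.
have [D hD] := monomial_ideals_bounded hA lead_ideal_mono.
pose d m := projT1 (cid (hA (lead_ideal m))).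
pose a m : 'I_(d m) -> A := projT1 (cid (projT2 (cid (hA (lead_ideal m))))).
have aP m : ideal_set (lead_ideal m) = ideal_gen (range (a m)).
  exact: projT2 (cid (projT2 (cid (hA (lead_ideal m))))).
pose T : finType := {m : 'X_{1..n < D.+1} & 'I_(d (val m))}.
have /choice [g gP] : forall j : T, exists h, [/\ ideal_set I h,
    forall l, (l < val (tag j))%O -> h l = 0 & h (val (tag j)) = a (val (tag j)) (tagged j)].
  move=> [m l] /=; suff: ideal_set (lead_ideal (val m)) (a (val m) l) by [].
  by rewrite aP; apply: ideal_gen_sub; exists l.
exists T, g, D; split=> [j|h k Ih h0]; first by have [] := gP j.
have [m [mk mD km]] := hD k.
have mD' : (mdeg m < D.+1)%N by [].
have : ideal_set (lead_ideal m) (h k) by apply: km; exists h.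
rewrite aP => /ideal_gen_rangeP[b hb]; pose m' := BMultinom mD'.
pose tg (i : 'I_(d m)) : T :=
  Tagged (fun m : 'X_{1..n < D.+1} => 'I_(d (val m))) (i : 'I_(d (val m'))).
pose q (j : T) : mpseries n A :=
  \sum_(i : 'I_(d m) | j == tg i) mps_mono (k - m)%MM (b i).
have qE : \sum_j q j * g j = \sum_(i : 'I_(d m)) mps_mono (k - m)%MM (b i) *
    g (tg i).
  rewrite (eq_bigr (fun j => \sum_(i : 'I_(d m) | j == tg i) mps_mono (k - m)%MM (b i) * g j)); last first.
    by move=> j _; rewrite mulr_suml.
  by rewrite (exchange_big_dep predT) //=; apply: eq_bigr => i _; rewrite big_pred1_eq.
exists q; split=> [j|l lk].
  apply: (@ideal_sum_cond _ (ord_ideal n A (mdeg k - D))) => i _.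
  apply: (@ord_ge_le _ _ _ (mdeg (k - m)%MM)); last exact: mps_mono_ord.
  by rewrite (mdeg_split mk) leq_subLR leq_add2r.
have e : (m + (k - m))%MM = k by rewrite addmC submK.
rewrite qE mps_coefB mps_sum_coef.
move: lk; rewrite le_eqVlt => /predU1P[->|lk].
  rewrite hb -sumrB big1 // => i _.
  have [_ _ /= <-] := gP (tg i).
  by rewrite -(mps_mono_lead (k - m)%MM) e subrr.
rewrite h0 // big1 ?subrr // => i _.
have [_ g0 _] := gP (tg i).
by apply: mps_mono_lt g0 _; rewrite /= e.
Qed.

(** Artin-Rees for the powers of the variables, with control of the
    multipliers: the successive reductions by a standard basis converge. *)
Lemma artin_rees : exists (T : finType) (g : T -> mpseries n A) (D : nat),
  (forall j, ideal_set I (g j)) /\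
  forall t h, ideal_set I h -> ord_ge t h ->
  exists q : T -> mpseries n A, (forall j, ord_ge (t - D) (q j)) /\
    h = \sum_j q j * g j.
Proof.
have [T [g [D [Ig red]]]] := standard_basis.
exists T, g, D; split=> // t h Ih ht.
have step : forall s f, exists q : T -> mpseries n A,
    ideal_set I f -> ord_ge s f ->
    (forall j, ord_ge (s - D) (q j)) /\ ord_ge s.+1 (f - \sum_j q j * g j).
  move=> s f; have [If|nIf] := pselect (ideal_set I f); last by exists (fun=> 0).
  have [fs|nfs] := pselect (ord_ge s f); last by exists (fun=> 0).
  suff [q qP] : exists q : T -> mpseries n A,
    (forall j, ord_ge (s - D) (q j)) /\ ord_ge s.+1 (f - \sum_j q j * g j) by exists q.
  move: f If fs; elim/(@lead_ind n A s.+1) => [f fs If fs'|f k ks f0 fk IH If fs].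
    exists (fun=> 0); split=> [j|]; first exact: ideal0 (ord_ideal n A _).
    by rewrite big1 ?subr0 // => j _; rewrite mul0r.
  have ek : mdeg k = s by apply/eqP; rewrite eqn_leq -ltnS ks leqNgt; apply/negP => /fs/fk.
  have [q [qk q0]] := red f k If f0; rewrite ek in qk.
  have [||r rP] := IH _ q0.
  - by apply: idealB => //; apply: ideal_sum => j; apply: idealM.
  - move=> m ms; apply: q0; apply: ltW; apply: lt_mdeg_ltmc; by rewrite ek.
  exists (fun j => q j + r j); split=> [j|].
    by apply: (idealD (I := ord_ideal n A (s - D))); [apply: qk | apply: rP.1].
  move: rP.2; congr ord_ge; rewrite -addrA -opprD -big_split.
  by congr (_ - _); apply: eq_bigr => j _; rewrite mulrDl.
pose qf s := projT1 (choice (step s)).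
have qfP s f : ideal_set I f -> ord_ge s f ->
    (forall j, ord_ge (s - D) (qf s f j)) /\
    ord_ge s.+1 (f - \sum_j qf s f j * g j) := projT2 (choice (step s)) f.
pose r := fix r k := if k is k'.+1 then
  r k' - \sum_j qf (t + k')%N (r k') j * g j else h.
have rP k : ideal_set I (r k) /\ ord_ge (t + k) (r k).
  elim: k => [|k [Ik ok]]; first by rewrite addn0.
  rewrite /= addnS; have [_ o] := qfP _ _ Ik ok; split=> //.
  by apply: idealB => //; apply: ideal_sum => j; apply: idealM.
pose a j k : mpseries n A := \sum_(l < k) qf (t + l)%N (r l) j.
have ra k : h - \sum_j a j k * g j = r k.
  elim: k => [|k IH]; first by rewrite big1 ?subr0 // => j _; rewrite /a big_ord0 mul0r.
  rewrite [RHS]/= -{1}IH -addrA -opprD -big_split; congr (_ - _).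
  by apply: eq_bigr => j _; rewrite /a big_ord_recr mulrDl.
have qo k j : ord_ge (t + k - D) (qf (t + k)%N (r k) j).
  by have [Ik ok] := rP k; have [] := qfP _ _ Ik ok.
have /choice [q qP] : forall j, exists b, forall k, ord_ge k (b - a j (k + D)%N).
  move=> j; apply: mps_complete => k; rewrite /a addSn big_ord_recr /= [X in X - _]addrC addrK.
  by apply: ord_ge_le (qo (k + D)%N j); lia.
exists q; split=> [j|].
  rewrite -(subrK (a j (t - D + D)%N) (q j)); apply: (idealD (I := ord_ideal n A (t - D))).
    exact: qP.
  apply: ideal_sum => l; apply: ord_ge_le (qo _ _); lia.
apply/eqP; rewrite -subr_eq0; apply/eqP/ord_ge_eq0 => k.
rewrite (_ : _ - _ = r (k + D)%N - \sum_j (q j - a j (k + D)%N) * g j).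
  apply: (idealB (I := ord_ideal n A k)).
    by apply: ord_ge_le (rP _).2; lia.
  by apply: ideal_sum => j; apply: idealMr; apply: qP.
rewrite -ra -addrA -opprD -big_split; congr (_ - _); apply: eq_bigr => j _.
by rewrite /= mulrBl addrC subrK.
Qed.

End ArtinRees.

Lemma mps_noetherian n (A : comPzRingType) : noetherian A -> noetherian (mpseries n A).
Proof.
move=> hA I; have [T [g [D [Ig red]]]] := artin_rees hA I.
exists #|T|, (fun i => g (enum_val i)); apply/seteqP; split=> h; last first.
  by apply: ideal_gen_min => _ [i _ <-].
move=> Ih; have [q [_ ->]] := red 0%N h Ih (ord_ge0 h).
apply: ideal_sum => j; apply: idealM; apply: ideal_gen_sub.
by exists (enum_rank j); rewrite // enum_rankK.
Qed.

(** Multiplication by f is strict, up to a bounded shift, for the order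
    filtration modulo P. *)
Lemma artin_rees_principal n (A : comPzRingType) (P : ideal (mpseries n A)) f :
  noetherian A -> exists D, forall t b,
  ideal_set (ideal_add P (ideal_gen [set f])) b -> ord_ge t b ->
  exists2 h, ord_ge (t - D) h & ideal_set P (b - f * h).
Proof.
move=> hA; have [T [g [D [gP red]]]] := artin_rees hA (ideal_add P (ideal_gen [set f])).
have gf j : exists c, ideal_set P (g j - f * c).
  have [x [y [Px fy ->]]] := gP j.
  have Q : is_ideal [set y | exists c, y = f * c].
    split=> [|_ _ [c ->] [d ->]|a _ [c ->]]; first by exists 0; rewrite mulr0.
      by exists (c + d); rewrite mulrDr.
    by exists (a * c); rewrite mulrCA.
  have [|c ->] := @ideal_gen_min _ _ (Ideal Q) _ y fy.
    by move=> _ ->; exists 1; rewrite mulr1.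
  by exists c; rewrite addrK.
have [c cP] := choice gf; exists D => t b Ib bt; have [q [qo ->]] := red t b Ib bt.
exists (\sum_j q j * c j).
  by apply: (ideal_sum (I := ord_ideal n A (t - D))) => j; apply: idealMr; apply: qo.
rewrite mulr_sumr -sumrB; apply: ideal_sum => j.
by rewrite mulrCA -mulrBr; apply: idealM.
Qed.

(** Krull's intersection theorem: by strictness, f is congruent to f h modulo J
    for some h of positive order, and 1 - h is invertible. *)
Lemma ideal_closed n (A : comPzRingType) (J : ideal (mpseries n A)) f :
  noetherian A -> (forall t, ideal_set (ideal_add J (ord_ideal n A t)) f) ->
  ideal_set J f.
Proof.
move=> hA hf; have [D hD] := artin_rees_principal J f hA.
have [x [y [Jx oy e]]] := hf D.+1.
have [|h h1 Jh] := hD D.+1 y _ oy.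
  rewrite (_ : y = - x + f); last by rewrite e addKr.
  apply: idealD; first by apply: ideal_addl; apply: idealN.
  by apply: ideal_addr; apply: ideal_gen_sub.
rewrite subSnn in h1; apply: (ideal_invertible (mps_invertible_1B h1)).
rewrite (_ : _ * f = x + (y - f * h)); first exact: idealD.
by rewrite addrA -e; ring.
Qed.

(** * The dimension of a power series ring over a field *)

(** A lower bound on the length of the quotient by I. *)
Definition has_chain (R : comPzRingType) (I : ideal R) (l : nat) : Prop :=
  exists c : nat -> ideal R, I `<=` c 0%N /\
    forall i, (i < l)%N -> ideal_set (c i) `<` c i.+1.

Section Chains.
Variable R : comPzRingType.
Implicit Types (I J P Q : ideal R).

Lemma has_chain0 I : has_chain I 0. Proof. by exists (fun=> I); split=> // x. Qed.

Lemma has_chain_sub I J l : J `<=` I -> has_chain I l -> has_chain J l.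
Proof. by move=> JI [c [Ic hc]]; exists c; split=> //; apply: subset_trans Ic. Qed.

Lemma has_chain_le I k l : (k <= l)%N -> has_chain I l -> has_chain I k.
Proof. by move=> kl [c [Ic hc]]; exists c; split=> // i ik; apply: hc; lia. Qed.

Lemma has_chain_cat (c : nat -> ideal R) a J b :
  (forall i, (i < a)%N -> ideal_set (c i) `<` c i.+1) -> c a `<=` J ->
  has_chain J b -> has_chain (c 0%N) (a + b).
Proof.
move=> hc caJ [d [Jd hd]].
have [->|b0] := posnP b; first by rewrite addn0; exists c; split=> // x.
exists (fun i => if (i <= a)%N then c i else d (i - a)%N); split=> // i iab.
have [ia|ia|ia] := ltngtP i a; first by apply: hc.
  have -> : (i.+1 - a = (i - a).+1)%N by lia.
  by apply: hd; lia.
rewrite ia subSnn; have h := hd 0%N b0.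
split=> [x /caJ/Jd/h.1 //|s]; apply: h.2 => x /s /caJ; exact: Jd.
Qed.

Lemma scale_is_ideal f I : is_ideal [set y | exists2 x, ideal_set I x & y = f * x].
Proof.
split=> [|_ _ [x Ix ->] [y Iy ->]|a _ [x Ix ->]].
- by exists 0; rewrite ?mulr0 //; apply: ideal0.
- by exists (x + y); rewrite ?mulrDr //; apply: idealD.
by exists (a * x); [apply: idealM | apply: mulrCA].
Qed.

Definition ideal_scale f I := Ideal (scale_is_ideal f I).

(** Superadditivity of length: if multiplication by f embeds R / P' into
    R / P with image inside Q / P, chains above P' and above Q are concatenated
    into one above P. *)
Lemma has_chain_add P P' Q f a b :
  P `<=` Q -> ideal_set Q f -> (forall g, ideal_set P (f * g) -> ideal_set P' g) ->
  has_chain P' a -> has_chain Q b -> has_chain P (a + b).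
Proof.
move=> PQ Qf fP [c [Pc hc]] hQ.
pose d i := ideal_add P (ideal_scale f (c i)).
have cm i : (i <= a)%N -> P' `<=` c i.
  elim: i => [//|i IH] ia x Px; apply: (hc i _).1 => //; apply: IH => //; lia.
apply: (@has_chain_sub (d 0%N)) => [x Px|]; first exact: ideal_addl.
apply: has_chain_cat hQ => [i ia|_ [x [_ [Px [y _ ->] ->]]]]; last first.
  by apply: idealD; [apply: PQ | apply: idealMr].
have [ci nci] := hc i ia; split=> [_ [x [_ [Px [y cy ->] ->]]]|s].
  by exists x, (f * y); split=> //; exists y => //; apply: ci.
apply: nci => g cg.
have /s[x [_ [Px [y cy ->] e]]] : ideal_set (d i.+1) (f * g).
  by apply: ideal_addr; exists g.
apply: ideal_exchange cy; apply: (cm i); first exact: ltnW.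
by apply: fP; rewrite mulrBr e addrK.
Qed.

End Chains.

Lemma mnm_le_mdeg n (m : 'X_{1..n}) i : (m i <= mdeg m)%N.
Proof. by rewrite mdegE (bigD1 i) //= leq_addr. Qed.

Section LengthBound.
Variables (n : nat) (K : comPzRingType).
Hypothesis hK : is_field K.
Implicit Types (I J : ideal (mpseries n K)).

Let lead t I : {set 'X_{1..n < t}} := finset (fun m : 'X_{1..n < t} =>
  `[< exists h, [/\ ideal_set I h, h (val m) <> 0 & forall l, (l < val m)%O -> h l = 0] >]).

Let lead_proper t I J : ord_ideal n K t `<=` I -> ideal_set I `<` J ->
  lead t I \proper lead t J.
Proof.
move=> tI [IJ JI]; apply/properP; split.
  apply/fintype.subsetP => m; rewrite !inE => -[h [Ih hm h0]].
  by exists h; split=> //; apply: IJ.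
apply: contrapT => no; apply: JI; elim/(@lead_ind n K t) => [h /tI //|h k kt h0 hk IH Jh].
have Jk : BMultinom kt \in lead t J by rewrite !inE; exists h.
have : BMultinom kt \in lead t I by apply: contrapT => /negP Ik; apply: no; exists (BMultinom kt).
rewrite !inE => -[g [Ig gk g0]]; have [a ag] := hK.2 _ gk.
have Ic : ideal_set I (mps_const n (h k * a) * g) by apply: idealM.
rewrite -(subrK (mps_const n (h k * a) * g) h); apply: idealD => //; apply: IH.
  move=> l; rewrite le_eqVlt => /predU1P[->|lk]; rewrite mps_coefB mps_constM.
    by rewrite -mulrA ag mulr1 subrr.
  by rewrite h0 // g0 // mulr0 subrr.
by apply: idealB => //; apply: IJ.
Qed.

Let card_lead t (c : nat -> ideal (mpseries n K)) l :
  ord_ideal n K t `<=` c 0%N -> (forall i, (i < l)%N -> ideal_set (c i) `<` c i.+1) ->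
  (l <= #|lead t (c l)|)%N /\ ord_ideal n K t `<=` c l.
Proof.
move=> t0; elim: l => [|l IH] hc //.
have [|h1 h2] := IH; first by move=> i il; apply: hc; lia.
split; last by move=> x /h2; apply: (hc l _).1.
by apply: leq_ltn_trans h1 _; apply: proper_card; apply: lead_proper => //; apply: hc.
Qed.

(** Strictly increasing ideals containing the t-th power of the maximal ideal
    have strictly increasing sets of leading monomials of degree < t. *)
Lemma length_bound t I l : ord_ideal n K t `<=` I -> has_chain I l -> (l <= t ^ n)%N.
Proof.
move=> tI [c [Ic hc]]; have [h _] := card_lead (subset_trans tI Ic) hc.
apply: leq_trans h (leq_trans (max_card _) _).
pose F (m : 'X_{1..n < t}) : {ffun 'I_n -> 'I_t} := [ffun i =>
  Ordinal (leq_ltn_trans (mnm_le_mdeg (val m) i) (bmdeg m))].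
have -> : (t ^ n = #|{ffun 'I_n -> 'I_t}|)%N by rewrite card_ffun !card_ord.
apply: (@leq_card _ _ F) => m k e; apply/val_inj/mnmP => i.
by have := congr1 val (f_equal (fun f : {ffun 'I_n -> 'I_t} => f i) e); rewrite !ffunE.
Qed.

End LengthBound.

Section PrimeChains.
Variables (n : nat) (K : comPzRingType).
Hypothesis hK : is_field K.
Let S := mpseries n K.
Let M t : ideal S := ord_ideal n K t.

Let M_le s t : (s <= t)%N -> M t `<=` M s.
Proof. by move=> st f; apply: ord_ge_le. Qed.

Lemma prime_add_ord_proper (P : Spec S) t : ~ ideal_set (ideal_add P (M t.+1)) 1.
Proof.
move=> [x [y [Px oy e]]]; apply: (spec_proper (s := P)).
have h : invertible (1 - y) by apply: mps_invertible_1B; apply: ord_ge_le oy.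
apply: (ideal_invertible h); rewrite mulr1 (_ : 1 - y = x) //.
by rewrite e addrK.
Qed.

(** Strictness from Artin-Rees, combined with primality to cancel f. *)
Lemma prime_strict (P : Spec S) f : ~ ideal_set P f -> exists D, forall t g,
  ideal_set (ideal_add P (M t)) (f * g) -> ideal_set (ideal_add P (M (t - D))) g.
Proof.
move=> Pf; have [D hD] := artin_rees_principal P f (field_noetherian hK).
exists D => t g [a [b [Pa ob e]]].
have [|h oh Ph] := hD t b _ ob.
  rewrite (_ : b = - a + g * f); last by rewrite mulrC e addKr.
  apply: idealD; first by apply: ideal_addl; apply: idealN.
  by apply: ideal_addr; apply: idealM; apply: ideal_gen_sub.
have [//|Pgh] : ideal_set P f \/ ideal_set P (g - h).
  apply: spec_prime; rewrite (_ : _ * _ = a + (b - f * h)); first exact: idealD.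
  by rewrite mulrBr e addrA.
by exists (g - h), h; rewrite subrK.
Qed.

(** A prime chain of length d forces the quotients modulo powers of the
    variables to have length growing at least like t^d: by strictness of the
    multiplication by an element of the second prime outside the first, the
    length function of the first prime has differences bounded below by the
    length function of the second one. *)
Lemma prime_chain_growth d (P : nat -> Spec S) :
  (forall i, (i < d)%N -> ideal_set (P i) `<` P i.+1) ->
  exists c, forall t, has_chain (ideal_add (P 0%N) (M (c * t.+1))) 'C(t, d).
Proof.
elim: d P => [|d IH] P hP.
  exists 1%N => t; rewrite bin0 mul1n.
  have hT : is_ideal [set: S] by [].
  pose I := ideal_add (P 0%N) (M t.+1).
  exists (fun k => if k is 0%N then I else Ideal hT); split=> // -[|//] _ /=.
  by split=> // h; apply: (@prime_add_ord_proper (P 0%N) t); apply: h.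
have [|c hc] := IH (fun i => P i.+1); first by move=> i id; apply: hP.
have [P01 /existsNP[f /not_implyP[P1f P0f]]] := hP 0%N isT.
have [D hD] := prime_strict P0f.
pose c' := (c + D)%N; exists c'.
suff h t : has_chain (ideal_add (P 0%N) (M (c' * t))) 'C(t, d.+1).
  move=> t; apply: has_chain_le (h t.+1); rewrite binS; exact: leq_addr.
elim: t => [|t IHt]; first by rewrite bin0n; apply: has_chain0.
rewrite binS.
apply: (@has_chain_add _ _ (ideal_add (P 0%N) (M (c' * t))) (ideal_add (P 1%N) (M (c' * t.+1))) f) => //.
- by move=> _ [x [y [Px My ->]]]; exists x, y; split=> //; apply: P01.
- exact: ideal_addl.
- move=> g /hD [x [y [Px My ->]]]; exists x, y; split=> //.
  by apply: M_le My; rewrite mulnS /c'; lia.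
apply: has_chain_sub (hc t) => _ [x [y [Px My ->]]]; exists x, y; split=> //.
by apply: M_le My; rewrite leq_mul2r /c' leq_addr orbT.
Qed.

Lemma binomial_beats_power k c : exists t, ((c * t.+1) ^ k < 'C(t, k.+1))%N.
Proof.
pose u := (k.+1`! * (2 * c) ^ k + k.+2)%N; exists (k.+1 + u)%N.
have u_le : (u ^ k.+1 <= 'C(k.+1 + u, k.+1) * k.+1`!)%N.
  rewrite bin_ffact ffact_prod.
  rewrite (_ : (u ^ k.+1 = \prod_(i < k.+1) u)%N); last by rewrite prod_nat_const card_ord.
  by apply: leq_prod => i _; have := ltn_ord i; lia.
rewrite ltnNge; apply/negP => h.
have exp_mono a b : (a <= b)%N -> (a ^ k <= b ^ k)%N.
  by have [->|k0] := posnP k; rewrite ?expn0 // leq_exp2r.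
have : (u ^ k.+1 <= k.+1`! * (2 * c) ^ k * u ^ k)%N.
  apply: leq_trans u_le _; rewrite mulnC -mulnA leq_mul2l -expnMn; apply/orP; right.
  apply: leq_trans h _; apply: exp_mono; rewrite /u; nia.
rewrite expnS leq_pmul2r; last by rewrite expn_gt0 /u addnS.
by rewrite /u addnS ltnNge leq_addr.
Qed.

Theorem prime_chain_length d : prime_chain S d -> (d <= n)%N.
Proof.
move=> [P hP]; rewrite leqNgt; apply/negP => nd.
pose P' i : Spec S := P (inord i).
have [|c hc] := @prime_chain_growth n.+1 P'.
  by move=> i id; apply: hP; rewrite !inordK //; lia.
have [t] := binomial_beats_power n c; apply/negP; rewrite -leqNgt.
by apply: length_bound (hc t) => // f; apply: ideal_addr.
Qed.

(** Leading monomials multiply. *)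
Lemma mps_domain (f g : S) : f * g = 0 -> f = 0 \/ g = 0.
Proof.
move=> fg; apply: contrapT => /not_orP[f0 g0].
have lead (h : S) : h <> 0 -> exists k, h k <> 0 /\ forall l, (l < k)%O -> h l = 0.
  move=> h0; have [m hm] : exists m, h m <> 0.
    by apply: contrapT => /forallNP h'; apply: h0; apply/mpseriesP => m; apply: contrapT; apply: h'.
  by have [k [_ hk h']] := lead_exists hm; exists k.
have [k [fk fmin]] := lead f f0; have [l [gl gmin]] := lead g g0.
have := congr1 (fun h : S => h (k + l)%MM) fg; rewrite /= -[LHS]/((f * g) _).
rewrite (@mps_coefM1 _ _ _ _ _ k) ?lem_addr // => [|m mkl mk].
  rewrite [(k + l)%MM]addmC addmK => e; have [a ag] := hK.2 _ gl.
  by apply: fk; rewrite -[f k]mulr1 -ag [a * _]mulrC mulrA e mul0r.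
case: (ltgtP m k) mk => // [mk|mk] _; first by rewrite fmin ?mul0r.
rewrite [X in _ * X]gmin ?mulr0 //.
by rewrite -(ltmc_add2l _ _ m) submK // addmC ltmc_add2r.
Qed.

Lemma zero_ideal_proper : ~ ideal_set (zero_ideal S) 1.
Proof. by move=> /(congr1 (@mps_coef0 n K)); rewrite mps_coef01; apply: hK.1. Qed.

Definition mps_zero_spec : Spec S := PrimeIdeal zero_ideal_proper mps_domain.

Let off i (m : 'X_{1..n}) := [forall j : 'I_n, (j < i)%N ==> (m j == 0%N)].

Let offD i m k : off i (m + k)%MM = off i m && off i k.
Proof.
apply/forallP/andP => [h|[/forallP h1 /forallP h2] j]; last first.
  by apply/implyP => ji; rewrite mnmDE (eqP (implyP (h1 j) ji)) (eqP (implyP (h2 j) ji)).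
by split; apply/forallP => j; apply/implyP => /(implyP (h j)); rewrite mnmDE addn_eq0 => /andP[].
Qed.

Lemma coordinate_is_ideal i : is_ideal [set f : S | forall m, off i m -> f m = 0].
Proof.
split=> [m //|f g f0 g0 m im|a f f0 m im].
  by rewrite mps_coefD f0 // g0 // addr0.
apply: mps_coefM0 => k km; rewrite f0 ?mulr0 //.
by move: im; rewrite -{1}(submK km) offD => /andP[].
Qed.

Definition coordinate_ideal i : ideal S := Ideal (coordinate_is_ideal i).

Lemma coordinate_proper i : ~ ideal_set (coordinate_ideal i) 1.
Proof.
move=> /(_ 0%MM) h; apply: hK.1; rewrite -(mps_coef01 n K); apply: h.
by apply/forallP => j; rewrite mnm0E eqxx implybT.
Qed.

(** The quotient is the power series ring in the remaining variables, embedded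
    here as the series supported on the monomials in these variables. *)
Lemma coordinate_prime i f g : ideal_set (coordinate_ideal i) (f * g) ->
  ideal_set (coordinate_ideal i) f \/ ideal_set (coordinate_ideal i) g.
Proof.
move=> fg; pose tr (h : S) : S := MPSeries (fun m => if off i m then h m else 0).
have tr0 h : tr h = 0 -> ideal_set (coordinate_ideal i) h.
  by move=> /mpseriesP h0 m im; have := h0 m; rewrite /= im.
suff: tr f * tr g = 0 by move=> /mps_domain[/tr0|/tr0]; [left | right].
apply/mpseriesP => m; have [im|im] := boolP (off i m).
  transitivity ((f * g) m); last exact: fg.
  rewrite !mps_coefM; apply: eq_bigr => k km /=.
  by move: im; rewrite -{1}(submK km) offD => /andP[-> ->].
apply: mps_coefM0 => k km /=; move: im; rewrite -{1}(submK km) offD negb_and.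
by case: ifP => [_|_]; [case: ifP => // _; rewrite mulr0 | case: ifP => // _; rewrite mul0r].
Qed.

Lemma coordinate_chain : prime_chain S n.
Proof.
pose P i : Spec S := PrimeIdeal (@coordinate_proper i) (@coordinate_prime i).
exists (fun i => P i) => i j ij; split=> [f fi m /forallP jm|].
  apply: fi; apply/forallP => k; apply/implyP => ki; apply: (implyP (jm k)); lia.
have i_lt : (i < n)%N by have := ltn_ord j; lia.
pose i' := Ordinal i_lt; move=> /(_ (mps_var K i')) h.
have /h/(_ U_(i')%MM) : ideal_set (P j) (mps_var K i').
  move=> m /forallP/(_ i')/implyP/(_ ij)/eqP mi /=.
  by case: ifP => // /eqP e; move: mi; rewrite e mnm1E eqxx.
rewrite /= eqxx => h1; apply: hK.1; apply: h1.
apply/forallP => k; apply/implyP => ki; rewrite mnm1E.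
by rewrite eqb0; apply/eqP => e; rewrite -e /= ltnn in ki.
Qed.

End PrimeChains.

Lemma local_ring_maximal (R : comPzRingType) (M : ideal R) :
  ~ ideal_set M 1 -> (forall x, ~ ideal_set M x -> invertible x) ->
  maximal_ideal M /\ forall M', maximal_ideal M' -> ideal_set M' = M.
Proof.
move=> M1 hM; split.
  split=> // J MJ; have [JM|/existsNP[x /not_implyP[Jx /hM[y yx]]]] := pselect (J `<=` M).
    by left; apply/seteqP.
  right; apply/seteqP; split=> // z _; rewrite -[z]mulr1 -yx.
  by do 2!apply: idealM.
move=> M' [M'1 hM'].
have M'M : M' `<=` M.
  move=> x M'x; apply: contrapT => /hM[y yx]; apply: M'1; rewrite -yx; exact: idealM.
by have [//|e] := hM' M M'M; case: M1; rewrite e.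
Qed.

Lemma mps_var_ideal_invertible n (K : comPzRingType) (f : mpseries n K) :
  is_field K -> ~ ideal_set (var_ideal n K) f -> invertible f.
Proof. by move=> hK /var_idealP f0; apply: mps_invertible; apply: hK.2. Qed.

Theorem mps_regular n (K : comPzRingType) :
  is_field K -> regular_local_ring (mpseries n K).
Proof.
move=> hK; split; first exact/mps_noetherian/field_noetherian.
have [||h1 h2] := @local_ring_maximal _ (var_ideal n K).
- by move=> /var_idealP; rewrite mps_coef01; apply: hK.1.
- by move=> x; apply: mps_var_ideal_invertible.
exists (var_ideal n K); split=> //; exists n; last by exists (@mps_var n K).
by split; [apply: coordinate_chain | apply: prime_chain_length].
Qed.

Lemma comap_cancel (R R' : comPzRingType) (f : {rmorphism R -> R'})
    (g : {rmorphism R' -> R}) (I : ideal R) :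
  cancel f g -> ideal_set (ideal_comap f (ideal_comap g I)) = I.
Proof. by move=> fg; apply/seteqP; split=> x /=; rewrite fg. Qed.

Lemma comap_maximal (R R' : comPzRingType) (f : {rmorphism R -> R'})
    (g : {rmorphism R' -> R}) (I : ideal R') :
  cancel f g -> cancel g f -> maximal_ideal I -> maximal_ideal (ideal_comap f I).
Proof.
move=> fg gf [I1 hI]; split=> [|J IJ]; first by rewrite /= rmorph1.
have [|e|e] := hI (ideal_comap g J).
- by move=> y Iy; apply: IJ; rewrite /= gf.
- by left; rewrite -(comap_cancel J fg); apply/seteqP; split=> x /=; rewrite -e.
right; apply/seteqP; split=> // x _; rewrite -[x]fg.
by suff: ideal_set (ideal_comap g J) (f x) by []; rewrite e.
Qed.

Section Isomorphism.
Variables (R R' : comPzRingType) (f : {rmorphism R -> R'}).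
Hypothesis f_inj : forall x, f x = 0 -> x = 0.
Hypothesis f_surj : forall y, exists x, f x = y.

Let inj x y : f x = f y -> x = y.
Proof.
by move=> e; apply/eqP; rewrite -subr_eq0; apply/eqP/f_inj; rewrite rmorphB e subrr.
Qed.

Lemma rmorph_inverse : exists g : {rmorphism R' -> R}, cancel f g /\ cancel g f.
Proof.
have [g gP] := choice f_surj.
have [||h hE] := @rmorphismP _ _ g.
- by move=> x y; apply: inj; rewrite gP rmorphB !gP.
- by split=> [|x y]; apply: inj; rewrite ?rmorphM !gP ?rmorph1.
by exists h; split=> x; [apply: inj | ]; rewrite hE gP.
Qed.

(** Regularity only involves ideals, hence is invariant under isomorphism. *)
Lemma regular_iso : regular_local_ring R' -> regular_local_ring R.
Proof.
have [g [fg gf]] := rmorph_inverse.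
have g_surj x : exists y, g y = x by exists (f x).
have gen (I : ideal R) d (a : 'I_d -> R') :
    ideal_set (ideal_comap g I) = ideal_gen (range a) ->
    ideal_set I = ideal_gen (range (fun i => g (a i))).
  move=> e; apply/seteqP; split=> x.
    rewrite -[x]fg => Ix; have : ideal_set (ideal_comap g I) (f x) by [].
    rewrite e; apply: rmorph_ideal_gen => _ [i _ <-]; apply: ideal_gen_sub.
    by exists i.
  apply: ideal_gen_min => _ [i _ <-].
  suff: ideal_set (ideal_comap g I) (a i) by [].
  by rewrite e; apply: ideal_gen_sub; exists i.
have chain d : prime_chain R d -> prime_chain R' d.
  by move=> [P hP]; exists (fun i => spec_comap g (P i)) => i j ij; apply: comap_chain (hP i j ij).
have chain' d : prime_chain R' d -> prime_chain R d.
  by move=> [P hP]; exists (fun i => spec_comap f (P i)) => i j ij; apply: comap_chain (hP i j ij).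
move=> [nR [M [Mmax Muniq [d [dim_ge dim_le] [a Ma]]]]]; split.
  move=> I; have [e [b hb]] := nR (ideal_comap g I).
  by exists e, (fun i => g (b i)); apply: gen.
exists (ideal_comap f M); split.
- exact: comap_maximal fg gf Mmax.
- move=> M' hM'; have e := Muniq _ (comap_maximal gf fg hM').
  by rewrite -(comap_cancel M' fg); apply/seteqP; split=> x /=; rewrite -e.
exists d; first by split=> [|e /chain/dim_le //]; apply: chain'.
exists (fun i => g (a i)); apply: gen; rewrite -Ma; exact: comap_cancel.
Qed.

End Isomorphism.

(** * Linear parts and coordinates *)

Lemma field_splitting (F : fieldType) m n (L : 'M[F]_(m, n)) :
  exists r e (f : 'I_r -> 'I_m) (U : 'M[F]_(n, r)) (V : 'M[F]_(e, n)) (W : 'M[F]_(n, e)),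
  [/\ rowsub f L *m U = 1%:M, L *m W = 0, V *m W = 1%:M &
      U *m rowsub f L + W *m V = 1%:M].
Proof.
pose L1 := rowsub (maxrankfun L) L; pose V := row_base (L1^C)%MS.
have rL : \rank L1 = \rank L by rewrite eq_maxrowsub.
have fullP : row_full (col_mx L1 V).
  rewrite -sub1mx -addsmxE; apply: submx_trans (_ : (L1 + L1^C <= _)%MS).
    by rewrite sub1mx addsmx_compl_full.
  by apply: addsmxS => //; rewrite eq_row_base.
have freeP : row_free (col_mx L1 V).
  rewrite /row_free (eqP fullP) mxrank_compl rL subnKC //.
  exact: rank_leq_col.
have [B BP] := row_fullP fullP; have [B' PB'] := row_freeP freeP.
have PB : col_mx L1 V *m B = 1%:M.
  by rewrite (_ : B = B') // -[B]mulmx1 -PB' mulmxA BP mul1mx.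
exists (\rank L), (\rank (L1^C)%MS), (maxrankfun L), (lsubmx B), V, (rsubmx B).
move: PB BP; rewrite -{1 2}[B]hsubmxK mul_col_row scalar_mx_block => /eq_block_mx[h1 h2 _ h4].
rewrite mul_row_col => h; split=> //.
have /submxP[C LE] : (L <= L1)%MS by rewrite eq_maxrowsub.
by rewrite [X in X *m _]LE -mulmxA h2 mulmx0.
Qed.

Section FieldOf.
Variables (K : comPzRingType) (hK : is_field K).

(** K with a chosen inverse operation, so that the rank theory of matrices
    over a field applies to it. *)
Definition field_of (_ : is_field K) : Type := K.
Local Notation F := (field_of hK).
HB.instance Definition _ := GRing.ComPzRing.on F.

Let one_neq0 : (1 : F) != 0. Proof. by apply/eqP; apply: hK.1. Qed.
HB.instance Definition _ := GRing.PzSemiRing_isNonZero.Build F one_neq0.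

Let inv_ex (x : F) : exists y : F, x = 0 /\ y = 0 \/ x <> 0 /\ y * x = 1.
Proof.
have [->|x0] := pselect (x = 0); first by exists 0; left.
by have [y yx] := hK.2 _ x0; exists y; right.
Qed.
Let inv x := sval (cid (inv_ex x)).
Let mulVf (x : F) : x != 0 -> inv x * x = 1.
Proof. by move=> /eqP x0; rewrite /inv; case: (cid _) => y /= [[]|[]]. Qed.
Let inv0 : inv 0 = 0.
Proof. by rewrite /inv; case: (cid _) => y /= [[]|[]]. Qed.
HB.instance Definition _ := GRing.ComNzRing_isField.Build F mulVf inv0.

End FieldOf.

(** The rows of L with indices in f are a basis of its row space, W is a basis
    of the kernel of L, and U and V complete them to inverse coordinate
    systems. *)
Lemma linear_splitting (K : comPzRingType) m n (L : 'M[K]_(m, n)) : is_field K ->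
  exists r e (f : 'I_r -> 'I_m) (U : 'M[K]_(n, r)) (V : 'M[K]_(e, n)) (W : 'M[K]_(n, e)),
  [/\ rowsub f L *m U = 1%:M, L *m W = 0, V *m W = 1%:M &
      U *m rowsub f L + W *m V = 1%:M].
Proof. by move=> hK; apply: (@field_splitting (field_of hK)). Qed.

Lemma right_inverse_min (K : comPzRingType) m n (X : 'M[K]_(m, n)) (Y : 'M[K]_(n, m)) :
  is_field K -> X *m Y = 1%:M -> (m <= n)%N.
Proof. by move=> hK; apply: (@mulmx1_min (field_of hK)). Qed.

Lemma subst_ord n e (A R : comPzRingType) (v : {rmorphism mpseries n A -> mpseries e R}) :
  (forall i, ord_ge 1 (v (mps_var A i))) -> forall t f, ord_ge t f -> ord_ge t (v f).
Proof.
move=> v1 t f ft; apply: (@ord_ideal_exp _ _ (ord_ideal e R 1)) => //.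
exact: (hom_ord (Q := ord_ideal e R 1)) ft.
Qed.

(** An endomorphism that is the identity to first order modulo J is the
    identity on leading forms modulo J. *)
Lemma hom_graded n (K : comPzRingType) (J : ideal (mpseries n K))
    (a : {rmorphism mpseries n K -> mpseries n K}) :
  (forall x, a (mps_const n x) = mps_const n x) ->
  (forall i, ideal_set (ideal_add J (ord_ideal n K 2)) (a (mps_var K i) - mps_var K i)) ->
  forall t f, ord_ge t f -> ideal_set (ideal_add J (ord_ideal n K t.+1)) (a f - f).
Proof.
move=> ac av; have Mle s t : (s <= t)%N ->
    ideal_add J (ord_ideal n K t) `<=` ideal_add J (ord_ideal n K s).
  by move=> st _ [x [y [Jx oy ->]]]; exists x, y; split=> //; apply: ord_ge_le oy.
have MM s t x y : ideal_set (ideal_add J (ord_ideal n K s)) x ->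
    ideal_set (ideal_add J (ord_ideal n K t)) y ->
    ideal_set (ideal_add J (ord_ideal n K (s + t))) (x * y).
  move=> [x1 [x2 [Jx ox ->]]] [y1 [y2 [Jy oy ->]]]; rewrite mulrDl mulrDr.
  apply: idealD; first by apply: ideal_addl; apply: idealD; apply: idealMr.
  rewrite mulrDr; apply: idealD; first by apply: ideal_addl; apply: idealM.
  by apply: ideal_addr; apply: ord_geM.
have xM i : ideal_set (ideal_add J (ord_ideal n K 1)) (mps_var K i).
  by apply: ideal_addr; apply: ord_ge_var.
have decomp := hom_sub_decomp (a := a) (b := idfun) ac.
elim=> [|t IH] f.
  have [G ->] := mps_decomp f => _; rewrite decomp; apply: ideal_sum => i.
  apply: idealD; first by apply: idealMr; apply: Mle (av i).
  by apply: idealMr; apply: xM.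
move=> /ord_geS[G [Gt e]].
have -> : f = mps_const n 0 + \sum_i mps_var K i * G i by rewrite rmorph0 add0r.
rewrite decomp; apply: ideal_sum => i; apply: idealD.
  apply: (MM 2 t); first exact: av.
  apply: (ideal_exchange (y := G i)); last by apply: ideal_addr; apply: Gt.
  by apply: Mle (IH _ (Gt i)).
by apply: (MM 1%N t.+1); [apply: xM | apply: IH].
Qed.

Definition linear_form n (K : comPzRingType) (c : 'I_n -> K) : mpseries n K :=
  \sum_i mps_const n (c i) * mps_var K i.

Lemma linear_form_ord n (K : comPzRingType) (c : 'I_n -> K) : ord_ge 1 (linear_form c).
Proof.
apply: (ideal_sum (I := ord_ideal n K 1)) => i; apply: idealM; exact: ord_ge_var.
Qed.

Lemma linear_part n (K : comPzRingType) (g : mpseries n K) :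
  ord_ge 1 g -> ord_ge 2 (g - linear_form (fun i => g U_(i)%MM)).
Proof.
move=> /ord_geS[G [_ e]]; rewrite {1}e /linear_form -sumrB.
apply: (ideal_sum (I := ord_ideal n K 2)) => i.
rewrite e coef_var_sum mulrC -mulrBl -[2%N]/(1 + 1)%N.
apply: ord_geM; last exact: ord_ge_var.
by apply/ord_ge1; rewrite mps_coef0B mps_coef0_const subrr.
Qed.

Lemma hom_linear_form n (K C : comPzRingType) (v : {rmorphism mpseries n K -> C}) c :
  v (linear_form c) = \sum_i v (mps_const n (c i)) * v (mps_var K i).
Proof. by rewrite rmorph_sum; apply: eq_bigr => i _; rewrite rmorphM. Qed.

Lemma linear_form_comb n (K : comPzRingType) k (a : 'I_k -> K) (c : 'I_k -> 'I_n -> K) :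
  \sum_l mps_const n (a l) * linear_form (c l) =
  linear_form (fun i => \sum_l a l * c l i).
Proof.
rewrite /linear_form; under eq_bigr do rewrite mulr_sumr.
rewrite exchange_big; apply: eq_bigr => i _; rewrite rmorph_sum mulr_suml.
by apply: eq_bigr => l _; rewrite rmorphM mulrA.
Qed.

Lemma linear_formB n (K : comPzRingType) (a b : 'I_n -> K) :
  linear_form a - linear_form b = linear_form (fun i => a i - b i).
Proof.
by rewrite /linear_form -sumrB; apply: eq_bigr => i _; rewrite rmorphB mulrBl.
Qed.

Lemma linear_form_delta n (K : comPzRingType) (i : 'I_n) (c : 'I_n -> K) :
  (forall j, c j = (i == j)%:R) -> linear_form c = mps_var K i.
Proof.
move=> h; rewrite /linear_form (bigD1 i) //= h eqxx rmorph1 mul1r big1 ?addr0 // => j ji.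
by rewrite h eq_sym (negPf ji) rmorph0 mul0r.
Qed.

Lemma substitution_linear n e (K : comPzRingType) (W : 'M[K]_(n, e)) :
  exists v : {rmorphism mpseries n K -> mpseries e K},
  [/\ forall a, v (mps_const n a) = mps_const e a,
      forall i, v (mps_var K i) = linear_form (W i) &
      forall t f, ord_ge t f -> ord_ge t (v f)].
Proof.
have [v [vc vx]] := @substitution n e K K idfun _ (fun i => linear_form_ord (W i)).
by exists v; split=> //; apply: subst_ord => i; rewrite vx; apply: linear_form_ord.
Qed.

Section Coordinates.
Variables (K : comPzRingType) (n m r e : nat) (G : 'I_m -> mpseries n K).
Hypothesis hK : is_field K.
Hypothesis G1 : forall j, ord_ge 1 (G j).
Let L : 'M[K]_(m, n) := \matrix_(j, i) G j U_(i)%MM.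
Variables (f : 'I_r -> 'I_m) (U : 'M[K]_(n, r)) (V : 'M[K]_(e, n)) (W : 'M[K]_(n, e)).
Hypothesis LW : L *m W = 0.
Hypothesis VW : V *m W = 1%:M.
Hypothesis ULWV : U *m rowsub f L + W *m V = 1%:M.
Variables (theta : {rmorphism mpseries e K -> mpseries n K}).
Hypothesis theta_const : forall a, theta (mps_const e a) = mps_const n a.
Hypothesis theta_var : forall l, theta (mps_var K l) = linear_form (V l).
Hypothesis theta_ord : forall t h, ord_ge t h -> ord_ge t (theta h).

Let J := ideal_gen (range (fun l => G (f l))).

(** The series in the kernel coordinates represent all classes modulo the
    selected generators: linear algebra corrects the leading form, and the
    corrections converge. *)
Lemma theta_surj h : exists h0, ideal_set J (h - theta h0).
Proof.
have [lam [lam_const lam_var lam_ord]] := substitution_linear W.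
have step t g : ord_ge t g -> ideal_set (ideal_add J (ord_ideal n K t.+1)) (g - theta (lam g)).
  move=> gt; rewrite -opprB; apply: idealN.
  apply: (@hom_graded n K J (theta \o lam)) gt => [x|i].
    by rewrite /= lam_const theta_const.
  rewrite [X in ideal_set _ (X - _)]/= lam_var hom_linear_form.
  under eq_bigr do rewrite theta_const theta_var.
  rewrite linear_form_comb -(@linear_form_delta _ _ i (1%:M i)) => [|j]; last by rewrite mxE.
  rewrite linear_formB (_ : linear_form _ = - \sum_l mps_const n (U i l) * linear_form (rowsub f L l)).
        apply: idealN; apply: ideal_sum => l; apply: idealM.
    rewrite -(subrK (G (f l)) (linear_form _)); apply: idealD; last first.
      by apply: ideal_addl; apply: ideal_gen_sub; exists l.
    rewrite -opprB; apply: idealN; apply: ideal_addr.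
    rewrite (_ : linear_form _ = linear_form (fun i => G (f l) U_(i)%MM)); first exact: linear_part.
    by apply: eq_bigr => j _; rewrite !mxE.
  rewrite linear_form_comb /linear_form -sumrN; apply: eq_bigr => j _.
  rewrite -mulNr -rmorphN; congr (mps_const n _ * _).
  have := congr1 (fun X : 'M_n => X i j) ULWV; rewrite !mxE => <-.
  by rewrite opprD addrCA subrr addr0.
have rho_ex g t : exists y, ideal_set (ideal_add J (ord_ideal n K t)) g ->
    ord_ge t y /\ ideal_set J (g - y).
  have [[x [y [Jx oy ->]]]|no] := pselect (ideal_set (ideal_add J (ord_ideal n K t)) g).
    by exists y => _; rewrite addrK.
  by exists 0.
pose rho g t := sval (cid (rho_ex g t)).
have rhoP g t : ideal_set (ideal_add J (ord_ideal n K t)) g ->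
    ord_ge t (rho g t) /\ ideal_set J (g - rho g t) := svalP (cid (rho_ex g t)).
pose s := fix s t := if t is t'.+1 then s t' + lam (rho (h - theta (s t')) t') else 0.
have sP t : ideal_set (ideal_add J (ord_ideal n K t)) (h - theta (s t)).
  elim: t => [|t IH]; first by apply: ideal_addr.
  have [ot Jt] := rhoP _ _ IH; rewrite [s t.+1]/= rmorphD opprD addrA.
  move: Jt ot; set g := h - _; set d := rho _ _ => Jt ot.
  rewrite -[g](subrK d) -addrA; apply: idealD; first exact: ideal_addl.
  exact: step.
have [|h0 hh0] := @mps_complete _ _ s.
  by move=> t; rewrite /= addrC addKr; apply: lam_ord; have [] := rhoP _ _ (sP t).
exists h0; apply: ideal_closed; first exact: field_noetherian.
move=> t; rewrite -(subrK (theta (s t)) (theta h0)) opprD addrCA.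
apply: idealD; last exact: sP.
by apply: ideal_addr; apply: idealN; rewrite -rmorphB; apply: theta_ord; apply: hh0.
Qed.

End Coordinates.

(** The composite psi theta is the identity on leading forms. *)
Lemma theta_inj (K : comPzRingType) n e (V : 'M[K]_(e, n)) (W : 'M[K]_(n, e))
    (theta : {rmorphism mpseries e K -> mpseries n K})
    (psi : {rmorphism mpseries n K -> mpseries e K}) :
  V *m W = 1%:M ->
  (forall a, theta (mps_const e a) = mps_const n a) ->
  (forall l, theta (mps_var K l) = linear_form (V l)) ->
  (forall a, psi (mps_const n a) = mps_const e a) ->
  (forall i, ord_ge 2 (psi (mps_var K i) - linear_form (W i))) ->
  forall h, psi (theta h) = 0 -> h = 0.
Proof.
move=> VW theta_const theta_var psi_const psi_var h h0.
apply: ord_ge_eq0; elim=> [|t IH] //.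
have := @hom_graded e K (zero_ideal _) (psi \o theta) _ _ t h IH.
case=> [a|l|x [y [-> oy]]]; last first.
- rewrite /= h0 sub0r add0r => /(congr1 -%R); rewrite opprK => ->.
  exact: (idealN (I := ord_ideal e K t.+1)).
- apply: ideal_addr; rewrite [X in ideal_set _ (X - _)]/= theta_var hom_linear_form.
  under eq_bigr do rewrite psi_const.
  rewrite -(@linear_form_delta _ _ l (1%:M l)) => [|j]; last by rewrite mxE.
  have -> : linear_form (1%:M l) = \sum_i mps_const e (V l i) * linear_form (W i).
    rewrite linear_form_comb; apply: eq_bigr => j _; congr (mps_const e _ * _).
    by rewrite -VW mxE.
  by rewrite -sumrB; apply: (ideal_sum (I := ord_ideal e K 2)) => i; rewrite -mulrBr; apply: idealM; apply: psi_var.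
by rewrite /= theta_const psi_const.
Qed.

(** * Regular quotients of power series rings *)

Section RegularGenerators.
Variables (K : comPzRingType) (n m r e : nat) (G : 'I_m -> mpseries n K).
Hypothesis hK : is_field K.
Hypothesis G1 : forall j, ord_ge 1 (G j).
Let L : 'M[K]_(m, n) := \matrix_(j, i) G j U_(i)%MM.
Variables (f : 'I_r -> 'I_m) (U : 'M[K]_(n, r)) (V : 'M[K]_(e, n)) (W : 'M[K]_(n, e)).
Hypothesis LW : L *m W = 0.
Hypothesis VW : V *m W = 1%:M.
Hypothesis ULWV : U *m rowsub f L + W *m V = 1%:M.

Let I := ideal_gen (range G).

Let I_var : I `<=` var_ideal n K.
Proof. by apply: ideal_gen_min => _ [j _ <-]; apply/var_idealP; apply/ord_ge1. Qed.

Lemma quotient_local (M : ideal (quot_ring I)) :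
  M = quot_image I (var_ideal n K) ->
  maximal_ideal M /\ forall M', maximal_ideal M' -> ideal_set M' = M.
Proof.
move=> ->; apply: local_ring_maximal.
  rewrite -(rmorph1 (quot_proj I)) => /(quot_imageP _ I_var)/var_idealP.
  by rewrite mps_coef01; apply: hK.1.
move=> x; rewrite -[x]quot_projK => hx; apply: invertible_rmorph.
by apply: mps_var_ideal_invertible => // h; apply: hx; exists (repr x).
Qed.

Lemma coefM_linear (z g : mpseries n K) i :
  ord_ge 1 g -> (z * g) U_(i)%MM = mps_coef0 z * g U_(i)%MM.
Proof.
move=> g1; rewrite (@mps_coefM1 _ _ _ _ _ 0%MM) ?subm0 //.
  by apply/mnm_lepP => j; rewrite mnm0E.
move=> k ki k0; rewrite [g _]g1 ?mulr0 //.
have := mdeg_split ki; rewrite mdeg1 => /eqP; rewrite -mdeg_eq0 in k0; lia.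
Qed.

(** Compare linear parts: each variable is a combination of d lifts of the
    generators and of the series G, and W kills the linear parts of G, so that
    the identity of size e factors through d coordinates. *)
Lemma generators_lower_bound d (a : 'I_d -> quot_ring I) :
  ideal_set (quot_image I (var_ideal n K)) = ideal_gen (range a) -> (e <= d)%N.
Proof.
move=> Ma.
have /choice [h hP] : forall l, exists g, ord_ge 1 g /\ quot_proj I g = a l.
  move=> l; suff [g /var_idealP/ord_ge1 g1 ga] : ideal_set (quot_image I (var_ideal n K)) (a l).
    by exists g.
  by rewrite Ma; apply: ideal_gen_sub; exists l.
have /choice [q /choice [z qz]] : forall i, exists q : 'I_d -> mpseries n K,
    exists z : 'I_m -> mpseries n K, mps_var K i = \sum_l q l * h l + \sum_j z j * G j.
  move=> i; have : ideal_set (quot_image I (var_ideal n K)) (quot_proj I (mps_var K i)).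
    by exists (mps_var K i) => //; apply/var_idealP/ord_ge1/ord_ge_var.
  rewrite Ma => /ideal_gen_rangeP[q e1]; exists (fun l => repr (q l)).
  have /quot_projP/ideal_gen_rangeP[z e2] : quot_proj I (mps_var K i) =
      quot_proj I (\sum_l repr (q l) * h l).
    rewrite e1 rmorph_sum; apply: eq_bigr => l _; rewrite rmorphM.
    by congr (_ * _); [apply/esym/quot_projK | apply/esym/(hP l).2].
  by exists z; rewrite -e2 addrC subrK.
pose Q : 'M[K]_(n, d) := \matrix_(i, l) mps_coef0 (q i l).
pose H : 'M[K]_(d, n) := \matrix_(l, i) h l U_(i)%MM.
pose Z : 'M[K]_(n, m) := \matrix_(i, j) mps_coef0 (z i j).
have QHZL : 1%:M = Q *m H + Z *m L.
  apply/matrixP => i k; have := congr1 (fun g : mpseries n K => g U_(k)%MM) (qz i).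
  rewrite mps_coefD !mps_sum_coef !mxE [LHS]/= eq_mnm1 eq_sym => h1.
  transitivity (if i == k then 1 else 0 : K); first by case: eqP.
  rewrite h1; congr (_ + _); apply: eq_bigr => l _; rewrite !mxE coefM_linear //.
  by have [] := hP l.
apply: (@right_inverse_min K _ _ (V *m Q) (H *m W) hK).
by rewrite mulmxA -[V *m Q *m H]mulmxA -VW -{2}[V]mulmx1 QHZL mulmxDr mulmxDl -!mulmxA LW !mulmx0 addr0.
Qed.

(** If the quotient is regular, its dimension is the embedding dimension e. The
    power series ring in e variables surjects onto it; a nonzero element of
    the kernel would add the zero ideal below a maximal chain of primes. *)
Lemma regular_generators : regular_local_ring (quot_ring I) ->
  forall j, ideal_set (ideal_gen (range (fun l => G (f l)))) (G j).
Proof.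
move=> [_ [M [_ Muniq [d [[P hP] _] [a Ma]]]]] j.
have [M0max _] := quotient_local erefl.
have ed : (e <= d)%N.
  by apply: (@generators_lower_bound d a); rewrite -Ma; apply: Muniq.
set J := ideal_gen _; have JI : J `<=` I.
  by apply: ideal_gen_min => _ [l _ <-]; apply: ideal_gen_sub; exists (f l).
have [theta [theta_const theta_var theta_ord]] := substitution_linear V.
have surj := theta_surj hK G1 ULWV theta_const theta_var theta_ord.
have [h0 Jh0] := surj (G j).
have [h00|h00] := pselect (h0 = 0); first by move: Jh0; rewrite h00 rmorph0 subr0.
pose pr : {rmorphism mpseries e K -> quot_ring I} := quot_proj I \o theta.
have pr_surj y : exists x, pr x = y.
  have [x Jx] := surj (repr y); exists x.
  rewrite -[RHS]quot_projK; apply: esym.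
  by apply: (proj2 (quot_projP I (repr y) (theta x))); apply: JI.
have : prime_chain (mpseries e K) d.+1.
  pose P' (i : 'I_d.+2) := if unlift ord0 i is Some i' then spec_comap pr (P i') else mps_zero_spec e hK.
  exists P' => i k ik; rewrite /P'.
  case: unliftP ik => [i' ->|->]; case: unliftP => [k' ->|->] // ik.
    by apply: comap_chain => //; apply: hP.
  split=> [x ->|h]; first exact: ideal0.
  have pr_h0 : pr h0 = 0.
    apply: (proj2 (quot_proj0 I (theta h0))); rewrite -[theta h0]opprK -[- theta h0](addKr (G j)).
    apply: idealN; apply: idealD; last exact: JI.
    by apply: idealN; apply: ideal_gen_sub; exists j.
  apply: h00; suff: ideal_set (zero_ideal (mpseries e K)) h0 by [].
  by apply: h; rewrite -[ideal_set _ _]/(ideal_set (P k') (pr h0)) pr_h0; apply: ideal0.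
by move=> /(prime_chain_length hK); lia.
Qed.

End RegularGenerators.

(** * Flatness *)

Section IdealModule.
Variables (R : comPzRingType) (I : ideal R).

Definition ideal_pred : {pred R^o} := fun x => `[< ideal_set I x >].

Lemma ideal_pred_closed : submod_closed ideal_pred.
Proof.
split=> [|a x y /asboolP Ix /asboolP Iy]; apply/asboolP; first exact: ideal0.
by apply: idealD => //; apply: idealM.
Qed.

HB.instance Definition _ := GRing.isSubmodClosed.Build R R^o ideal_pred
  (GRing.submod_closed_semi ideal_pred_closed).

(** The ideal as an R-module: flatness is tested on its inclusion in R. *)
Record ideal_module := IdealElt { ideal_val : R^o; ideal_valP : ideal_val \in ideal_pred }.
HB.instance Definition _ := [isSub for ideal_val].
HB.instance Definition _ := [Choice of ideal_module by <:].
HB.instance Definition _ := [SubChoice_isSubLmodule of ideal_module by <:].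
End IdealModule.

Section FlatIntersection.
Variables (A T : comPzRingType) (c : {rmorphism A -> T}) (I : ideal T) (p : ideal A).
Let phi : {rmorphism A -> quot_ring I} := quot_proj I \o c.
Hypothesis flat_phi : flat_morphism phi.

Let N : lmodType A := Defs_restr__canonical__GRing_Lmodule phi.
Let pI := ideal_mul (ideal_gen (c @` p)) I.

Let value (z : ideal_module p * N) : T := c (val z.1) * repr (z.2 : quot_ring I).

Let valueP (x : ideal_module p) y (n : N) : quot_proj I y = n :> quot_ring I ->
  ideal_set pI (value (x, n) - c (val x) * y).
Proof.
move=> e; rewrite -mulrBr; apply: ideal_mulP.
  by apply: ideal_gen_sub; exists (val x) => //; apply/asboolP; apply: ideal_valP.
by apply/quot_projP; rewrite e; apply: quot_projK.
Qed.

(** Representatives of classes modulo I are only defined up to I, but they are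
    multiplied by elements of p: evaluation of tensors is well defined modulo
    p I. *)
Let value_rel (s t : seq (ideal_module p * N)) : tensor_rel s t ->
  ideal_set pI (\sum_(z <- s) value z - \sum_(z <- t) value z).
Proof.
elim=> {s t}.
- by move=> s; rewrite subrr; apply: ideal0.
- by move=> s t _ st; rewrite -opprB; apply: idealN.
- by move=> s t u _ st _ tu; have := idealD st tu; rewrite subrKA.
- move=> s s' t t' _ ss' _ tt'; rewrite !big_cat; have := idealD ss' tt'; rewrite addrACA -opprD; apply.
- move=> s t; rewrite (_ : \sum_(z <- s ++ t) value z = \sum_(z <- t ++ s) value z).
    by rewrite subrr; apply: ideal0.
  by rewrite !big_cat; apply: addrC.
- move=> x y n; rewrite !big_cons !big_nil !addr0.
  rewrite (_ : value (x + y, n) = value (x, n) + value (y, n)).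
    by rewrite subrr; apply: ideal0.
  by rewrite /value -mulrDl -rmorphD.
- move=> x n n'; rewrite !big_cons !big_nil !addr0.
  rewrite [X in _ - X](_ : _ = c (val x) * (repr (n : quot_ring I) + repr (n' : quot_ring I))).
    by apply: valueP; rewrite rmorphD; congr (_ + _); apply: quot_projK.
  by rewrite mulrDr.
- move=> n; rewrite !big_cons !big_nil (_ : value (0, n) = 0).
    by rewrite addr0 subrr; apply: ideal0.
  by rewrite /value /= -[RHS](mul0r (repr (n : quot_ring I))) -(rmorph0 c).
move=> a x n; rewrite !big_cons !big_nil !addr0 -opprB; apply: idealN.
rewrite [X in _ - X](_ : _ = c (val x) * (c a * repr (n : quot_ring I))).
  apply: valueP; rewrite rmorphM; congr (_ * _); exact: quot_projK.
by rewrite /value /= mulrCA mulrA -rmorphM.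
Qed.

Let tensor_collect (s : seq (A^o * N)) :
  tensor_rel s [:: (1 : A^o, \sum_(z <- s) z.1 *: z.2)].
Proof.
elim: s => [|[a n] s IH].
  rewrite big_nil -(scale0r (0 : N)); apply: tensor_sym.
  apply: tensor_trans (tensor_sym (tensor_Z _ _ _)) _; rewrite scale0r.
  exact: tensor_0l.
rewrite big_cons; apply: tensor_sym; apply: tensor_trans (tensor_Dr _ _ _) _.
rewrite -cat1s -[_ :: s]cat1s; apply: tensor_cat (tensor_sym IH).
apply: tensor_trans (tensor_sym (tensor_Z _ _ _)) _.
rewrite (_ : (a : A) *: (1 : A^o) = a); first exact: tensor_refl.
exact: mulr1.
Qed.

(** By flatness, a relation between classes modulo I with coefficients in p
    already holds in the tensor product of p with T / I, where it can be
    evaluated modulo p I. *)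
Lemma flat_intersection d (a : 'I_d -> A) (h : 'I_d -> T) :
  (forall l, ideal_set p (a l)) -> ideal_set I (\sum_l c (a l) * h l) ->
  ideal_set pI (\sum_l c (a l) * h l).
Proof.
move=> pa Ih.
have a_pred l : (a l : A^o) \in ideal_pred p by apply/asboolP; apply: pa.
pose x l : ideal_module p := IdealElt (a_pred l).
pose s : seq (ideal_module p * N) := [seq (x l, quot_proj I (h l) : N) | l <- index_enum 'I_d].
have s0 : \sum_(z <- [seq (val z.1 : A^o, z.2) | z <- s]) z.1 *: z.2 = 0 :> N.
  rewrite /s !big_map /=; apply: etrans (_ : quot_proj I (\sum_l c (a l) * h l) = 0).
    by rewrite rmorph_sum; apply: eq_bigr => l _; rewrite rmorphM; apply: erefl.
  exact: (proj2 (quot_proj0 I _)).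
have rel : tensor_rel s [::].
  apply/tensor_eq; apply: (flat_phi (f := val) val_inj).
  rewrite !pi_tensor_map; apply/tensor_eq; apply: tensor_trans (tensor_collect _) _.
  apply: tensor_sym; apply: tensor_trans (tensor_collect _) _.
  by rewrite s0 big_nil; apply: tensor_refl.
have := value_rel rel; rewrite big_nil subr0 /s big_map => pIv.
apply: (ideal_exchange (y := \sum_l value (x l, quot_proj I (h l) : N))) => //.
rewrite -opprB; apply: idealN; rewrite -sumrB; apply: ideal_sum => l.
exact: (@valueP (x l)).
Qed.

End FlatIntersection.

(** * The local ring of the family along the section *)

Section LocalRing.
Variables (A : comPzRingType) (n m : nat) (F : 'I_m -> mpseries n A).
Hypothesis hF : forall i, ideal_set (var_ideal n A) (F i).
Variable p : Spec A.

Let Bn : comPzRingType := loc_at (sigma hF p).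

Definition to_local : {rmorphism mpseries n A -> Bn} :=
  loc_at_in (sigma hF p) \o series_proj F.

Lemma to_local_F i : to_local (F i) = 0.
Proof.
rewrite /= (_ : series_proj F (F i) = 0); first exact: rmorph0.
by apply: (proj2 (quot_proj0 _ _)); apply: ideal_gen_sub; exists i.
Qed.

Lemma structure_map_at_in a :
  structure_map_at hF p (loc_at_in p a) = to_local (mps_const n a).
Proof.
rewrite -[LHS]/(loc_map _ (\pi_(loc_at p) _)) pi_loc_map; apply: loc_eq1 => /=.
by rewrite -[mps_const n 1]/(1 : mpseries n A) rmorph1.
Qed.

Lemma to_local_invertible f : ~ ideal_set p (mps_coef0 f) -> invertible (to_local f).
Proof.
by move=> pf; apply: loc_in_invertible => /(section_idealP hF)/pf.
Qed.

Lemma to_local_lift (C : comPzRingType) (v : {rmorphism mpseries n A -> C}) :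
  (forall i, v (F i) = 0) ->
  (forall f, ~ ideal_set p (mps_coef0 f) -> invertible (v f)) ->
  exists w : {rmorphism Bn -> C}, forall f, w (to_local f) = v f.
Proof.
move=> vF vU; have [|q hq] := @quot_lift _ _ (ideal_gen (range F)) v.
  by move=> x /(@rmorph_ideal_gen _ _ v _ (zero_ideal C)); apply=> _ [i _ <-]; apply: vF.
have [|w hw] := @loc_lift _ (prime_compl (sigma hF p)) C q.
  move=> b; rewrite -[b]quot_projK => hb; rewrite hq; apply: vU => hp; apply: hb.
  exact/(section_idealP hF).
by exists w => f; rewrite -hq -hw.
Qed.

Lemma to_local_ext (C : comPzRingType) (v w : {rmorphism Bn -> C}) :
  (forall f, v (to_local f) = w (to_local f)) -> v =1 w.
Proof.
move=> e; apply: (@loc_hom_ext _ (prime_compl (sigma hF p))) => b.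
by rewrite -[b]quot_projK; apply: e.
Qed.

Lemma structure_map_at_ext (C : comPzRingType) (v : {rmorphism Bn -> C})
    (g : {rmorphism loc_at p -> C}) :
  (forall a, v (to_local (mps_const n a)) = g (loc_at_in p a)) ->
  forall c, v (structure_map_at hF p c) = g c.
Proof.
move=> h; apply: (@loc_hom_ext _ (prime_compl p) _ (v \o structure_map_at hF p) g) => a.
by rewrite /= -h -structure_map_at_in.
Qed.

Let nB := loc_at_ideal (sigma hF p) (sigma hF p).

Lemma to_local_var i : ideal_set nB (to_local (mps_var A i)).
Proof.
apply: ideal_gen_sub; exists (series_proj F (mps_var A i)) => //.
by apply: ideal_gen_sub; left; exists i.
Qed.

Lemma to_local_const a : ideal_set p a -> ideal_set nB (to_local (mps_const n a)).
Proof.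
move=> pa; apply: ideal_gen_sub; exists (series_proj F (mps_const n a)) => //.
by apply: ideal_gen_sub; right; exists a.
Qed.

Lemma local_ideal_image (C : comPzRingType) (v : {rmorphism Bn -> C}) (Q : ideal C) :
  (forall i, ideal_set Q (v (to_local (mps_var A i)))) ->
  (forall a, ideal_set p a -> ideal_set Q (v (to_local (mps_const n a)))) ->
  forall y, ideal_set nB y -> ideal_set Q (v y).
Proof.
move=> hv hc; apply: rmorph_ideal_gen => _ [b sb <-].
apply: (@rmorph_ideal_gen _ _ (v \o loc_at_in (sigma hF p)) _ Q _ _ sb) => _ [[i _ <-]|[a pa <-]].
  exact: hv.
exact: hc.
Qed.

Lemma fibre_F1 j : ord_ge 1 (mps_map (to_residue_field p) (F j)).
Proof.
have /var_idealP/ord_ge1 f1 := hF j.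
by move=> k k1; rewrite -[LHS]/(to_residue_field p (F j k)) f1 // rmorph0.
Qed.

End LocalRing.

(** * Formal smoothness implies regularity of the fibre *)

Section SmoothRegular.
Variables (A : comPzRingType) (n m : nat) (F : 'I_m -> mpseries n A).
Hypothesis hF : forall i, ideal_set (var_ideal n A) (F i).
Variable p : Spec A.
Hypothesis smooth :
  formally_smooth (structure_map_at hF p) (loc_at_ideal (sigma hF p) (sigma hF p)).

Let K : comPzRingType := residue_field p.
Let hK : is_field K := residue_is_field p.
Let G j : mpseries n K := mps_map (to_residue_field p) (F j).
Let L : 'M[K]_(m, n) := \matrix_(j, i) G j U_(i)%MM.
Variables (e : nat) (W : 'M[K]_(n, e)).
Hypothesis LW : L *m W = 0.

(** Approximate solutions, of precision t, of the equations G in the power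
    series ring in e variables, with linear part W. *)
Let approx t (v : {rmorphism mpseries n K -> mpseries e K}) : Prop :=
  [/\ forall a, v (mps_const n a) = mps_const e a,
      forall i, ord_ge 2 (v (mps_var K i) - linear_form (W i)) &
      forall j, ord_ge t (v (G j))].

Let approx_var1 t v i : approx t v -> ord_ge 1 (v (mps_var K i)).
Proof.
move=> [_ /(_ i) h _]; rewrite -(subrK (linear_form (W i)) (v _)).
apply: (idealD (I := ord_ideal e K 1)); last exact: linear_form_ord.
exact: ord_ge_le h.
Qed.

Let approx_init : exists v, approx 2 v.
Proof.
have [v [vc vx vo]] := substitution_linear W; exists v; split=> // [i|j].
  by rewrite vx subrr; apply: (ideal0 (ord_ideal e K 2)).
rewrite -(subrK (linear_form (fun i => G j U_(i)%MM)) (G j)) rmorphD.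
apply: (idealD (I := ord_ideal e K 2)).
  by apply: vo; apply: linear_part; apply: (fibre_F1 hF).
rewrite hom_linear_form; under eq_bigr do rewrite vc vx.
rewrite linear_form_comb (_ : linear_form _ = 0); first exact: (ideal0 (ord_ideal e K 2)).
rewrite /linear_form big1 // => k _.
have := congr1 (fun X : 'M_(m, e) => X j k) LW; rewrite !mxE => h.
rewrite (_ : \sum_l _ = 0) ?rmorph0 ?mul0r // -[RHS]h.
by apply: eq_bigr => l _; rewrite mxE.
Qed.

(** Formal smoothness improves the precision by one: lift along the
    square-zero quotient from precision t + 1 to precision t. *)
Let approx_step t v : approx t.+2 v -> exists v', approx t.+3 v' /\
  forall i, ord_ge t.+2 (v' (mps_var K i) - v (mps_var K i)).
Proof.
move=> hv; have [v_const v_var vG] := hv.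
pose C : comPzRingType := quot_ring (ord_ideal e K t.+3).
pose pr : {rmorphism mpseries e K -> C} := quot_proj (ord_ideal e K t.+3).
pose N : ideal C := quot_image (ord_ideal e K t.+3) (ord_ideal e K t.+2).
pose Q : ideal C := quot_image (ord_ideal e K t.+3) (ord_ideal e K 1).
have Q0 x : ideal_set (ideal_exp Q t.+3) x -> x = 0.
  by move=> /quot_image_exp[f /ord_ideal_exp ft <-]; apply/quot_proj0/ft.
have N2 : ideal_set (ideal_exp N 2) = [set 0].
  apply/square_zeroP => _ _ [a oa <-] [b ob <-]; rewrite -rmorphM; apply/quot_proj0.
  by apply: ord_ge_le (ord_geM oa ob); lia.
have [red redE] := mps_mapP n (to_residue_field p).
pose kappa : {rmorphism loc_at p -> K} := quot_proj (loc_at_ideal p p).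
pose g : {rmorphism loc_at p -> C} := pr \o @mps_const e K \o kappa.
pose u0 : {rmorphism mpseries n A -> quot_ring N} := quot_proj N \o pr \o v \o red.
have red_const a : red (mps_const n a) = mps_const n (to_residue_field p a).
  by rewrite redE; apply/mpseriesP => k /=; case: ifP; rewrite ?rmorph0.
have red_var i : red (mps_var A i) = mps_var K i.
  by rewrite redE; apply/mpseriesP => k /=; case: ifP; rewrite ?rmorph0 ?rmorph1.
have [||u uE] := @to_local_lift _ _ _ F hF p _ u0.
- move=> j; rewrite /= redE; apply: (proj2 (quot_proj0 N _)).
  by exists (v (G j)) => //; apply: vG.
- move=> f pf; apply: (@invertible_rmorph _ _ (quot_proj N \o pr \o v) (red f)).
  by apply: mps_invertible; rewrite redE; apply: residue_compl_invertible.
have v1 i : ord_ge 1 (v (mps_var K i)) := approx_var1 i hv.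
have u_var i : u (to_local hF p (mps_var A i)) = quot_proj N (pr (v (mps_var K i))).
  by rewrite uE /= red_var.
have u_const a : u (to_local hF p (mps_const n a)) = quot_proj N (g (loc_at_in p a)).
  by rewrite uE /= red_const v_const.
have [||w [wg wu]] := smooth (g := g) N2 (u := u).
- by move=> c; apply: (structure_map_at_ext (g := quot_proj N \o g)).
- exists t.+3 => y.
  pose QN := quot_image N Q.
  move=> /(rmorph_ideal_exp (J := QN) (f := u)) h.
  have /quot_image_exp[x /Q0 -> <-] : ideal_set (ideal_exp QN t.+3) (u y).
    apply: h; apply: local_ideal_image => [i|a pa].
      rewrite u_var; exists (pr (v (mps_var K i))) => //.
      by exists (v (mps_var K i)) => //; apply: v1.
    have g0 : g (loc_at_in p a) = 0.
      rewrite -[LHS]/(pr (mps_const e (to_residue_field p a))).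
      by rewrite (proj2 (residue_field0 p a) pa) !rmorph0.
    by rewrite u_const g0 rmorph0; apply: ideal0.
  exact: rmorph0.
pose w' i : mpseries e K := repr (w (to_local hF p (mps_var A i))).
have w'E i : pr (w' i) = w (to_local hF p (mps_var A i)) := quot_projK _.
have w'v i : ord_ge t.+2 (w' i - v (mps_var K i)).
  have t32 : ord_ideal e K t.+3 `<=` ord_ideal e K t.+2 by move=> f; apply: ord_ge_le.
  apply/(quot_imageP _ t32); suff: ideal_set N (pr (w' i) - pr (v (mps_var K i))).
    by rewrite -rmorphB.
  by apply/quot_projP; rewrite -u_var -wu -w'E.
have w'1 i : ord_ge 1 (w' i).
  rewrite -(subrK (v (mps_var K i)) (w' i)).
  by apply: (idealD (I := ord_ideal e K 1)) (v1 i); apply: ord_ge_le (w'v i).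
have [v' [v'_const v'_var]] := @substitution n e K K idfun w' w'1.
exists v'; split=> [|i]; last by rewrite v'_var.
split=> [//|i|j].
  rewrite v'_var -(subrKA (v (mps_var K i))); apply: (idealD (I := ord_ideal e K 2)) (v_var i).
  by apply: ord_ge_le (w'v i).
have e' : (pr \o v' \o red) =1 (w \o to_local hF p).
  apply: (@hom_uniq _ _ _ _ _ Q t.+3) => [a|i|i|//].
  - by rewrite [LHS]/= red_const v'_const -[RHS]/(w (to_local hF p _)) -structure_map_at_in wg.
  - by rewrite [LHS]/= red_var v'_var w'E.
  - have : ideal_set Q (pr (w' i)) by exists (w' i) => //; apply: w'1.
    by rewrite w'E.
have := e' (F j); rewrite /= redE -[w _]/(w (to_local hF p (F j))) to_local_F rmorph0.
by move=> /quot_proj0.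
Qed.

(** The approximate solutions of increasing precision converge to an exact
    one. *)
Lemma smooth_hom : exists psi : {rmorphism mpseries n K -> mpseries e K},
  [/\ forall a, psi (mps_const n a) = mps_const e a,
      forall i, ord_ge 2 (psi (mps_var K i) - linear_form (W i)) &
      forall j, psi (G j) = 0].
Proof.
have step_ex t v : exists v', approx t.+2 v -> approx t.+3 v' /\
    forall i, ord_ge t.+2 (v' (mps_var K i) - v (mps_var K i)).
  have [/approx_step[v' h]|no] := pselect (approx t.+2 v); first by exists v'.
  by exists v.
pose step t v := sval (cid (step_ex t v)).
have stepP t v : approx t.+2 v -> approx t.+3 (step t v) /\
    forall i, ord_ge t.+2 (step t v (mps_var K i) - v (mps_var K i)).
  exact: svalP (cid (step_ex t v)).
have [v0 hv0] := approx_init.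
pose s := fix s k := if k is k'.+1 then step k' (s k') else v0.
have sP k : approx k.+2 (s k) by elim: k => [//|k /stepP[]].
have sS k i : ord_ge k.+2 (s k.+1 (mps_var K i) - s k (mps_var K i)).
  by have [_] := stepP _ _ (sP k).
have /choice [w hw] : forall i, exists b, forall k, ord_ge k (b - s k (mps_var K i)).
  by move=> i; apply: mps_complete => k; apply: ord_ge_le (sS k i); lia.
have w2 i : ord_ge 2 (w i - linear_form (W i)).
  have [_ h _] := sP 2; rewrite -(subrKA (s 2 (mps_var K i))).
  exact: (idealD (I := ord_ideal e K 2)) (hw i 2%N) (h i).
have w1 i : ord_ge 1 (w i).
  rewrite -(subrK (linear_form (W i)) (w i)).
  by apply: (idealD (I := ord_ideal e K 1)) (linear_form_ord _); apply: ord_ge_le (w2 i).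
have [psi [psi_const psi_var]] := @substitution n e K K idfun w w1.
exists psi; split=> [//|i|j]; first by rewrite psi_var.
apply: ord_ge_eq0 => k; have [sc sv sG] := sP k.
rewrite -(subrK (s k (G j)) (psi (G j))).
apply: (idealD (I := ord_ideal e K k)); last by apply: ord_ge_le (sG j); lia.
have [|||x [y [ox oy ->]]] := @hom_diff _ _ _ psi (s k) (ord_ideal e K 1) (ord_ideal e K k) _ _ _ k (G j).
- by move=> a; rewrite psi_const sc.
- by move=> i; rewrite psi_var; apply: hw.
- by move=> i; apply: approx_var1 (sP k).
by apply: (idealD (I := ord_ideal e K k)) => //; apply: ord_ideal_exp oy.
Qed.

End SmoothRegular.

(** The fibre is isomorphic to a power series ring in as many variables as its
    embedding dimension: such a ring surjects onto it, and the homomorphism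
    produced by smoothness shows that nothing is killed. *)
Theorem smooth_regular (A : comPzRingType) n m (F : 'I_m -> mpseries n A)
    (hF : forall i, ideal_set (var_ideal n A) (F i)) (p : Spec A) :
  formally_smooth (structure_map_at hF p) (loc_at_ideal (sigma hF p) (sigma hF p)) ->
  regular_local_ring (completed_fibre F p).
Proof.
move=> smooth; have hK := residue_is_field p.
pose G j : mpseries n (residue_field p) := mps_map (to_residue_field p) (F j).
have [r [e [f [U [V [W [LU LW VW ULWV]]]]]]] :=
  linear_splitting (\matrix_(j, i) G j U_(i)%MM) hK.
have [psi [psi_const psi_var psiG]] := smooth_hom smooth LW.
have [theta [theta_const theta_var theta_ord]] := substitution_linear V.
have surj := theta_surj hK (fibre_F1 hF p) ULWV theta_const theta_var theta_ord.
have inj := theta_inj VW theta_const theta_var psi_const psi_var.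
pose I := ideal_gen (range G).
pose th : {rmorphism mpseries e (residue_field p) -> completed_fibre F p} := quot_proj I \o theta.
have [g [gth thg]] : exists g : {rmorphism completed_fibre F p -> _}, cancel th g /\ cancel g th.
  apply: rmorph_inverse => [h /(proj1 (quot_proj0 I _)) Ih|y].
    apply: inj; move: Ih; apply: (@rmorph_ideal_gen _ _ psi _ (zero_ideal _)).
    by move=> _ [j _ <-]; apply: psiG.
  have [h Jh] := surj (repr y); exists h; rewrite -[RHS]quot_projK; apply: esym.
  apply: (proj2 (quot_projP I _ _)); move: Jh; apply: ideal_gen_min => _ [l _ <-].
  by apply: ideal_gen_sub; exists (f l).
apply: (@regular_iso _ _ g) (mps_regular e hK) => [y gy|h].
  by rewrite -[y]thg gy rmorph0.
by exists (th h); apply: gth.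
Qed.

(** * Regularity of the fibre implies formal smoothness *)

Section IdealPowers.
Variable R : comPzRingType.
Implicit Types (I J N : ideal R).

Lemma ideal_mulA I J N : ideal_mul I (ideal_mul J N) `<=` ideal_mul (ideal_mul I J) N.
Proof.
apply: ideal_mul_min => x y Ix.
apply: (@ideal_gen_min _ _ (ideal_colon (ideal_mul (ideal_mul I J) N) x)).
move=> _ [z [t [Jz Nt ->]]].
by have := ideal_mulP (ideal_mulP Ix Jz) Nt; rewrite -mulrA.
Qed.

Lemma ideal_mul_mono I I' J J' : I `<=` I' -> J `<=` J' ->
  ideal_mul I J `<=` ideal_mul I' J'.
Proof.
by move=> h h'; apply: ideal_mul_min => x y Ix Jy; apply: ideal_mulP; [apply: h | apply: h'].
Qed.

Lemma ideal_exp_split I j k :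
  ideal_exp I (j + k) `<=` ideal_mul (ideal_exp I j) (ideal_exp I k).
Proof.
elim: j => [|j IH] x Ix; first by rewrite -[x]mul1r; apply: ideal_mulP => //; apply: ideal_exp0.
by apply: (@ideal_mulA I (ideal_exp I j)); apply: ideal_mul_mono Ix.
Qed.

Lemma ideal_exp_gen_image (R' : comPzRingType) (u : {rmorphism R -> R'}) I k :
  ideal_exp (ideal_gen (u @` I)) k `<=` ideal_gen (u @` ideal_exp I k).
Proof.
elim: k => [|k IH].
  move=> x _; rewrite -[x]mulr1 -(rmorph1 u); apply: idealM; apply: ideal_gen_sub.
  by exists 1 => //; apply: ideal_exp0.
apply: ideal_mul_min => x y ux /IH uy; apply: ideal_gen_mul ux uy.
move=> _ _ [a Ia <-] [b Ib <-]; rewrite -rmorphM; apply: ideal_gen_sub.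
by exists (a * b) => //; apply: ideal_mulP.
Qed.

End IdealPowers.

Section AlmostGenerators.
Variables (A : comPzRingType) (n m : nat) (F : 'I_m -> mpseries n A).
Hypothesis hA : noetherian A.
Hypothesis flatF : flat_morphism (structure_map F).
Variable p : Spec A.

Let K : comPzRingType := residue_field p.
Let S := mpseries n A.
Let I : ideal S := ideal_gen (range F).
Let pS : ideal S := ideal_gen (@mps_const n A @` p).

Lemma common_denominator (T : finType) (z : T -> K) : exists s (a : T -> A),
  mulset_set (prime_compl p) s /\
  forall t, to_residue_field p s * z t = to_residue_field p (a t).
Proof.
have /choice [a /choice [s h]] : forall t, exists a s, mulset_set (prime_compl p) s /\
    to_residue_field p s * z t = to_residue_field p a.
  by move=> t; have [a [s [ps e]]] := residue_fracP (z t); exists a, s.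
exists (\prod_t s t), (fun t => (\prod_(t' | t' != t) s t') * a t); split.
  by apply: big_ind => [||t _]; [exact: mulset1 | exact: mulsetM | have [] := h t].
move=> t; rewrite (bigD1 t) // !(rmorphM (to_residue_field p)).
by rewrite -(proj2 (h t)); ring.
Qed.

(** Truncated lift to A[[x]], up to a denominator outside p, of a relation
    between the reductions of the series F. *)
Lemma truncated_lift r (f : 'I_r -> 'I_m) (g0 : S) (q : 'I_r -> mpseries n K) B :
  mps_map (to_residue_field p) g0 =
    \sum_l q l * mps_map (to_residue_field p) (F (f l)) ->
  exists s (b : 'I_r -> S), mulset_set (prime_compl p) s /\
    ord_ge B (mps_map (to_residue_field p) (mps_const n s * g0 - \sum_l b l * F (f l))).
Proof.
have [red redE] := mps_mapP n (to_residue_field p).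
rewrite -redE => e.
pose z (t : 'I_r * 'X_{1..n < B}) := q t.1 (val t.2).
have [s [a [ps ha]]] := common_denominator z; exists s.
pose b l : S := MPSeries (fun k =>
  if insub k is Some k' then a (l, k' : 'X_{1..n < B}) else 0).
exists b; split=> //; rewrite -redE rmorphB rmorphM e rmorph_sum mulr_sumr -sumrB.
apply: (ideal_sum (I := ord_ideal n K B)) => l.
rewrite rmorphM (redE (F _)) mulrA -mulrBl; apply: idealMr => k kB.
have -> : red (mps_const n s) = mps_const n (to_residue_field p s).
  by rewrite redE; apply/mpseriesP => k' /=; case: ifP; rewrite ?rmorph0.
rewrite redE mps_coefB mps_constM -[X in _ - X]/(to_residue_field p (b l k)).
have -> : b l k = a (l, BMultinom kB) by rewrite /= insubT.
by rewrite -(ha (l, BMultinom kB)); apply: subrr.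
Qed.

Lemma coef_in_ideal d (a : 'I_d -> A) (g : S) : ideal_set p = ideal_gen (range a) ->
  (forall k, ideal_set p (g k)) <-> exists h, g = \sum_l mps_const n (a l) * h l.
Proof.
move=> pa; split=> [pg|[h ->] k]; last first.
  rewrite mps_sum_coef; apply: ideal_sum => l; rewrite mps_constM pa.
  by apply: idealMr; apply: ideal_gen_sub; exists l.
have /choice [q hq] : forall k, exists q : 'I_d -> A, g k = \sum_l q l * a l.
  by move=> k; apply/ideal_gen_rangeP; rewrite -pa.
exists (fun l => MPSeries (fun k => q k l)); apply/mpseriesP => k.
by rewrite mps_sum_coef hq; apply: eq_bigr => l _; rewrite mps_constM mulrC.
Qed.

(** If F i lies in the ideal of the F (f l) over the residue field, then over A
    it does so up to a denominator s, an element of p I and terms of arbitrarily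
    high order in I: the truncation error is controlled by the Artin-Rees
    lemma and flatness removes the rest. *)
Lemma almost_generators r (f : 'I_r -> 'I_m) i B :
  ideal_set (ideal_gen (range (fun l => mps_map (to_residue_field p) (F (f l)))))
    (mps_map (to_residue_field p) (F i)) ->
  exists s (b : 'I_r -> S) (T : finType) (q y : T -> S),
  [/\ mulset_set (prime_compl p) s, forall j, ord_ge B (q j), forall j, ideal_set I (y j) &
      ideal_set (ideal_mul pS I)
        (mps_const n s * F i - \sum_l b l * F (f l) - \sum_j q j * y j)].
Proof.
move=> /ideal_gen_rangeP[c /truncated_lift lift].
have [d [a pa]] := hA p.
have pS_coef (g : S) : ideal_set pS g -> forall k, ideal_set p (g k).
  have Q : is_ideal [set g : S | forall k, ideal_set p (g k)].
    split=> [k|g1 g2 p1 p2 k|h g1 p1 k]; first exact: ideal0.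
      by rewrite mps_coefD; apply: idealD.
    by rewrite mps_coefM; apply: ideal_sum_cond => l _; apply: idealM.
  apply: (ideal_gen_min (I := Ideal Q)) => _ [x px <-] k /=.
  by case: ifP => // _; apply: ideal0.
have coef_pS (g : S) : (forall k, ideal_set p (g k)) -> ideal_set pS g.
  move=> /(coef_in_ideal _ pa)[h ->]; apply: ideal_sum => l; apply: idealMr.
  by apply: ideal_gen_sub; exists (a l) => //; rewrite pa; apply: ideal_gen_sub; exists l.
have [T [g [D [gI red]]]] := artin_rees hA (ideal_add I pS).
have [s [b [ps lb]]] := lift (B + D)%N.
have /choice [y /choice [z yz]] : forall j, exists y z,
    [/\ ideal_set I y, ideal_set pS z & g j = y + z] by [].
pose X := mps_const n s * F i - \sum_l b l * F (f l).
have IX : ideal_set I X.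
  apply: idealB; first by apply: idealM; apply: ideal_gen_sub; exists i.
  by apply: ideal_sum => l; apply: idealM; apply: ideal_gen_sub; exists (f l).
pose X1 : S := MPSeries (fun k => if (mdeg k < B + D)%N then X k else 0).
have pX1 : ideal_set pS X1.
  apply: coef_pS => k /=; case: ifP => [kB|_]; last exact: ideal0.
  exact/residue_field0/(lb k kB).
have [||q [qB e]] := red (B + D)%N (X - X1).
- apply: idealB; [exact: ideal_addl | exact: ideal_addr].
- by move=> k kB; rewrite mps_coefB /= kB subrr.
rewrite addnK in qB.
exists s, b, T, q, y; split=> // [j|]; first by have [] := yz j.
rewrite -/X; set Y := X - _.
have IY : ideal_set I Y.
  by apply: idealB => //; apply: ideal_sum => j; apply: idealM; have [] := yz j.
have pY : ideal_set pS Y.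
  rewrite (_ : Y = X1 + \sum_j q j * z j).
    by apply: idealD => //; apply: ideal_sum => j; apply: idealM; have [] := yz j.
  apply/eqP; rewrite /Y subr_eq -addrA -big_split /= addrC -subr_eq; apply/eqP.
  rewrite e; apply: eq_bigr => j _; have [_ _ ->] := yz j.
  by rewrite mulrDr addrC.
have [h eY] := (coef_in_ideal Y pa).1 (pS_coef _ pY).
rewrite eY; apply: (flat_intersection flatF) => [l|]; last by rewrite -eY.
by rewrite pa; apply: ideal_gen_sub; exists l.
Qed.

End AlmostGenerators.

Section RegularSmooth.
Variables (A : comPzRingType) (n m : nat) (F : 'I_m -> mpseries n A).
Hypothesis hA : noetherian A.
Hypothesis hF : forall i, ideal_set (var_ideal n A) (F i).
Hypothesis flatF : flat_morphism (structure_map F).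
Variable p : Spec A.

Let K : comPzRingType := residue_field p.
Let hK : is_field K := residue_is_field p.
Let G j : mpseries n K := mps_map (to_residue_field p) (F j).
Let L : 'M[K]_(m, n) := \matrix_(j, i) G j U_(i)%MM.
Variables (r : nat) (f : 'I_r -> 'I_m) (U : 'M[K]_(n, r)).
Hypothesis LU : rowsub f L *m U = 1%:M.
Hypothesis gens : forall j, ideal_set (ideal_gen (range (fun l => G (f l)))) (G j).

Let Bn : comPzRingType := loc_at (sigma hF p).
Let nB : ideal Bn := loc_at_ideal (sigma hF p) (sigma hF p).

Section Lifting.
Variables (C : comPzRingType) (g : {rmorphism loc_at p -> C}) (N : ideal C).
Hypothesis N2 : forall x y, ideal_set N x -> ideal_set N y -> x * y = 0.
Variables (u : {rmorphism Bn -> quot_ring N}) (k : nat).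
Hypothesis ug : forall c, u (structure_map_at hF p c) = quot_proj N (g c).
Hypothesis uk : forall y, ideal_set (ideal_exp nB k) y -> u y = 0.

Let iota : {rmorphism mpseries n A -> Bn} := to_local hF p.
Let Q : ideal C := ideal_comap (quot_proj N) (ideal_gen (u @` nB)).

Let NQ : N `<=` Q.
Proof.
move=> x Nx; suff: ideal_set (ideal_gen (u @` nB)) (quot_proj N x) by [].
by rewrite (proj2 (quot_proj0 N x) Nx); apply: ideal0.
Qed.

Let uQ0 y : ideal_set (ideal_exp (ideal_gen (u @` nB)) k) y -> y = 0.
Proof.
move=> /ideal_exp_gen_image; apply: (@ideal_gen_min _ _ (zero_ideal _)).
by move=> _ [b nb <-]; apply: uk.
Qed.

Let QkN : ideal_exp Q k `<=` N.
Proof.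
move=> x Qx; apply/quot_proj0/uQ0.
by apply: (rmorph_ideal_exp (f := quot_proj N) (I := Q)) Qx.
Qed.

Let Q0 x : ideal_set (ideal_exp Q (k + k)) x -> x = 0.
Proof.
move=> /ideal_exp_split; apply: (@ideal_mul_min _ _ _ (zero_ideal C)) => {x} x y.
by move=> /QkN Nx /QkN Ny; apply: N2.
Qed.

Let g_Q z : ideal_set (loc_at_ideal p p) z -> ideal_set Q (g z).
Proof.
apply: rmorph_ideal_gen => _ [a pa <-] /=; rewrite -ug structure_map_at_in.
by apply: ideal_gen_sub; exists (to_local hF p (mps_const n a)) => //; apply: to_local_const.
Qed.

(** Candidate lifts: homomorphisms from the power series ring over A which
    reduce to u. *)
Let lifts (v : {rmorphism mpseries n A -> C}) : Prop :=
  (forall a, v (mps_const n a) = g (loc_at_in p a)) /\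
  (forall i, quot_proj N (v (mps_var A i)) = u (iota (mps_var A i))).

Let lifts_var v i : lifts v -> ideal_set Q (v (mps_var A i)).
Proof.
move=> [_ hv]; rewrite /= hv; apply: ideal_gen_sub.
by exists (iota (mps_var A i)) => //; apply: to_local_var.
Qed.

Let liftsE v h : lifts v -> quot_proj N (v h) = u (iota h).
Proof.
move=> hv; have [v_const v_var] := hv.
apply: (@hom_uniq _ _ _ (quot_proj N \o v) (u \o iota) (ideal_gen (u @` nB)) k) => [a|i|i|].
- by rewrite [LHS]/= v_const -ug structure_map_at_in.
- by rewrite [LHS]/= v_var.
- by apply: ideal_gen_sub; exists (iota (mps_var A i)) => //; apply: to_local_var.
exact: uQ0.
Qed.

Let lifts_unit v h : lifts v -> ~ ideal_set p (mps_coef0 h) -> invertible (v h).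
Proof.
move=> hv ph; apply: (invertible_mod_square_zero N2); rewrite liftsE //.
exact/invertible_rmorph/to_local_invertible.
Qed.

Let lifts_F v j : lifts v -> ideal_set N (v (F j)).
Proof. by move=> hv; apply/quot_proj0; rewrite liftsE // /iota to_local_F rmorph0. Qed.

Let lifts_eval (c : 'I_n -> C) :
  (forall i, quot_proj N (c i) = u (iota (mps_var A i))) ->
  exists v, lifts v /\ forall i, v (mps_var A i) = c i.
Proof.
move=> hc; have [|//|v [v_const v_var]] := @eval_nilpotent n A C (g \o loc_at_in p) c Q (k + k).
  move=> i; rewrite /= hc; apply: ideal_gen_sub.
  by exists (iota (mps_var A i)) => //; apply: to_local_var.
by exists v; split=> //; split=> // i; rewrite v_var.
Qed.

(** Newton iteration: the Jacobian matrix of the selected generators has the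
    right inverse U modulo p, so that correcting the images of the variables by
    - U F moves the values of the selected generators into a higher power of
    the nilpotent ideal Q. *)
Let newton t : exists v, lifts v /\
  forall l, ideal_set (ideal_mul (ideal_exp Q t) N) (v (F (f l))).
Proof.
elim: t => [|t [v [hv vF]]].
  have [|v [hv _]] := lifts_eval (c := fun i => repr (u (iota (mps_var A i)))).
    by move=> i; apply: quot_projK.
  exists v; split=> // l; rewrite -[v _]mul1r; apply: ideal_mulP; last exact: lifts_F.
  exact: ideal_exp0.
set E := ideal_mul (ideal_exp Q t) N in vF.
have EN : E `<=` N by apply: ideal_mul_subr.
pose kappa : {rmorphism loc_at p -> K} := quot_proj (loc_at_ideal p p).
pose U' i l : loc_at p := repr (U i l).
have U'E i l : kappa (U' i l) = U i l by apply: quot_projK.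
pose e i := - \sum_l g (U' i l) * v (F (f l)).
have Ee i : ideal_set E (e i).
  by apply: idealN; apply: ideal_sum => l; apply: idealM.
have [|v' [hv' v'_var]] := lifts_eval (c := fun i => v (mps_var A i) + e i).
  move=> i; apply: etrans (liftsE (mps_var A i) hv); apply/quot_projP.
  by rewrite addrC addKr; apply: EN.
exists v'; split=> // l.
suff: ideal_set (ideal_mul Q E) (v' (F (f l))) by apply: ideal_mulA.
have vv_const a : v' (mps_const n a) = v (mps_const n a) by rewrite hv'.1 hv.1.
have vv_var i : v' (mps_var A i) - v (mps_var A i) = e i by rewrite v'_var addrC addKr.
have taylor : ideal_set (ideal_mul Q E) (v' (F (f l)) - v (F (f l)) -
    \sum_i (v' (mps_var A i) - v (mps_var A i)) * v (mps_const n (F (f l) U_(i)%MM))).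
  apply: (hom_taylor vv_const _ _ _ Q0) => [i|i|].
  - by rewrite vv_var.
  - exact: lifts_var.
  by move=> x /EN/NQ.
apply: ideal_exchange (_ : ideal_set _ (v (F (f l)) + \sum_i e i * g (loc_at_in p (F (f l) U_(i)%MM)))).
  move: taylor; rewrite opprD addrA; congr ideal_set; congr (_ - _).
  by apply: eq_bigr => i _; rewrite vv_var hv.1.
pose z k' : loc_at p := (l == k')%:R - \sum_i loc_at_in p (F (f l) U_(i)%MM) * U' i k'.
have kz k' : kappa (z k') = 0.
  have h := congr1 (fun X : 'M_r => X l k') LU; rewrite !mxE in h.
  rewrite /z rmorphB rmorph_nat rmorph_sum -h; apply/eqP; rewrite subr_eq0; apply/eqP.
  by apply: eq_bigr => i _; rewrite rmorphM U'E !mxE.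
rewrite (_ : _ + _ = \sum_k' g (z k') * v (F (f k'))); last first.
  under [RHS]eq_bigr => k' _ do rewrite /z rmorphB mulrBl rmorph_sum mulr_suml.
  rewrite sumrB (bigD1 l) //= eqxx rmorph1 mul1r [X in _ = _ + X - _]big1 ?addr0 => [|k' kl]; last first.
    by rewrite eq_sym (negPf kl) rmorph0 mul0r.
  congr (_ + _); rewrite exchange_big -sumrN; apply: eq_bigr => i _.
  rewrite /e mulNr mulr_suml; congr (- _); apply: eq_bigr => k' _.
  by rewrite rmorphM; ring.
apply: ideal_sum => k'; apply: ideal_mulP; last exact: vF.
by apply: g_Q; apply/(quot_proj0 (loc_at_ideal p p)); apply: kz.
Qed.

(** A lift killing the selected generators kills all of them: the ideal V of C
    generated by the values of F satisfies V = Q V, and Q is nilpotent. *)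
Let lift_exists : exists v, lifts v /\ forall j, v (F j) = 0.
Proof.
have [v [hv vf]] := newton (k + k).
have vf0 l : v (F (f l)) = 0.
  apply: Q0; exact: ideal_mul_subl (vf l).
exists v; split=> //; pose V := ideal_gen (range (fun j => v (F j))).
have vI h : ideal_set (ideal_gen (range F)) h -> ideal_set V (v h).
  by apply: rmorph_ideal_gen => _ [j _ <-]; apply: ideal_gen_sub; exists j.
have vQ h : ideal_set (ideal_gen (@mps_const n A @` p)) h -> ideal_set Q (v h).
  apply: rmorph_ideal_gen => _ [a pa <-]; rewrite hv.1; apply: g_Q.
  by apply: ideal_gen_sub; exists a.
have VQV : V `<=` ideal_mul Q V.
  apply: ideal_gen_min => _ [j _ <-].
  have [s [b [T [q [y [ps qB yI]]]]]] := almost_generators hA flatF (k + k) (gens j).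
  have v_pI h : ideal_set (ideal_mul (ideal_gen (@mps_const n A @` p)) (ideal_gen (range F))) h ->
      ideal_set (ideal_mul Q V) (v h).
    apply: rmorph_ideal_gen => _ [h1 [h2 [ph1 Ih2 ->]]]; rewrite rmorphM.
    by apply: ideal_mulP; [apply: vQ | apply: vI].
  move=> /v_pI; rewrite !rmorphB !rmorph_sum [X in _ - X - _]big1 => [|l _]; last first.
    by rewrite rmorphM vf0 mulr0.
  rewrite [X in _ - X]big1 => [|t _]; last first.
    rewrite rmorphM (_ : v (q t) = 0) ?mul0r //; apply: Q0.
    by apply: hom_ord (qB t) => i; apply: lifts_var.
  rewrite !subr0 rmorphM; apply: ideal_invertible; apply: lifts_unit => //.
  by rewrite mps_coef0_const.
have VQt t : V `<=` ideal_mul (ideal_exp Q t) V.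
  elim: t => [|t IH] x Vx; first by rewrite -[x]mul1r; apply: ideal_mulP => //; apply: ideal_exp0.
  by apply: ideal_mulA; apply: ideal_mul_mono (VQV x Vx).
move=> j; apply: Q0; apply: (@ideal_mul_subl _ _ V); apply: VQt.
by apply: ideal_gen_sub; exists j.
Qed.

Lemma smooth_lift : exists w : {rmorphism Bn -> C},
  (forall c, w (structure_map_at hF p c) = g c) /\ forall y, quot_proj N (w y) = u y.
Proof.
have [v [hv vF]] := lift_exists.
have [//||w wE] := @to_local_lift _ _ _ F hF p _ v.
  by move=> h; apply: lifts_unit.
exists w; split; first by apply: structure_map_at_ext => a; rewrite wE hv.1.
apply: (to_local_ext (v := quot_proj N \o w)) => h.
by rewrite [LHS]/= wE liftsE.
Qed.

End Lifting.

Lemma generated_smooth : formally_smooth (structure_map_at hF p) nB.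
Proof.
by move=> C g N /square_zeroP N2 u ug [k uk]; apply: (smooth_lift N2 ug uk).
Qed.

End RegularSmooth.

Theorem regular_smooth (A : comPzRingType) n m (F : 'I_m -> mpseries n A)
    (hF : forall i, ideal_set (var_ideal n A) (F i)) (p : Spec A) :
  noetherian A -> flat_morphism (structure_map F) ->
  regular_local_ring (completed_fibre F p) ->
  formally_smooth (structure_map_at hF p) (loc_at_ideal (sigma hF p) (sigma hF p)).
Proof.
move=> hA flatF reg; have hK := residue_is_field p.
pose G j : mpseries n (residue_field p) := mps_map (to_residue_field p) (F j).
have [r [e [f [U [V [W [LU LW VW ULWV]]]]]]] :=
  linear_splitting (\matrix_(j, i) G j U_(i)%MM) hK.
apply: (generated_smooth hA flatF LU).
exact: (regular_generators hK (fibre_F1 hF p) LW VW ULWV reg).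
Qed.

Theorem lemma61 (A : comPzRingType) (n m : nat) (F : 'I_m -> mpseries n A)
  (hA : noetherian A)
  (hF : forall i : 'I_m, ideal_set (var_ideal n A) (F i))
  (hflat : flat_morphism (structure_map F)) :
  Sing_sigma hF =
  [set sigma hF p | p in
     [set p : Spec A | ~ regular_local_ring (completed_fibre F p)]].
Proof.
apply/seteqP; split=> _ [p hp <-]; exists p => // h; apply: hp.
  exact: regular_smooth.
exact: smooth_regular h.
Qed.
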